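(* Let $(\Omega,\mathcal A,P,S,\alpha)$ be a probability preserving fibred system which is $\vartheta_\mu$-mixing for some probability $\mu\sim P$ on $(\Omega,\mathcal A)$, and let $\varphi:\Omega\to\mathbb N$ be $\alpha$-measurable. Put $\varphi_n:=\sum_{k=1}^n\varphi\circ S^k$ and $a(n):=\sum_{k=1}^nP([\varphi_k\le n])$ for $n\ge 0$. Suppose that $a(n)$ is regularly varying with index $\gamma\in(0,1]$ and adapted to $(\vartheta_\mu(n))_{n\in\mathbb N}$, i.e. $\frac{n\,\vartheta_\mu(\delta a(n))}{a(n)}\to 0$ as $n\to\infty$ for all $\delta>0$. Let $b$ be asymptotically inverse to $a$, i.e. $b(a(n))\sim a(b(n))\sim n$ (so that $b$ is $\frac1\gamma$-regularly varying). (a) (Stable limit theorem) $\frac{\varphi_n}{b(n)}$ converges strongly in distribution to $Z_\gamma$ as $n\to\infty$. (b) (One-sided law of the iterated logarithm for $\gamma=1$) If, in addition, $\gamma=1$ and $b(n/\log\log n)\,\log\log n\sim b(n)$ as $n\to\infty$, then $$\liminf_{n\to\infty}\frac{\varphi_n}{b(n)}=1\quad P\text{-a.s.}$$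
   Context: A fibred system $(\Omega,\mathcal A,m,S,\alpha)$ consists of a nonsingular transformation $S$ of a $\sigma$-finite measure space $(\Omega,\mathcal A,m)$ (i.e. $S$ is measurable and $m\circ S^{-1}\ll m$) and a countable partition $\alpha\subset\mathcal A$ of $\Omega$ (mod $m$) which is a unilateral generator (the sets $S^{-n}a$, $a\in\alpha$, $n\ge0$, generate $\mathcal A$ mod $m$), such that for each $a\in\alpha$ the restriction $S:a\to Sa$ is invertible and nonsingular. It is probability preserving if $m=P$ is an $S$-invariant probability. Put $\alpha_k:=\bigvee_{j=0}^{k-1}S^{-j}\alpha$. $\mathbb N=\{1,2,\dots\}$. For a probability measure $\mu$ on $(\Omega,\mathcal A)$ with $\mu\sim P$ (mutual absolute continuity), let $$\vartheta_\mu(n):=\sup\left\{\frac{|P(A\cap S^{-(n+k)}B)-P(A)P(B)|}{\mu(B)}:\ k\ge1,\ A\in\sigma(\alpha_k),\ B\in\mathcal A,\ \mu(B)>0\right\}.$$ The system is $\vartheta_\mu$-mixing if $\vartheta_\mu(n)\to0$. Functions defined on integers are evaluated at real arguments via integer parts. $a(n)$ is $\gamma$-regularly varying if $a(cn)/a(n)\to c^\gamma$ for all $c>0$. $u_n\sim v_n$ means $u_n/v_n\to1$. Strong convergence in distribution of measurable $F_n:\Omega\to[0,\infty]$ to a random variable $Y\ge0$ means: $\int g(F_n)\,dQ\to\mathbb E(g(Y))$ for all $g\in C([0,\infty])$ and all probability measures $Q\ll P$ on $(\Omega,\mathcal A)$. For $\gamma\in[0,1]$, $Y_\gamma\ge0$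 denotes a random variable with the normalized Mittag-Leffler distribution of order $\gamma$: $\mathbb E(Y_\gamma^p)=\frac{p!\,\Gamma(1+\gamma)^p}{\Gamma(1+p\gamma)}$ for integers $p\ge0$. For $\gamma\in(0,1]$, $Z_\gamma:=Y_\gamma^{-1/\gamma}$ (a positive $\gamma$-stable random variable; $Z_1\equiv1$). *)

(* Defs.v *)
From HB Require Import structures.
From mathcomp Require Import all_boot all_order all_algebra.
From mathcomp Require Import all_classical all_reals all_analysis.
Set Implicit Arguments.
Unset Strict Implicit.
Unset Printing Implicit Defensive.
Import Order.TTheory GRing.Theory Num.Theory.
Import numFieldNormedType.Exports.

Local Open Scope classical_set_scope.
Local Open Scope ring_scope.

Section fibred_systems.
Context {d : measure_display} {T : measurableType d} {R : realType}.

(* The map S, restricted to D, is measurable and nonsingular.  With D = setT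
   the second clause says m \o S^-1 << m. *)
Definition nonsingular_on (m : set T -> \bar R) (D : set T) (S : T -> T) :=
  measurable_fun D S /\ (fun B => m (D `&` S @^-1` B)) `<< m.

(* Injectivity on a together with measurability of the inverse S a -> a (for
   A = a: the image S a is measurable). *)
Definition invertible_on (a : set T) (S : T -> T) :=
  set_inj a S /\
  forall A, measurable A -> A `<=` a -> measurable (S @` A).

(* A partition mod m: distinct cells meet in a null set and the cells cover
   up to a null set. *)
Record ae_partition (m : set T -> \bar R) (alpha : set (set T)) : Prop := {
  ae_partition_countable : countable alpha ;
  ae_partition_measurable : alpha `<=` measurable ;
  ae_partition_disjoint : forall a b, alpha a -> alpha b -> a != b ->
    m (a `&` b) = 0%E ;
  ae_partition_cover : m (~` \bigcup_(a in alpha) a) = 0%E }.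

(* The sets S^-n a generate the sigma-algebra mod m. *)
Definition unilateral_generator (m : set T -> \bar R) (S : T -> T)
    (alpha : set (set T)) :=
  forall A, measurable A -> exists2 B,
    <<s [set iter n S @^-1` a | n in [set: nat] & a in alpha] >> B &
    m (A `+` B) = 0%E.

Record fibred_system (m : {sigma_finite_measure set T -> \bar R})
    (S : T -> T) (alpha : set (set T)) : Prop := {
  fibred_nonsingular : nonsingular_on m setT S ;
  fibred_partition : ae_partition m alpha ;
  fibred_generator : unilateral_generator m S alpha ;
  fibred_branch : forall a, alpha a ->
    invertible_on a S /\ nonsingular_on m a S }.

Definition probability_preserving_fibred_system (P : probability T R)
    (S : T -> T) (alpha : set (set T)) :=
  fibred_system P S alpha /\
  forall A, measurable A -> P (S @^-1` A) = P A.

(* alpha_k, the join of the partitions S^-j alpha for 0 <= j < k *)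
Definition join_partition (S : T -> T) (alpha : set (set T)) (k : nat) :
    set (set T) :=
  [set \bigcap_(j in `I_k) iter j S @^-1` c j |
    c in [set c : nat -> set T | forall j, (j < k)%N -> alpha (c j)]].

Definition equivalent_measures (mu P : set T -> \bar R) :=
  mu `<< P /\ P `<< mu.

(* The supremum may be +oo, hence the extended real value. *)
Definition theta_coef (P mu : probability T R) (S : T -> T)
    (alpha : set (set T)) (n : nat) : \bar R :=
  ereal_sup [set r | exists k A B,
    [/\ (1 <= k)%N, <<s join_partition S alpha k >> A, measurable B,
        (0 < mu B)%E &
        r = (`|fine (P (A `&` iter (n + k) S @^-1` B))
               - fine (P A) * fine (P B)| / fine (mu B))%:E ]].

Definition theta_mixing (P mu : probability T R) (S : T -> T)
    (alpha : set (set T)) :=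
  theta_coef P mu S alpha n @[n --> \oo] --> 0%E.

Definition partition_measurable (alpha : set (set T)) (phi : T -> nat) :=
  forall B : set nat, <<s alpha >> (phi @^-1` B).

(* The sum starts at phi \o S, not at phi. *)
Definition ergodic_sum (S : T -> T) (phi : T -> nat) (n : nat) (x : T) : nat :=
  (\sum_(1 <= k < n.+1) phi (iter k S x))%N.

Definition occupation (P : probability T R) (S : T -> T) (phi : T -> nat)
    (n : nat) : R :=
  \sum_(1 <= k < n.+1) fine (P [set x | (ergodic_sum S phi k x <= n)%N]).

End fibred_systems.

Section asymptotics.
Context {R : realType}.

(* Evaluation at the integer part; truncn sends negative reals to 0. *)
Definition at_real (V : Type) (u : nat -> V) (x : R) : V := u (Num.truncn x).

Definition asymp_equiv (u v : nat -> R) := u n / v n @[n --> \oo] --> (1 : R).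

Definition regularly_varying (u : nat -> R) (gamma : R) :=
  forall c : R, 0 < c ->
    at_real u (c * n%:R) / u n @[n --> \oo] --> c `^ gamma.

Definition asymp_inverse (a b : nat -> R) :=
  asymp_equiv (fun n => at_real b (a n)) (fun n => n%:R) /\
  asymp_equiv (fun n => at_real a (b n)) (fun n => n%:R).

Definition adapted (a : nat -> R) (theta : nat -> \bar R) :=
  forall delta : R, 0 < delta ->
    ((n%:R / a n)%:E * at_real theta (delta * a n))%E @[n --> \oo] --> 0%E.

End asymptotics.

Section distributions.
Context {R : realType}.

Definition Gamma (x : R) : R :=
  Rintegral lebesgue_measure `]0, +oo[%classic
    (fun t : R => t `^ (x - 1) * expR (- t)).

(* Moments determine this distribution, gamma being in [0, 1]. *)
Definition mittag_leffler {d : measure_display} {W : measurableType d}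
    (Q : probability W R) (Y : {RV Q >-> R}) (gamma : R) :=
  (forall w, 0 <= Y w) /\
  forall p : nat, ('E_Q[fun w => (Y w ^+ p)%R])%E =
    (p`!%:R * Gamma (1 + gamma) ^+ p / Gamma (1 + p%:R * gamma))%:E.

(* Y^(-1/gamma), with value +oo (the library's inverse of 0) where Y = 0. *)
Definition stable_of {W : Type} (Y : W -> R) (gamma : R) (w : W) : \bar R :=
  ((Y w `^ gamma^-1)%:E)^-1%E.

Definition strongly_converges {d d' : measure_display}
    {T : measurableType d} {W : measurableType d'}
    (P : probability T R) (F : nat -> T -> \bar R)
    (P' : probability W R) (Z : W -> \bar R) :=
  forall g : \bar R -> R,
    {within [set x | (0 <= x)%E], continuous g} ->
    forall Q : probability T R, Q `<< P ->
      ('E_Q[fun x => g (F n x)])%E @[n --> \oo] -->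
      ('E_P'[fun w => g (Z w)])%E.

End distributions.

(* Main.v *)
(* Let f_n(k) = E exp(-phi_k / x_n) with x_n = b(n) / lam.  Mixing makes f_n
   almost multiplicative in k, and Karamata's Abelian theorem gives
   sum_k f_n(k) ~ c n with c = Gamma(1 + gamma) lam^(-gamma).  The adaptedness
   of a bounds the error made over gaps of length delta a(x_n), so a renewal
   argument forces f_n(n) -> exp(-1/c).  Mixing upgrades this to convergence
   under every Q << P.  The limit is E exp(-lam Y^(-1/gamma)): for X exponential
   and independent of Y, X^gamma Y / lam^gamma has exponential moments, hence an
   exponential law.  Weierstrass approximation in u = e^(-t) then gives (a).

   In (b), the limit law is degenerate, so phi_n / b(n) -> 1 in probability and
   the liminf is at most 1.  For the lower bound, [1, n] is cut into about
   log log n blocks of length m = n / log log n separated by gaps of fixed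
   length.  The mixing error is controlled by mu, which is comparable to P only
   on a set E of almost full measure; blocks starting outside E are rare by the
   maximal ergodic inequality.  Chernoff's bound then gives probability at most
   (log n)^(-2) to phi_n <= (1 - eps) b(n), which is summable along n = e^(jt). *)

Require Import Defs.
From HB Require Import structures.
From mathcomp Require Import all_boot all_order all_algebra.
From mathcomp Require Import all_classical all_reals all_analysis.
From mathcomp Require Import measurable_realfun.
From mathcomp Require Import ring lra zify.
Import Order.TTheory GRing.Theory Num.Theory.
Import numFieldNormedType.Exports.
Local Open Scope classical_set_scope.
Local Open Scope ring_scope.

(** * Weierstrass approximation *)

(** Two different defects of multiplicativity enter the renewal argument. Over a long gap the error
    carries the weight e^(-l / x_n), because phi >= 1 bounds the second factor by it; summed over l
    it costs theta x_n, and adaptedness makes this o(n) while the gap is still of order n. Over a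
    fixed gap h the error is theta(h) plus the cost of deleting h + 1 terms, which vanishes as n
    grows. Limits are taken along ultrafilters, so that f_n(n / q) has a limit for every q before
    any convergence is known. In (b) the obstacle is that an error theta mu(B) need not shrink with
    P(B), so it could not be iterated over a growing number of blocks. Where the density of mu is at
    most M it becomes theta M P(B), a fixed fraction of the main term, and a constant gap suffices.
    The maximal inequality counts visits at all times and not at block starts; Chernoff's bound is
    therefore averaged over all phases of the block decomposition. *)

Section ultralimits.
Context {R : realType}.
Implicit Types (u v : nat -> R) (l : R).

(** If a neighbourhood of [l] were not eventually entered, the tails intersected with the
    exceptional indices would generate a proper filter, and an ultrafilter above it would contradict
    the hypothesis. *)
Lemma cvg_ultra u l :
  (forall U : set_system nat, UltraFilter U -> \oo `<=` U -> u @ U --> l) ->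
  u @ \oo --> l.
Proof.
move=> h A Al; apply: contrapT => /= nA.
pose F : set_system nat := [set B | exists2 N, \oo N & N `&` ~` (u @^-1` A) `<=` B].
have FF : ProperFilter F.
  split.
    move=> [N NF sub]; apply: nA; apply: filterS NF => n Nn.
    by apply: contrapT => nAn; apply: (sub n).
  split.
  - by exists setT => //; exact: filterT.
  - move=> B C [N1 h1 s1] [N2 h2 s2]; exists (N1 `&` N2); first exact: filterI.
    by move=> x [[? ?] ?]; split; [apply: s1|apply: s2].
  - by move=> B C BC [N1 h1 s1]; exists N1 => //; exact: subset_trans BC.
have [U [UU FU]] := ultraFilterLemma FF.
have Uoo : \oo `<=` U.
  by move=> N hN; apply: FU; exists N => // x [].
have UA : U (u @^-1` A) := h U UU Uoo A Al.
have UnA : U (~` (u @^-1` A)).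
  by apply: FU; exists setT; [exact: filterT|move=> x []].
have [x [? ?]] := filter_ex (filterI UA UnA).
by [].
Qed.

Lemma ultra_image_map u (U : set_system nat) : UltraFilter U ->
  UltraFilter (u @ U).
Proof.
move=> UU; split; first exact: fmap_proper_filter.
move=> G GF sub; rewrite predeqE => A; split; last exact: sub.
move=> GA; have [//|h] := in_ultra_setVsetC (u @^-1` A) UU.
have GnA : G (~` A) by apply: sub.
by have [x []] := filter_ex (filterI GA GnA).
Qed.

(** Compactness of the segment. Infinitely many bounded sequences thus have limits along the same
    [U], with no extraction of subsequences. *)
Lemma ultra_cvg u (a b : R) (U : set_system nat) : UltraFilter U ->
  (forall n, a <= u n <= b) -> exists2 l, a <= l <= b & u @ U --> l.
Proof.
move=> UU uab.
have := @segment_compact R a b; rewrite compact_ultra.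
move=> /(_ (u @ U) (ultra_image_map u U UU)) [].
  change (U (u @^-1` `[a, b])); apply: filterE => n.
  by rewrite /= in_itv /=; exact: uab.
by move=> l [/=]; rewrite in_itv /= => ? ?; exists l.
Qed.

Lemma exists_ultra_infty :
  exists2 U : set_system nat, UltraFilter U & \oo `<=` U.
Proof. by have [U [? ?]] := @ultraFilterLemma _ (\oo : set_system nat) _; exists U. Qed.

End ultralimits.

Section weierstrass.
Context {R : realType}.

(** By contradiction with [K = n]: take limits [p] and [q] of the offending pairs along an
    ultrafilter. They coincide, for otherwise [n * (u - x) ^+ 2] would outgrow the bounded
    differences of [G]; then continuity at [p] contradicts the gap [e]. *)
Lemma within_quadratic (G : R -> R) (e : R) : 0 < e ->
  {within `[0, 1], continuous G} ->
  exists2 K, 0 <= K & forall u x, 0 <= u <= 1 -> 0 <= x <= 1 ->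
    `|G u - G x| <= e + K * (u - x) ^+ 2.
Proof.
move=> e0 /subspace_continuousP cG; apply: contrapT => nK.
have /choice[ux Hux] : forall n : nat, exists p : R * R,
    [/\ 0 <= p.1 <= 1, 0 <= p.2 <= 1 & e + n%:R * (p.1 - p.2) ^+ 2 < `|G p.1 - G p.2|].
  move=> n; apply: contrapT => nP; apply: nK; exists n%:R => // u x u01 x01.
  by rewrite leNgt; apply/negP => h; apply: nP; exists (u, x).
pose u n := (ux n).1; pose x n := (ux n).2.
have [U UU Uoo] := exists_ultra_infty.
have [p p01 up] := @ultra_cvg _ u 0 1 U UU (fun n => let: And3 a _ _ := Hux n in a).
have [q q01 xq] := @ultra_cvg _ x 0 1 U UU (fun n => let: And3 _ b _ := Hux n in b).
have cvgG (v : nat -> R) (w : R) : (forall n, 0 <= v n <= 1) -> 0 <= w <= 1 -> v @ U --> w ->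
    G (v n) @[n --> U] --> G w.
  move=> v01 w01 vw.
  have := cG w; rewrite /= in_itv /= => /(_ w01); apply: cvg_trans.
  move=> A /= wA; have h : U (fun n => `[0, 1]%classic (v n) -> A (G (v n))) by exact: (vw _ wA).
  have: U (fun n => A (G (v n))); last by [].
  apply: filterS h => n /=; apply.
  by rewrite in_itv /= v01.
have Gu : G (u n) @[n --> U] --> G p by apply: cvgG => // n; case: (Hux n).
have Gx : G (x n) @[n --> U] --> G q by apply: cvgG => // n; case: (Hux n).
have d1 : `|G (u n) - G (x n)| @[n --> U] --> `|G p - G q|.
  by apply: cvg_norm; exact: cvgB.
have d2 : (u n - x n) ^+ 2 @[n --> U] --> (p - q) ^+ 2.
  by rewrite expr2; under eq_fun do rewrite expr2; apply: cvgM; exact: cvgB.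
have pq : p = q.
  apply/eqP; rewrite -subr_eq0 -sqrf_eq0 eq_le sqr_ge0 andbT.
  apply: contrapT => /negP; rewrite -ltNge => pq0.
  pose D := `|G p - G q|.
  have [N hN] : exists N : nat, (D + 1) / ((p - q) ^+ 2 / 2) < N%:R.
    by exists (Num.bound ((D + 1) / ((p - q) ^+ 2 / 2))); rewrite archi_boundP// divr_ge0// ?addr_ge0 ?normr_ge0// divr_ge0// ltW.
  have /filter_ex [n [[h1 h2] h3]] : U [set n | (`|G (u n) - G (x n)| < D + 1 /\
      (p - q) ^+ 2 / 2 < (u n - x n) ^+ 2) /\ (N <= n)%N].
    apply: filterI; last by apply: Uoo; exists N.
    apply: filterI.
      by apply: (cvgr_lt _ d1); rewrite ltrDl.
    by apply: (cvgr_gt _ d2); rewrite ltr_pdivrMr// ltr_pMr// ltr1n.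
  have [_ _] := Hux n; rewrite -/(u n) -/(x n); apply/negP; rewrite -leNgt.
  rewrite (le_trans (ltW h1))//.
  move: hN; rewrite ltr_pdivrMr ?divr_gt0// => hN.
  rewrite (le_trans (ltW hN))// -[leLHS]add0r lerD ?(ltW e0)//.
  by rewrite ler_pM// ?divr_ge0 ?ler_nat// ltW.
have : e <= `|G p - G q|.
  apply: (cvgr_to_ge d1).
  apply: filterE => n; have [_ _ h] := Hux n; apply: ltW; apply: le_lt_trans h.
  by rewrite lerDl mulr_ge0// sqr_ge0.
by rewrite pq subrr normr0 leNgt e0.
Qed.

(** The mean of [h] under the binomial law with [n] trials and success probability [x], by
    conditioning on one trial. For [h j = G (j / n)] it is the Bernstein polynomial of [G]. *)
Fixpoint bern (n : nat) (h : nat -> R) (x : R) : R :=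
  if n is m.+1 then x * bern m (fun j => h j.+1) x + (1 - x) * bern m h x
  else h 0%N.

Lemma bern_poly n h : exists p : {poly R}, forall x, bern n h x = p.[x].
Proof.
elim: n h => [|n IH] h /=; first by exists (h 0%N)%:P => x; rewrite hornerC.
have [p hp] := IH (fun j => h j.+1); have [q hq] := IH h.
by exists ('X * p + (1 - 'X) * q) => x; rewrite hp hq !hornerE.
Qed.

Lemma bern_le n h1 h2 x : 0 <= x <= 1 -> (forall j, (j <= n)%N -> h1 j <= h2 j) ->
  bern n h1 x <= bern n h2 x.
Proof.
move=> /andP[x0 x1]; elim: n h1 h2 => [|n IH] h1 h2 h12 /=; first exact: h12.
apply: lerD; apply: ler_wpM2l; rewrite ?subr_ge0//; apply: IH => j jn; apply: h12 => //.
by rewrite leqW.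
Qed.

Lemma bernD n h1 h2 x : bern n (fun j => h1 j + h2 j) x = bern n h1 x + bern n h2 x.
Proof. by elim: n h1 h2 => [|n IH] h1 h2 //=; rewrite !IH; ring. Qed.

Lemma bernZ n c h x : bern n (fun j => c * h j) x = c * bern n h x.
Proof. by elim: n h => [|n IH] h //=; rewrite !IH; ring. Qed.

Lemma bern_cst n c x : bern n (fun=> c) x = c.
Proof. by elim: n => [|n IH] //=; rewrite !IH; ring. Qed.

(** Variance plus squared bias of the binomial law. The centre [y] is free because conditioning on a
    success moves it to [y - 1]. *)
Lemma bern_sqr n y x :
  bern n (fun j => (j%:R - y) ^+ 2) x = n%:R * (x * (1 - x)) + (n%:R * x - y) ^+ 2.
Proof.
elim: n y => [|n IH] y /=; first by ring.
have -> : (fun j : nat => (j.+1%:R - y) ^+ 2) = (fun j => (j%:R - (y - 1)) ^+ 2).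
  by apply/funext => j; rewrite -natr1; congr (_ ^+ 2); ring.
by rewrite !IH -natr1; ring.
Qed.

(* Bernstein's argument: the quadratic modulus above turns the variance of the
   binomial law into a uniform bound. *)
Lemma weierstrass (G : R -> R) (e : R) : 0 < e ->
  {within `[0, 1], continuous G} ->
  exists p : {poly R}, forall x, 0 <= x <= 1 -> `|G x - p.[x]| <= e.
Proof.
move=> e0 cG; have e20 : 0 < e / 2 by rewrite divr_gt0.
have [K K0 hK] := within_quadratic G (e / 2) e20 cG.
pose n := (Num.bound (K / (e / 2))).+1.
have n0 : 0 < n%:R :> R by rewrite ltr0n.
have Kn : K / n%:R <= e / 2.
  rewrite ler_pdivrMr// mulrC -ler_pdivrMr//.
  apply: ltW; apply: (lt_trans (archi_boundP _)); first by rewrite divr_ge0// ltW.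
  by rewrite ltr_nat.
have [p hp] := bern_poly n (fun j => G (j%:R / n%:R)).
exists p => x x01; rewrite -hp.
have key j : (j <= n)%N -> `|G (j%:R / n%:R) - G x| <= e / 2 + K / n%:R ^+ 2 * (j%:R - n%:R * x) ^+ 2.
  move=> jn; apply: (le_trans (hK _ _ _ x01)).
    by rewrite divr_ge0//= ler_pdivrMr// mul1r ler_nat.
  rewrite lerD2l -mulrA ler_wpM2l// -exprVn -exprMn.
  have -> : n%:R^-1 * (j%:R - n%:R * x) = j%:R / n%:R - x by field; rewrite gt_eqF.
  by [].
have bnd : bern n (fun j => e / 2 + K / n%:R ^+ 2 * (j%:R - n%:R * x) ^+ 2) x <= e.
  rewrite bernD bern_cst bernZ bern_sqr subrr expr0n /= addr0.
  rewrite [leRHS](splitr e) lerD2l; apply: le_trans Kn.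
  have -> : K / n%:R ^+ 2 * (n%:R * (x * (1 - x))) = K / n%:R * (x * (1 - x)).
    by field; rewrite gt_eqF.
  rewrite ler_piMr ?divr_ge0//; move/andP: x01 => [x0 x1].
  by nra.
rewrite ler_norml; apply/andP; split.
- rewrite lerBrDl.
  suff : bern n (fun j => G (j%:R / n%:R)) x <= bern n (fun j => G x + (e / 2 + K / n%:R ^+ 2 * (j%:R - n%:R * x) ^+ 2)) x.
    by rewrite bernD bern_cst => h; move: bnd h; lra.
  apply: bern_le => // j jn; have := key j jn; rewrite ler_norml => /andP[_]; lra.
- have : bern n (fun j => G x) x <= bern n (fun j => G (j%:R / n%:R) + (e / 2 + K / n%:R ^+ 2 * (j%:R - n%:R * x) ^+ 2)) x.
    apply: bern_le => // j jn; have := key j jn; rewrite ler_norml => /andP[]; lra.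
  rewrite bernD bern_cst; move: bnd; lra.
Qed.

End weierstrass.

(** * Renewal inequalities *)

Section renewal_core.
Context {R : realType}.

(** A lower Riemann sum of e^(-s/x) over the half-line. The induction runs on the sharper bound
    [x * (1 - expR (- (M / x)))], which telescopes. This turns a mixing error decaying like e^(-l/x)
    into a total of theta x. *)
Lemma sum_exp_le (x : R) (M : nat) : 0 < x ->
  \sum_(1 <= l < M.+1) expR (- (l%:R / x)) <= x.
Proof.
move=> x0.
suff : \sum_(1 <= l < M.+1) expR (- (l%:R / x)) <= x * (1 - expR (- (M%:R / x))).
  move=> /le_trans; apply.
  by rewrite mulrBr mulr1 lerBlDr lerDl mulr_ge0 ?expR_ge0 ?ltW.
elim: M => [|M IH]; first by rewrite big_nil mul0r oppr0 expR0 subrr mulr0.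
rewrite big_nat_recr//=; apply: le_trans (lerD IH (lexx _)) _.
have -> : expR (- (M%:R / x)) = expR (- (M.+1%:R / x)) * expR x^-1.
  by rewrite -expRD; congr expR; rewrite -natr1; field; rewrite gt_eqF.
have h1 : 1 <= x * (expR x^-1 - 1).
  have := expR_ge1Dx x^-1; rewrite -lerBrDl => /(ler_wpM2l (ltW x0)).
  by rewrite divff ?gt_eqF.
set E := expR _; have E0 : 0 <= E by rewrite /E ltW// expR_gt0.
by have := ler_wpM2r E0 h1; rewrite mul1r; lra.
Qed.

Lemma cvg_sumr (I : Type) (s : seq I) (F : set_system nat) (u : I -> nat -> R) (l : I -> R) :
  Filter F -> (forall i, u i @ F --> l i) ->
  \sum_(i <- s) u i n @[n --> F] --> \sum_(i <- s) l i.
Proof.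
move=> FF ul; elim: s => [|i s IH].
  by rewrite big_nil; under eq_fun do rewrite big_nil; exact: cvg_cst.
by rewrite big_cons; under eq_fun do rewrite big_cons; exact: cvgD.
Qed.

Lemma cvg_squeeze_nat_frac (q : nat) : (0 < q)%N ->
  (n %/ q)%:R / n%:R @[n --> \oo] --> (q%:R^-1 : R).
Proof.
move=> q0; have q0R : 0 < q%:R :> R by rewrite ltr0n.
apply: (@squeeze_cvgr _ _ _ _ (fun n => q%:R^-1 - n%:R^-1) (fun=> q%:R^-1)); last 2 first.
- rewrite -[X in _ --> X]subr0; apply: cvgB; first exact: cvg_cst.
  apply/gtr0_cvgV0; last exact: cvgr_idn.
  by near=> n; rewrite ltr0n; near: n; exists 1%N.
- exact: cvg_cst.
near=> n.
have n0 : 0 < n%:R :> R by rewrite ltr0n; near: n; exists 1%N.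
apply/andP; split.
- rewrite ler_pdivlMr// mulrBl mulVf ?gt_eqF// lerBlDr.
  rewrite -(ler_pM2l q0R) mulrA divff ?gt_eqF// mul1r mulrDr mulr1 -!natrM -natrD ler_nat.
  by rewrite mulnC; have := divn_eq n q; have := ltn_pmod n q0; lia.
- rewrite ler_pdivrMr// -(ler_pM2l q0R) mulrA divff ?gt_eqF// mul1r -natrM ler_nat mulnC.
  exact: leq_divM.
Unshelve. all: by end_near. Qed.

(** The renewal argument freed from the dynamics: [f n k] stands for the mean of e^(-phi_k / x n),
    and [A n] for its sum over [k >= 1]. [f_gap] serves the long gap [g n], its error being summable
    in [l]; [f_mul] serves a fixed gap [h], where [1 - f n h.+1] tends to 0. *)
Variables (f : nat -> nat -> R) (theta : nat -> R) (x A : nat -> R).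
Variables (g0 : nat) (g : nat -> nat) (c : R).
Hypothesis f01 : forall n k, 0 <= f n k <= 1.
Hypothesis f_dec : forall n k l, (k <= l)%N -> f n l <= f n k.
Hypothesis fn0 : forall n, f n 0%N = 1.
Hypothesis f_gap : \forall n \near \oo, forall k l h, (g0 <= h)%N ->
  f n (k + h.+1 + l)%N <= f n k * f n l + theta h * expR (- (l%:R / x n)).
Hypothesis f_mul : \forall n \near \oo, forall k l h, (g0 <= h)%N ->
  `|f n (k + l)%N - f n k * f n l| <= theta h + 2 * (1 - f n h.+1).
Hypothesis f_cvg1 : forall k, f n k @[n --> \oo] --> (1 : R).
Hypothesis fA : \forall n \near \oo,
  \sum_(1 <= k < K.+1) f n k @[K --> \oo] --> A n.
Hypothesis Ac : A n / n%:R @[n --> \oo] --> c.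
Hypothesis c0 : 0 < c.
Hypothesis x0 : \forall n \near \oo, 0 < x n.
Hypothesis theta0 : forall h, 0 <= theta h.
Hypothesis theta_cvg0 : theta @ \oo --> (0 : R).
Hypothesis g_bnd : \forall n \near \oo, (g0 <= g n <= 2 * n)%N.
Hypothesis theta_x : theta (g n) * x n / n%:R @[n --> \oo] --> (0 : R).

Let Sm n K := \sum_(1 <= k < K.+1) f n k.

Let f_ge0 n k : 0 <= f n k. Proof. by have /andP[] := f01 n k. Qed.
Let f_le1 n k : f n k <= 1. Proof. by have /andP[] := f01 n k. Qed.

Let Sm_le n K L : (K <= L)%N -> Sm n K <= Sm n L.
Proof.
move=> KL; rewrite /Sm (@big_cat_nat _ _ _ K.+1 1 L.+1)//= lerDl.
by rewrite sumr_ge0.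
Qed.

Let Sm_leA : \forall n \near \oo, forall K, Sm n K <= A n.
Proof.
apply: filterS fA => n hn K.
apply: (cvgr_to_ge hn); exists K => // L /= KL; exact: Sm_le.
Qed.

(** Monotonicity gives [f n K <= A n / K] at [K = C n]. Beyond [K] and a gap [g n], [f_gap] bounds
    the remaining sum by [f n K * A n + theta (g n) * x n]. As [g n <= 2 n], the terms set aside
    stop before [(C + 3) n]. *)
Let tail C : (0 < C)%N -> \forall n \near \oo,
  A n / n%:R <= Sm n ((C + 3) * n)%N / n%:R + (A n / n%:R) ^+ 2 / C%:R
    + theta (g n) * x n / n%:R.
Proof.
move=> C0; have C0R : 0 < C%:R :> R by rewrite ltr0n.
near=> n.
have n0 : (0 < n)%N by near: n; exists 1%N.
have n0R : 0 < n%:R :> R by rewrite ltr0n.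
have /andP[gg gn] : (g0 <= g n <= 2 * n)%N by near: n.
have SA : forall K, Sm n K <= A n by near: n; exact: Sm_leA.
have A0 : 0 <= A n by apply: le_trans (SA 0%N); rewrite /Sm big_nil.
have xn0 : 0 < x n by near: n.
have hA : Sm n K @[K --> \oo] --> A n by near: n; exact: fA.
pose K := (C * n)%N.
have hK : f n K <= A n / (C%:R * n%:R).
  rewrite ler_pdivlMr ?mulr_gt0// -natrM -/K; apply: le_trans (SA K).
  rewrite /Sm mulr_natr -[X in _ *+ X](subn0) -[X in _ *+ X]subSS -sumr_const_nat.
  apply: ler_sum_nat => i /andP[i1 iK].
  exact: f_dec.
have hM M : Sm n (K + (g n).+1 + M) <= Sm n (K + (g n).+1) + (f n K * A n + theta (g n) * x n).
  rewrite /Sm (@big_cat_nat _ _ _ (K + (g n).+1).+1)//=; last by rewrite ltnS leq_addr.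
  rewrite lerD2l.
  have -> : \sum_((K + (g n).+1).+1 <= i < (K + (g n).+1 + M).+1) f n i =
      \sum_(1 <= l < M.+1) f n (K + (g n).+1 + l)%N.
    rewrite -[in LHS]add1n -[X in \sum_(_ <= _ < X) _]addn1 -addnA addn1.
    rewrite [X in \sum_(_ <= _ < X) _]addnC big_addn; last first.
    by rewrite addnK; apply: eq_bigr => i _; rewrite addnC.
  apply: (@le_trans _ _ (\sum_(1 <= l < M.+1) (f n K * f n l + theta (g n) * expR (- (l%:R / x n))))).
    apply: ler_sum => l _.
    have : forall k l h, (g0 <= h)%N -> f n (k + h.+1 + l)%N <= f n k * f n l + theta h * expR (- (l%:R / x n)).
      by near: n.
    by apply.
  rewrite big_split/= -!mulr_sumr; apply: lerD; apply: ler_wpM2l => //.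
    exact: SA.
  exact: sum_exp_le.
have hA2 : A n <= Sm n (K + (g n).+1) + (f n K * A n + theta (g n) * x n).
  apply: (cvgr_to_le hA); exists (K + (g n).+1)%N => // L /= KL.
  by rewrite -(subnKC KL).
have hS : Sm n (K + (g n).+1) <= Sm n ((C + 3) * n)%N.
  by apply: Sm_le; rewrite /K mulnDl leq_add2l; lia.
rewrite ler_pdivrMr// !mulrDl !divfK ?gt_eqF//.
apply: (le_trans hA2); rewrite -addrA; apply: lerD => //; rewrite lerD2r.
apply: (@le_trans _ _ (A n / (C%:R * n%:R) * A n)); first exact: ler_wpM2r.
by rewrite le_eqVlt; apply/orP; left; apply/eqP; field; rewrite !gt_eqF.
Unshelve. all: by end_near. Qed.

(** [h] is fixed first, to make [theta h] small; only then does [n] grow, to make [1 - f n h.+1]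
    small. Hence [k] and [l] may be arbitrary sequences. *)
Let asymp_mul (k l : nat -> nat) :
  f n (k n + l n)%N - f n (k n) * f n (l n) @[n --> \oo] --> (0 : R).
Proof.
apply/cvgrPdist_le => e e0; have e20 : 0 < e / 2 by rewrite divr_gt0.
have [h gh th] : exists2 h, (g0 <= h)%N & theta h <= e / 2.
  have : \forall h \near \oo, (g0 <= h)%N /\ theta h <= e / 2.
    near=> h; split; first by near: h; exists g0.
    by near: h; exact: (cvgr_le _ theta_cvg0).
  by move=> /filter_ex[h []]; exists h.
have := f_cvg1 h.+1; move/cvgr_ge => /(_ (1 - e / 4)).
have -> : 1 - e / 4 < 1 by rewrite ltrBlDr ltrDl divr_gt0.
move=> /(_ isT) hge.
near=> n; rewrite sub0r normrN.
have hm : `|f n (k n + l n)%N - f n (k n) * f n (l n)| <= theta h + 2 * (1 - f n h.+1).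
  have : forall k l h, (g0 <= h)%N ->
    `|f n (k + l)%N - f n k * f n l| <= theta h + 2 * (1 - f n h.+1) by near: n.
  by apply.
have : 1 - e / 4 <= f n h.+1 by near: n; exact: hge.
move: th hm; lra.
Unshelve. all: by end_near. Qed.

Section along.
Variables (U : set_system nat) (UU : UltraFilter U) (Uoo : \oo `<=` U).

Let toU (u : nat -> R) (l : R) : u @ \oo --> l -> u @ U --> l.
Proof. by move=> ul B /ul; exact: Uoo. Qed.

Let pow_lim q (p : R) : f n (n %/ q)%N @[n --> U] --> p ->
  forall j, f n (j * (n %/ q))%N @[n --> U] --> p ^+ j.
Proof.
move=> hp; elim=> [|j IH].
  by under eq_fun do rewrite mul0n fn0; exact: cvg_cst.
rewrite exprSr.
have -> : (fun n => f n (j.+1 * (n %/ q))%N) = (fun n =>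
    (f n (j * (n %/ q) + n %/ q)%N - f n (j * (n %/ q))%N * f n (n %/ q)%N) +
    f n (j * (n %/ q))%N * f n (n %/ q)%N).
  by apply/funext => n; rewrite subrK mulSn addnC.
rewrite -[X in _ --> X]add0r; apply: cvgD; last exact: cvgM.
by apply: toU; exact: asymp_mul.
Qed.

(** The remainder [n %% q] is below the fixed [q], so its factor lies between [f n q] and 1 and
    tends to 1. *)
Let diag_lim q (p : R) : (0 < q)%N -> f n (n %/ q)%N @[n --> U] --> p ->
  f n n @[n --> U] --> p ^+ q.
Proof.
move=> q0 hp.
have -> : (fun n => f n n) = (fun n =>
    (f n (q * (n %/ q) + n %% q)%N - f n (q * (n %/ q))%N * f n (n %% q)%N) +
    f n (q * (n %/ q))%N * f n (n %% q)%N).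
  by apply/funext => n; rewrite subrK mulnC -divn_eq.
rewrite -[X in _ --> X]add0r; apply: cvgD.
  by apply: toU; exact: asymp_mul.
rewrite -[X in _ --> X]mulr1; apply: cvgM; first exact: pow_lim.
apply: toU; apply: (@squeeze_cvgr _ _ _ _ (f^~ q) (fun=> 1)); last 2 first.
- exact: f_cvg1.
- exact: cvg_cst.
by near=> n; rewrite f_le1 andbT; apply: f_dec; rewrite ltnW// ltn_pmod.
Unshelve. all: by end_near. Qed.

Let Sm_blocks n m J :
  m%:R * \sum_(1 <= j < J.+1) f n (j * m)%N <= Sm n (J * m) <=
  m%:R * \sum_(0 <= j < J) f n (j * m)%N.
Proof.
elim: J => [|J /andP[IH1 IH2]].
  by rewrite /Sm mul0n !big_nil mulr0 lexx.
have -> : Sm n (J.+1 * m) = Sm n (J * m) + \sum_((J * m).+1 <= k < (J.+1 * m).+1) f n k.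
  by rewrite /Sm -(@big_cat_nat _ _ _ (J * m).+1)//= ltnS leq_mul2r leqnSn orbT.
rewrite (@big_nat_recr _ _ _ J.+1)//= (@big_nat_recr _ _ _ J 0)//= !mulrDr.
have cst (z : R) : m%:R * z = \sum_((J * m).+1 <= k < (J.+1 * m).+1) z.
  by rewrite sumr_const_nat subSS mulSn addnK mulr_natl.
apply/andP; split; apply: lerD => //; rewrite cst;
  apply: ler_sum_nat => i /andP[i1 i2]; apply: f_dec => //.
exact: ltnW.
Qed.

Let upper q (p : R) : (0 < q)%N -> f n (n %/ q)%N @[n --> U] --> p ->
  c * q%:R * (1 - p) <= 1.
Proof.
move=> q0 hp; have q0R : 0 < q%:R :> R by rewrite ltr0n.
have p01 : 0 <= p <= 1.
  apply/andP; split; [apply: (cvgr_to_ge hp)|apply: (cvgr_to_le hp)];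
  by apply: filterE => n.
have key C : (0 < C)%N -> c <= q%:R^-1 * \sum_(0 <= j < (C + 4) * q) p ^+ j + c ^+ 2 / C%:R.
  move=> C0.
  (* The blocks have length [n %/ q]; the last [q] of them absorb the rounding, so that all together
     cover [(C + 3) n] once [n >= (C + 4) q]. *)
  pose J := ((C + 4) * q)%N.
  have H : \forall n \near \oo, A n / n%:R <= (n %/ q)%:R / n%:R * \sum_(0 <= j < J) f n (j * (n %/ q))%N
     + (A n / n%:R) ^+ 2 / C%:R + theta (g n) * x n / n%:R.
    near=> n.
    have n0R : 0 < n%:R :> R by rewrite ltr0n; near: n; exists 1%N.
    have h0 : A n / n%:R <= Sm n ((C + 3) * n)%N / n%:R + (A n / n%:R) ^+ 2 / C%:R
      + theta (g n) * x n / n%:R by near: n; exact: tail.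
    apply: (le_trans h0); rewrite -!addrA; apply: lerD => //.
    rewrite mulrAC ler_wpM2r ?invr_ge0 ?(ltW n0R)//.
    have /andP[_ h] := Sm_blocks n (n %/ q) J; apply: le_trans h.
    apply: Sm_le; rewrite /J -mulnA [(q * _)%N]mulnC.
    have hn : ((C + 4) * q <= n)%N by near: n; exists ((C + 4) * q)%N.
    by have := divn_eq n q; have := ltn_pmod n q0; nia.
  have FR : (n %/ q)%:R / n%:R * \sum_(0 <= j < J) f n (j * (n %/ q))%N
     + (A n / n%:R) ^+ 2 / C%:R + theta (g n) * x n / n%:R @[n --> U] -->
     q%:R^-1 * \sum_(0 <= j < J) p ^+ j + c ^+ 2 / C%:R; last first.
    exact: (ler_cvg_to (toU _ _ Ac) FR (Uoo _ H)).
  rewrite -[X in _ --> X]addr0; apply: cvgD; last exact: toU.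
  apply: cvgD.
    apply: cvgM; first by apply: toU; exact: cvg_squeeze_nat_frac.
    by apply: cvg_sumr => i; exact: pow_lim.
  rewrite expr2; under eq_fun do rewrite expr2.
  by apply: cvgMl; apply: toU; exact: cvgM.
have p1 : 0 <= 1 - p by rewrite subr_ge0; case/andP: p01.
(* The geometric sum is multiplied by [1 - p] instead of being divided out, so [p = 1] is not a
   separate case. *)
have key2 C : (0 < C)%N -> c * q%:R * (1 - p) - 1 <= (q%:R * c ^+ 2) / C%:R.
  move=> C0; have := key C C0; rewrite big_mkord => h.
  have := ler_wpM2r (mulr_ge0 (ltW q0R) p1) h.
  set s := \sum_(i < _) _.
  have hs : (1 - p) * s = 1 - p ^+ ((C + 4) * q).
    by rewrite /s -opprB mulNr -subrX1 opprB.
  have -> : (q%:R^-1 * s + c ^+ 2 / C%:R) * (q%:R * (1 - p)) =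
     (1 - p) * s + (1 - p) * (q%:R * c ^+ 2 / C%:R).
    by field; rewrite gt_eqF ?ltr0n// gt_eqF// ltr0n.
  rewrite hs.
  have : 0 <= p ^+ ((C + 4) * q) by rewrite exprn_ge0//; case/andP: p01.
  have : (1 - p) * (q%:R * c ^+ 2 / C%:R) <= q%:R * c ^+ 2 / C%:R.
    apply: ler_piMl; last by rewrite lerBlDr lerDl; case/andP: p01.
    by rewrite divr_ge0// mulr_ge0// sqr_ge0.
  rewrite -!mulrA; lra.
have F0 : (q%:R * c ^+ 2) / C%:R @[C --> \oo] --> (0 : R).
  rewrite -[X in _ --> X](mulr0 (q%:R * c ^+ 2)); apply: cvgMr.
  apply/gtr0_cvgV0; last exact: cvgr_idn.
  by near=> n; rewrite ltr0n; near: n; exists 1%N.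
rewrite -subr_le0; apply: (cvgr_to_ge F0).
by near=> C; apply: key2; near: C; exists 1%N.
Unshelve. all: by end_near. Qed.

Let lower q (p : R) : (0 < q)%N -> f n (n %/ q)%N @[n --> U] --> p ->
  p <= c * q%:R * (1 - p).
Proof.
move=> q0 hp; have q0R : 0 < q%:R :> R by rewrite ltr0n.
have p01 : 0 <= p <= 1.
  apply/andP; split; [apply: (cvgr_to_ge hp)|apply: (cvgr_to_le hp)];
  by apply: filterE => n.
have /andP[p0 p1] := p01.
have key J : \sum_(1 <= j < J.+1) p ^+ j <= c * q%:R.
  have H : \forall n \near \oo, (n %/ q)%:R / n%:R * \sum_(1 <= j < J.+1) f n (j * (n %/ q))%N <= A n / n%:R.
    near=> n.
    have n0R : 0 < n%:R :> R by rewrite ltr0n; near: n; exists 1%N.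
    rewrite mulrAC ler_wpM2r ?invr_ge0 ?(ltW n0R)//.
    have /andP[h _] := Sm_blocks n (n %/ q) J; apply: (le_trans h).
    by move: (J * _)%N; near: n; exact: Sm_leA.
  have : q%:R^-1 * \sum_(1 <= j < J.+1) p ^+ j <= c.
    have FL : (n %/ q)%:R / n%:R * \sum_(1 <= j < J.+1) f n (j * (n %/ q))%N @[n --> U]
        --> q%:R^-1 * \sum_(1 <= j < J.+1) p ^+ j.
      apply: cvgM; first by apply: toU; exact: cvg_squeeze_nat_frac.
      by apply: cvg_sumr => i; exact: pow_lim.
    exact: (ler_cvg_to FL (toU _ _ Ac) (Uoo _ H)).
  by rewrite ler_pdivrMl// mulrC.
have key2 J : (0 < J)%N -> p - p * (c * q%:R) / J%:R <= c * q%:R * (1 - p).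
  move=> J0; have J0R : 0 < J%:R :> R by rewrite ltr0n.
  (* The partial sums of the non-increasing sequence [p ^+ j] stay below [c q], so its [J]-th term
     is at most [c q / J]; [p < 1] need not be known. *)
  have h1 : p ^+ J <= c * q%:R / J%:R.
    rewrite ler_pdivlMr// [_ * J%:R]mulr_natr; apply: le_trans (key J).
    rewrite -[X in _ *+ X](subn0) -[X in _ *+ X]subSS -sumr_const_nat.
    apply: ler_sum_nat => i /andP[i1 iJ].
    by apply: ler_wiXn2l.
  have h2 : (1 - p) * \sum_(1 <= j < J.+1) p ^+ j = p * (1 - p ^+ J).
    rewrite big_add1/= big_mkord; under eq_bigr do rewrite exprS.
    by rewrite -mulr_sumr mulrCA -(opprB p 1) mulNr -subrX1 opprB.
  have h3 : p * (1 - p ^+ J) <= c * q%:R * (1 - p).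
    by rewrite -h2 mulrC ler_wpM2r ?subr_ge0// mulrC.
  apply: le_trans h3; rewrite mulrBr mulr1 -mulrA lerD2l lerN2.
  exact: ler_wpM2l.
have F0 : p - p * (c * q%:R) / J%:R @[J --> \oo] --> p; last first.
  apply: (cvgr_to_le F0).
  by near=> J; apply: key2; near: J; exists 1%N.
rewrite -[X in _ --> X]subr0 -[X in _ --> _ - X](mulr0 (p * (c * q%:R))).
apply: cvgB; first exact: cvg_cst.
apply: cvgMr; apply/gtr0_cvgV0; last exact: cvgr_idn.
by near=> n; rewrite ltr0n; near: n; exists 1%N.
Unshelve. all: by end_near. Qed.

(* If [p] is the limit of [f n (n / q)], then [p ^ j] is that of
   [f n (j (n / q))]; comparing the total sum of [f n], which is about [c n],
   with geometric sums gives [p <= c q (1 - p)] and [c q (1 - p) <= 1], and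
   [p ^ q] is squeezed to [e^(-1/c)] as [q] grows. *)
Lemma renewal_core_ultra : f n n @[n --> U] --> expR (- c^-1).
Proof.
have [H H01 fH] := @ultra_cvg _ (fun n => f n n) 0 1 U UU (fun n => f01 n n).
suff -> : expR (- c^-1) = H by [].
have main q : (0 < q)%N -> 1 < c * q%:R ->
    expR (- (c - q%:R^-1)^-1) <= H <= expR (- (c + q%:R^-1)^-1).
  move=> q0 cq1; have q0R : 0 < q%:R :> R by rewrite ltr0n.
  have [p /andP[p0 p1] hp] := @ultra_cvg _ (fun n => f n (n %/ q)%N) 0 1 U UU (fun n => f01 n _).
  have <- : p ^+ q = H.
    by apply: (@cvg_unique _ (@Rhausdorff R) ((fun n => f n n) @ U)) => //; exact: diag_lim.
  have u := upper q p q0 hp; have l := lower q p q0 hp.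
  have cq0 : 0 < c * q%:R by rewrite mulr_gt0.
  apply/andP; split.
  (* From e^(-y / (1 - y)) <= 1 - y <= p; the [q]-th power of the left side is exactly e^(-1 / (c -
     1/q)). The other bullet uses p <= 1 - 1 / (1 + cq) and 1 - z <= e^(-z) in the same way. *)
  - pose y := (c * q%:R)^-1.
    have y1 : 0 < 1 - y by rewrite subr_gt0 invf_lt1.
    have y0 : 0 < y by rewrite invr_gt0.
    have hp1 : 1 - y <= p.
      by rewrite lerBlDr -lerBlDl -(ler_pM2l cq0) divff ?gt_eqF.
    have : expR (- (y / (1 - y))) <= p.
      apply: le_trans hp1; rewrite expRN -[leRHS]invrK lef_pV2 ?posrE ?expR_gt0 ?invr_gt0//.
      apply: le_trans (expR_ge1Dx _).
      by rewrite le_eqVlt; apply/orP; left; apply/eqP; field; rewrite gt_eqF.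
    move=> h; apply: le_trans (lerXn2r q _ _ h); rewrite ?nnegrE ?expR_ge0//.
    rewrite -expRM_natl ler_expR mulrN lerN2 /y.
    rewrite le_eqVlt; apply/orP; left; apply/eqP.
    have e1 : c * q%:R - 1 != 0 by rewrite gt_eqF// subr_gt0.
    field; rewrite !(gt_eqF, e1)//=.
  - have hp1 : p <= 1 - (1 + c * q%:R)^-1.
      have h0 : 0 < 1 + c * q%:R by rewrite addr_gt0.
      rewrite -(ler_pM2l h0) mulrBr divff ?gt_eqF// mulr1.
      move: l; lra.
    have : p <= expR (- (1 + c * q%:R)^-1).
      by apply: (le_trans hp1); exact: expR_ge1Dx.
    move=> h; apply: le_trans (lerXn2r q _ _ h) _; rewrite ?nnegrE ?expR_ge0//.
    rewrite -expRM_natl ler_expR mulrN lerN2.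
    rewrite le_eqVlt; apply/orP; left; apply/eqP.
    field; rewrite !gt_eqF ?addr_gt0// ?mulr_gt0//.
have cq : q%:R^-1 @[q --> \oo] --> (0 : R).
  apply/gtr0_cvgV0; last exact: cvgr_idn.
  by near=> n; rewrite ltr0n; near: n; exists 1%N.
have big : \forall q \near \oo, (0 < q)%N /\ 1 < c * q%:R.
  near=> q; split; first by near: q; exists 1%N.
  rewrite mulrC -ltr_pdivrMr//; near: q.
  exact: (cvgryPgt _).1 (@cvgr_idn R) _.
apply/eqP; rewrite eq_le; apply/andP; split.
- have F1 : expR (- (c - q%:R^-1)^-1) @[q --> \oo] --> expR (- c^-1).
    apply: continuous_cvg; first exact: continuous_expR.
    apply: cvgN; apply: cvgV; first by rewrite gt_eqF.
    rewrite -[X in _ --> X]subr0; apply: cvgB => //; exact: cvg_cst.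
  apply: (ler_cvg_to F1 (cvg_cst H)).
  by apply: filterS big => q [q0 q1]; have /andP[] := main q q0 q1.
- have F1 : expR (- (c + q%:R^-1)^-1) @[q --> \oo] --> expR (- c^-1).
    apply: continuous_cvg; first exact: continuous_expR.
    apply: cvgN; apply: cvgV; first by rewrite gt_eqF.
    rewrite -[X in _ --> X]addr0; apply: cvgD => //; exact: cvg_cst.
  apply: (ler_cvg_to (cvg_cst H) F1).
  by apply: filterS big => q [q0 q1]; have /andP[] := main q q0 q1.
Unshelve. all: by end_near. Qed.

End along.

Lemma renewal_core : f n n @[n --> \oo] --> expR (- c^-1).
Proof. by apply: cvg_ultra => U UU Uoo; exact: renewal_core_ultra. Qed.

End renewal_core.

(** * Regular variation *)

Section truncn_cvg.
Context {R : realType}.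

Lemma cvgy_ge (y : nat -> R) : y n @[n --> \oo] --> +oo ->
  forall M, \forall n \near \oo, M <= y n.
Proof. by move=> yoo M; move/cvgryPge : yoo; exact. Qed.

Lemma cvg_truncn (y : nat -> R) : y n @[n --> \oo] --> +oo ->
  Num.truncn (y n) @[n --> \oo] --> \oo.
Proof.
move=> yoo M [K _ KM]; have : \forall n \near \oo, M (Num.truncn (y n)); last by [].
near=> n; apply: KM => /=.
have yK : K%:R <= y n by near: n; exact: cvgy_ge.
by rewrite truncn_ge_nat// (le_trans _ yK).
Unshelve. all: by end_near. Qed.

Lemma cvg_natinv : n%:R^-1 @[n --> \oo] --> (0 : R).
Proof.
apply/gtr0_cvgV0; last exact: cvgr_idn.
by near=> n; rewrite ltr0n; near: n; exists 1%N.
Unshelve. all: by end_near. Qed.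

Lemma near_nat_gt0 : \forall n \near \oo, 0 < n%:R :> R.
Proof. by exists 1%N => // n /= n1; rewrite ltr0n. Qed.

End truncn_cvg.

Section regular_variation.
Context {R : realType}.
Variables (a : nat -> R) (gamma : R) (b : nat -> R).
Hypothesis a_ge0 : forall n, 0 <= a n.
Hypothesis a_nd : forall m n, (m <= n)%N -> a m <= a n.
Hypothesis gamma01 : 0 < gamma <= 1.
Hypothesis arv : regularly_varying a gamma.
Hypothesis ab : asymp_equiv (fun n => at_real a (b n)) (fun n => n%:R).

Lemma at_real_nd (s t : R) : s <= t -> at_real a s <= at_real a t.
Proof. by move=> st; apply: a_nd; exact: le_truncn. Qed.

Lemma at_real_ge0 (s : R) : 0 <= at_real a s.
Proof. exact: a_ge0. Qed.

(** For [c = 1] the ratio [a n / a n] tends to 1, whereas it equals 0 wherever [a n = 0], since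
    division by 0 returns 0. *)
Lemma regvar_gt0 : \forall n \near \oo, 0 < a n.
Proof.
have := @arv 1 ltr01; rewrite powR1 => /cvgr_gt/(_ 0 ltr01).
apply: filterS => n h; rewrite lt_neqAle a_ge0 andbT eq_sym.
by apply: contraTN h => /eqP ->; rewrite invr0 mulr0 ltxx.
Qed.

(** While [b n < M], monotonicity keeps a(b(n)) below a(M), but a(b(n)) ~ n. *)
Lemma inverse_pinfty : b n @[n --> \oo] --> +oo.
Proof.
apply/cvgryPge => M.
have h1 : \forall n \near \oo, 1 / 2 <= at_real a (b n) / n%:R.
  by apply: (cvgr_ge _ ab); lra.
near=> n; rewrite leNgt; apply/negP => bM.
have n0 : 0 < n%:R :> R by near: n; exact: near_nat_gt0.
have h : 1 / 2 <= at_real a (b n) / n%:R by near: n.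
have h2 := at_real_nd _ _ (ltW bM).
have : 2 * at_real a M + 1 <= n%:R by near: n; exact: (cvgy_ge _ (@cvgr_idn R)).
by move: h; rewrite ler_pdivlMr//; lra.
Unshelve. all: by end_near. Qed.

(** Regular variation is given along integers only. Monotonicity of [a] carries it to real [y n],
    which lies between its integer part and [1 + eta] times it. *)
Lemma regvar_real (y : nat -> R) (u : R) : y n @[n --> \oo] --> +oo -> 0 < u ->
  at_real a (u * y n) / at_real a (y n) @[n --> \oo] --> u `^ gamma.
Proof.
move=> yoo u0; have /andP[g0 g1] := gamma01.
have Noo := cvg_truncn _ yoo.
have lim v : 0 < v -> at_real a (v * (Num.truncn (y n))%:R) / at_real a (y n) @[n --> \oo] --> v `^ gamma.
  by move=> v0; apply: (cvg_comp _ _ Noo (@arv v v0)).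
have apos : \forall n \near \oo, 0 < at_real a (y n).
  by have := Noo _ regvar_gt0; apply.
apply/cvgrPdist_le => e e0.
pose ug := u `^ gamma; have ug0 : 0 < ug by exact: powR_gt0.
(* As [gamma <= 1], (u (1 + eta))^gamma <= u^gamma (1 + eta), which this [eta] keeps within [e / 2]
   of u^gamma. *)
pose eta := e / 2 / (ug + 1).
have eta0 : 0 < eta by rewrite !divr_gt0// addr_gt0.
have ueta : ug * (1 + eta) <= ug + e / 2.
  rewrite mulrDr mulr1 lerD2l /eta mulrA ler_pdivrMr ?addr_gt0//.
  by rewrite mulrC ler_pM2l ?divr_gt0// lerDl.
have ueta2 : (u * (1 + eta)) `^ gamma <= ug + e / 2.
  rewrite powRM// ?(ltW u0)//; last lra.
  apply: le_trans ueta; apply: ler_wpM2l; first exact: ltW.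
  by apply: ler1_powR => //; lra.
near=> n.
have an0 : 0 < at_real a (y n) by near: n.
have y0 : 0 <= y n by near: n; exact: cvgy_ge.
have /andP[t1 t2] := truncn_itv y0.
have yeta : y n <= (1 + eta) * (Num.truncn (y n))%:R.
  have : eta^-1 + 1 <= y n by near: n; exact: cvgy_ge.
  move=> h; have h1 : eta^-1 <= (Num.truncn (y n))%:R by move: t2; rewrite -natr1; lra.
  move: h1; rewrite -(ler_pM2l eta0) divff ?gt_eqF// => h1.
  by move: t2; rewrite -natr1 mulrDl mul1r; lra.
rewrite ler_distlC; apply/andP; split.
- have : ug - e <= at_real a (u * (Num.truncn (y n))%:R) / at_real a (y n).
    by near: n; apply: (cvgr_ge _ (lim u u0)); rewrite ltrBlDr ltrDl.
  move=> /le_trans; apply; rewrite ler_wpM2r ?invr_ge0 ?(ltW an0)//.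
  by apply: at_real_nd; rewrite ler_wpM2l// ltW.
- apply: (@le_trans _ _ (at_real a (u * (1 + eta) * (Num.truncn (y n))%:R) / at_real a (y n))).
    rewrite ler_wpM2r ?invr_ge0 ?(ltW an0)//.
    by apply: at_real_nd; rewrite -mulrA ler_wpM2l// ltW.
  near: n; apply: (cvgr_le _ (lim _ _)); first by rewrite mulr_gt0//; lra.
  by move: ueta2; rewrite -/ug; lra.
Unshelve. all: by end_near. Qed.

Lemma regvar_inverse (u : R) : 0 < u ->
  at_real a (u * b n) / n%:R @[n --> \oo] --> u `^ gamma.
Proof.
move=> u0; have boo := inverse_pinfty.
have : (at_real a (u * b n) / at_real a (b n)) * (at_real a (b n) / n%:R) @[n --> \oo] --> u `^ gamma * 1.
  by apply: cvgM => //; exact: regvar_real.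
rewrite mulr1; apply: cvg_trans; apply: near_eq_cvg; near=> n.
have an0 : 0 < at_real a (b n) by near: n; exact: (cvg_truncn _ boo _ regvar_gt0).
by rewrite mulrA divfK// gt_eqF.
Unshelve. all: by end_near. Qed.

Lemma regvar_doubling : exists2 N : nat, (0 < N)%N &
  forall n, (N <= n)%N -> a (2 * n)%N <= 4 * a n.
Proof.
have /andP[g0 g1] := gamma01.
have h2 : 2 `^ gamma < 4 :> R.
  by apply: (@le_lt_trans _ _ 2); [apply: ler1_powR => //; lra|lra].
have r4 : \forall n \near \oo, at_real a (2 * n%:R : R) / a n <= 4.
  have two0 : 0 < 2 :> R by [].
  by have := @arv 2 two0; move=> /cvgr_le/(_ 4 h2).
have [N _ HN] := filterI regvar_gt0 r4.
 exists N.+1 => // n Nn.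
have [a0] := HN n (ltnW Nn); rewrite ler_pdivrMr//; apply: le_trans.
by rewrite /at_real -natrM natrK.
Unshelve. all: by end_near. Qed.

(* Potter-type bound, from doubling iterated log2 u times *)
Lemma regvar_domination : exists2 N : R, 0 < N &
  forall y u : R, N <= y -> 0 < u ->
    at_real a (u * y) <= 16 * (1 + u ^+ 2) * at_real a y.
Proof.
have [N N0 HN] := regvar_doubling; exists N%:R; first by rewrite ltr0n.
have iter j n : (N <= n)%N -> a (2 ^ j * n)%N <= 4 ^+ j * a n.
  move=> Nn; elim: j => [|j IH]; first by rewrite mul1n mul1r.
  rewrite expnS exprS -mulnA -mulrA; apply: (le_trans (HN _ _)).
    by rewrite (leq_trans Nn)// leq_pmull// expn_gt0.
  by rewrite ler_pM2l.
move=> y u Ny u0; have y0 : 0 < y by rewrite (lt_le_trans _ Ny)// ltr0n.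
have ay0 := at_real_ge0 y.
have [u1|u1] := leP u 1.
  apply: (@le_trans _ _ (at_real a y)); first by apply: at_real_nd; rewrite ler_piMl// ltW.
  by rewrite ler_peMl//; have := sqr_ge0 u; lra.
pose m := Num.truncn y; pose j := trunc_log 2 (Num.truncn u).
have m1 : (N <= m)%N by rewrite truncn_ge_nat// ltW.
have tu : (0 < Num.truncn u)%N by rewrite truncn_gt0 ltW.
have /andP[j1 j2] := @trunc_log_bounds 2 (Num.truncn u) isT tu.
have /andP[_ y2] := truncn_itv (ltW y0).
have /andP[u2 u3] := truncn_itv (ltW u0).
(* 2^j <= u < 2^(j+1) and y < 2 m, so u y lies below 2^(j+2) m. The j + 2 doublings cost 4^j * 16
   with 4^j <= u^2, whence the constant 16. *)
apply: (@le_trans _ _ (a (2 ^ (j + 2) * m)%N)).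
  apply: a_nd; rewrite -ltnS truncn_lt_nat ?mulr_ge0 ?(ltW u0) ?(ltW y0)//.
  apply: (@lt_le_trans _ _ ((2 ^ j.+1)%N%:R * (2 * m)%N%:R)).
    apply: ltr_pM => //; [exact: ltW|exact: ltW| |].
      by rewrite (lt_le_trans u3)// ler_nat.
    by rewrite (lt_le_trans y2)// ler_nat -/m; lia.
  rewrite -natrM ler_nat addn2 (expnS 2 j.+1) (mulnC 2) -mulnA; lia.
apply: (le_trans (iter _ _ m1)); rewrite ler_wpM2r//.
rewrite exprD [leLHS]mulrC.
have -> : (4 ^+ 2 : R) = 16 by ring.
rewrite ler_pM2l//.
have : (2 ^+ j : R) <= u by rewrite -natrX (le_trans _ u2)// ler_nat.
have -> : (4 ^+ j : R) = (2 ^+ j) ^+ 2 by rewrite -exprM mulnC exprM; congr (_ ^+ _); ring.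
move=> h; have : (2 ^+ j) ^+ 2 <= u ^+ 2 by rewrite lerXn2r ?nnegrE ?exprn_ge0// ltW.
by lra.
Qed.

Lemma measurable_at_real (D : set R) (x : R) : measurable D -> 0 <= x ->
  measurable_fun D (fun u : R => at_real a (u * x)).
Proof.
move=> mD x0; apply: nondecreasing_measurable => // s t st.
by apply: at_real_nd; rewrite ler_wpM2r.
Qed.

Local Notation Rpos := (`]0, +oo[%classic : set R).

Lemma integrable_exp_pos (r : R) : 0 < r ->
  (@lebesgue_measure R).-integrable Rpos (EFin \o (fun u => expR (- r * u))).
Proof.
move=> r0.
have : (@lebesgue_measure R).-integrable Rpos (EFin \o exponential_pdf r).
  apply: (integrableS _ _ _ (integrable_exponential_pdf r0)); [exact: measurableT|exact: measurable_itv|exact: subsetT].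
move=> h; have := @integrableZl _ _ _ lebesgue_measure _ _ r^-1 _ h.
move=> /(_ (measurable_itv _)); apply: eq_integrable => // u.
rewrite inE /= in_itv /= andbT => u0.
by rewrite /comp exponential_pdfE ?(ltW u0)// -EFinM mulrA mulVf ?gt_eqF// mul1r.
Qed.

(* Abelian direction of Karamata's theorem, along the sequence b *)
Lemma karamata_abel (lam : R) : 0 < lam ->
  Rintegral lebesgue_measure Rpos
    (fun u => at_real a (u * (b n / lam)) * expR (- u)) / n%:R @[n --> \oo]
  --> Gamma (1 + gamma) * lam `^ (- gamma).
Proof.
move=> lam0; have /andP[g0 g1] := gamma01.
have boo := inverse_pinfty.
have xoo : b n / lam @[n --> \oo] --> +oo.
  apply/cvgryPge => M; near=> n; rewrite ler_pdivlMr//.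
  by near: n; exact: cvgy_ge.
have [N N0 HN] := regvar_domination.
pose K := lam `^ (- gamma) + 1.
have K0 : 0 <= K by rewrite /K addr_ge0 ?powR_ge0.
have lamV u : 0 < u -> u / lam = u * lam^-1 by [].
have limx u : 0 < u -> at_real a (u * (b n / lam)) / n%:R @[n --> \oo] --> lam `^ (- gamma) * u `^ gamma.
  move=> u0; have -> : lam `^ (- gamma) * u `^ gamma = (u / lam) `^ gamma.
    rewrite powRM ?invr_ge0 ?(ltW u0) ?(ltW lam0)//.
    by rewrite -powR_inv1 ?(ltW lam0)// -powRrM mulN1r mulrC.
  have -> : (fun n => at_real a (u * (b n / lam)) / n%:R) = (fun n => at_real a (u / lam * b n) / n%:R).
    by apply/funext => n; congr (at_real a _ / _); rewrite mulrA mulrAC.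
  by apply: regvar_inverse; rewrite divr_gt0.
have bnd1 : \forall n \near \oo, [/\ 0 < n%:R :> R, N <= b n / lam & at_real a (b n / lam) / n%:R <= K].
  near=> n; split; near: n.
  - exact: near_nat_gt0.
  - exact: (cvgy_ge _ xoo).
  - have := limx 1 ltr01; rewrite powR1 mulr1; under eq_fun do rewrite mul1r.
    by move=> /cvgr_le; apply; rewrite /K ltrDl.
have [n0 _ hn0] := bnd1.
(* Dominated convergence wants the bound at every index, hence the shift by [n0]. *)
pose F n (u : R) : \bar R := (at_real a (u * (b (n + n0)%N / lam)) / (n + n0)%:R * expR (- u))%:E.
pose G (u : R) : \bar R := (lam `^ (- gamma) * (u `^ gamma * expR (- u)))%:E.
(* 128 = 16 * 8: the Potter bound 16 (1 + u^2), followed by 1 + u^2 <= 8 e^(u/2). *)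
pose H (u : R) : \bar R := (128 * K * expR (- (2^-1) * u))%:E.
have xpos n : 0 < b (n + n0)%N / lam.
  by have [_ h _] := hn0 (n + n0)%N (leq_addl _ _); exact: lt_le_trans h.
have mexp : measurable_fun Rpos (fun u : R => expR (- u)).
  by apply: measurableT_comp => //; exact: measurable_funTS.
have mF n : measurable_fun Rpos (F n).
  apply/measurable_EFinP; apply: measurable_funM => //.
  by apply: measurable_funM => //; apply: measurable_at_real => //; exact: ltW.
have mpow : measurable_fun Rpos (fun u : R => u `^ gamma).
  by apply: measurable_funTS; exact: measurable_powR.
have mG : measurable_fun Rpos G.
  by apply/measurable_EFinP; apply: measurable_funM => //; exact: measurable_funM.
have iH : (@lebesgue_measure R).-integrable Rpos H.
  have h2 : 0 < 2^-1 :> R by rewrite invr_gt0.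
  have := @integrableZl _ _ _ lebesgue_measure _ _ (128 * K) _ (integrable_exp_pos _ h2).
  by move=> /(_ (measurable_itv _)); apply: eq_integrable.
have FG : forall u, Rpos u -> F ^~ u @ \oo --> G u.
  move=> u; rewrite /= in_itv /= andbT => u0.
  apply: cvg_EFin; first by apply: nearW.
  rewrite mulrA; apply: cvgMl.
  by have := limx u u0; rewrite -(cvg_shiftn n0).
have FH : forall n u, Rpos u -> (`|F n u| <= H u)%E.
  move=> n u; rewrite /= in_itv /= andbT => u0.
  have [n1 h1 h2] := hn0 (n + n0)%N (leq_addl _ _).
  rewrite /F /H lee_fin ger0_norm; last first.
    by rewrite mulr_ge0 ?expR_ge0// divr_ge0 ?(ltW n1)//; exact: at_real_ge0.
  have e1 : at_real a (u * (b (n + n0)%N / lam)) / (n + n0)%:R <= 16 * (1 + u ^+ 2) * K.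
    apply: (@le_trans _ _ (16 * (1 + u ^+ 2) * (at_real a (b (n + n0)%N / lam) / (n + n0)%:R))).
      by rewrite [leRHS]mulrA ler_wpM2r ?invr_ge0 ?(ltW n1)//; exact: HN.
    by rewrite ler_wpM2l// mulr_ge0//; have := sqr_ge0 u; lra.
  apply: (le_trans (ler_wpM2r (expR_ge0 _) e1)).
  have e2 : 1 + u ^+ 2 <= 8 * expR (2^-1 * u).
    have := @expR_ge1Dxn R (2^-1 * u) 1.
    rewrite mulr_ge0 ?invr_ge0 ?(ltW u0)// => /(_ isT).
    rewrite exprMn /= => h.
    have h' := ler_wpM2l (ler0n R 8) h; apply: le_trans h'.
    rewrite (_ : (2`!)%:R = 2 :> R)//.
    have -> : 8 * (1 + 2^-1 ^+ 2 * u ^+ 2 / 2) = 8 + u ^+ 2 :> R by field.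
    by lra.
  have -> : expR (- u) = expR (- 2^-1 * u) * expR (- 2^-1 * u).
    by rewrite -expRD; congr expR; field.
  have -> : 16 * (1 + u ^+ 2) * K * (expR (- 2^-1 * u) * expR (- 2^-1 * u)) =
    (1 + u ^+ 2) * (expR (- 2^-1 * u)) * (16 * K * expR (- 2^-1 * u)) by ring.
  have -> : 128 * K * expR (- 2^-1 * u) = 8 * (16 * K * expR (- 2^-1 * u)) by ring.
  apply: ler_wpM2r; first by rewrite !mulr_ge0 ?expR_ge0.
  apply: (le_trans (ler_wpM2r (expR_ge0 _) e2)).
  by rewrite -mulrA -expRD mulNr subrr expR0 mulr1.
have fin : forall x, Rpos x -> H x \is a fin_num by [].
have mP : measurable Rpos by exact: measurable_itv.
have C : (\int[lebesgue_measure]_(u in Rpos) F n u)%E @[n --> \oo] -->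
    (\int[lebesgue_measure]_(u in Rpos) G u)%E.
  by apply: (@dominated_cvg _ _ _ (@lebesgue_measure R) Rpos _ F G H).
have iF n : (@lebesgue_measure R).-integrable Rpos (F n).
  apply: (@le_integrable _ _ _ (@lebesgue_measure R) Rpos _ _ H); [exact: mP|exact: mF| |exact: iH] => u Pu.
  rewrite (le_trans (FH n u Pu))// gee0_abs// /H lee_fin.
  by rewrite !mulr_ge0 ?expR_ge0.
have iG : (@lebesgue_measure R).-integrable Rpos G.
  apply: (@le_integrable _ _ _ (@lebesgue_measure R) Rpos _ _ H); [exact: mP|exact: mG| |exact: iH] => u Pu.
  have -> : `|H u|%E = H u by rewrite gee0_abs// /H lee_fin !mulr_ge0 ?expR_ge0.
  have Gu : `|F n u|%E @[n --> \oo] --> `|G u|%E by apply: cvg_abse; exact: FG.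
  rewrite -(cvg_lim _ Gu)//; apply: lime_le; first by apply/cvg_ex; exists (`|G u|%E).
  by apply: nearW => n; exact: FH.
rewrite -(cvg_shiftn n0).
have -> : Gamma (1 + gamma) * lam `^ (- gamma) = fine (\int[lebesgue_measure]_(u in Rpos) G u)%E.
  rewrite mulrC /Gamma -RintegralZl//.
    congr fine; apply: eq_integral => u _; rewrite /G; congr ((_ * (_ `^ _ * _))%:E).
    by rewrite addrAC subrr add0r.
  rewrite addrAC subrr add0r.
  have := @integrableZl _ _ _ lebesgue_measure _ _ (lam `^ (- gamma))^-1 _ iG.
  move=> /(_ mP); apply: eq_integrable => // u _.
  have l0 : lam `^ (- gamma) != 0 by rewrite gt_eqF// powR_gt0.
  by rewrite /G -EFinM mulKf.
have -> : (fun n => Rintegral lebesgue_measure Rpos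
   (fun u => at_real a (u * (b (n + n0)%N / lam)) * expR (- u)) / (n + n0)%:R) =
   fun n => fine (\int[lebesgue_measure]_(u in Rpos) F n u)%E.
  apply/funext => n; have [n1 h1 h2] := hn0 (n + n0)%N (leq_addl _ _).
  rewrite -RintegralZr//.
    by congr fine; apply: eq_integral => u _; rewrite /F mulrAC.
  have := @integrableZl _ _ _ lebesgue_measure _ _ ((n + n0)%:R) _ (iF n).
  move=> /(_ mP); apply: eq_integrable => // u _.
  rewrite /F -EFinM; congr EFin; set m : R := (n + n0)%:R in n1 *.
  by field; rewrite -natrD gt_eqF.
apply: fine_cvg; rewrite fineK//.
by apply: integrable_fin_num.
Unshelve. all: by end_near. Qed.

End regular_variation.

(** * Means of bounded functions *)

Section bounded_means.
Context {d : measure_display} {T : measurableType d} {R : realType}.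
Implicit Types (P : probability T R) (f g : T -> R) (A : set T).

Definition mean P f : R := Rintegral P setT f.

Definition bmeas f := measurable_fun setT f /\ exists M, forall x, `|f x| <= M.

Lemma bmeas_integrable P f : bmeas f -> P.-integrable setT (EFin \o f).
Proof.
move=> [mf [M fM]]; apply: measurable_bounded_integrable => //.
  by rewrite (@le_lt_trans _ _ 1%E)// ?probability_le1// ltry.
by exists M; split; [exact: num_real|move=> y My x _; exact: (le_trans (fM x) (ltW My))].
Qed.

Lemma bmeas_cst c : bmeas (fun=> c).
Proof. by split; [exact: measurable_cst|exists `|c|]. Qed.

Lemma bmeasD f g : bmeas f -> bmeas g -> bmeas (fun x => f x + g x).
Proof.
move=> [mf [M fM]] [mg [N gN]]; split; first exact: measurable_funD.
by exists (M + N) => x; rewrite (le_trans (ler_normD _ _))// lerD.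
Qed.

Lemma bmeasM f g : bmeas f -> bmeas g -> bmeas (fun x => f x * g x).
Proof.
move=> [mf [M fM]] [mg [N gN]]; split; first exact: measurable_funM.
by exists (M * N) => x; rewrite normrM ler_pM.
Qed.

Lemma bmeasZ c f : bmeas f -> bmeas (fun x => c * f x).
Proof. by move=> bf; apply: bmeasM => //; exact: bmeas_cst. Qed.

Lemma bmeasB f g : bmeas f -> bmeas g -> bmeas (fun x => f x - g x).
Proof.
move=> bf bg; have := bmeasD _ _ bf (bmeasZ (-1) _ bg).
by congr bmeas; apply/funext => x; rewrite mulN1r.
Qed.

Lemma bmeas_indic A : measurable A -> bmeas (\1_A : T -> R).
Proof.
move=> mA; split; first exact: measurable_indic.
by exists 1 => x; rewrite indicE; case: (_ \in _); rewrite ?normr1 ?normr0.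
Qed.

Lemma bmeas_sum (I : Type) (s : seq I) (F : I -> T -> R) :
  (forall i, bmeas (F i)) -> bmeas (fun x => \sum_(i <- s) F i x).
Proof.
move=> bF; elim: s => [|i s IH].
  by under eq_fun do rewrite big_nil; exact: bmeas_cst.
by under eq_fun do rewrite big_cons; exact: bmeasD.
Qed.

Lemma bmeas_comp f (S : T -> T) : measurable_fun setT S -> bmeas f -> bmeas (f \o S).
Proof.
move=> mS [mf [M fM]]; split; first exact: measurableT_comp.
by exists M => x; exact: fM.
Qed.

Lemma bmeas01 f : measurable_fun setT f -> (forall x, 0 <= f x <= 1) -> bmeas f.
Proof.
by move=> mf f01; split => //; exists 1 => x; have /andP[f0 f1] := f01 x; rewrite ger0_norm.
Qed.

Lemma meanD P f g : bmeas f -> bmeas g ->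
  mean P (fun x => f x + g x) = mean P f + mean P g.
Proof. by move=> bf bg; apply: RintegralD => //; exact: bmeas_integrable. Qed.

Lemma meanB P f g : bmeas f -> bmeas g ->
  mean P (fun x => f x - g x) = mean P f - mean P g.
Proof. by move=> bf bg; apply: RintegralB => //; exact: bmeas_integrable. Qed.

Lemma meanZ P c f : bmeas f -> mean P (fun x => c * f x) = c * mean P f.
Proof. by move=> bf; apply: RintegralZl => //; exact: bmeas_integrable. Qed.

Lemma mean_cst P c : mean P (fun=> c) = c.
Proof.
by rewrite /mean /Rintegral integral_cst// [X in (_ * X)%E](@probability_setT _ _ _ P) mule1.
Qed.

Lemma mean_le P f g : bmeas f -> bmeas g -> (forall x, f x <= g x) ->
  mean P f <= mean P g.
Proof.
by move=> bf bg fg; apply: le_Rintegral => //; exact: bmeas_integrable.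
Qed.

Lemma mean_ge0 P f : (forall x, 0 <= f x) -> 0 <= mean P f.
Proof. by move=> f0; apply: Rintegral_ge0. Qed.

Lemma mean_bounds P f a b : bmeas f -> (forall x, a <= f x <= b) -> a <= mean P f <= b.
Proof.
move=> bf fab; rewrite -{1}(mean_cst P a) -{1}(mean_cst P b); apply/andP; split.
  by apply: mean_le => // [|x]; [exact: bmeas_cst|have /andP[] := fab x].
by apply: mean_le => // [|x]; [exact: bmeas_cst|have /andP[] := fab x].
Qed.

Lemma mean_indic P A : measurable A -> mean P (\1_A) = fine (P A).
Proof. by move=> mA; rewrite /mean /Rintegral integral_indic// setIT. Qed.

Lemma mean_sum P (I : Type) (s : seq I) (F : I -> T -> R) :
  (forall i, bmeas (F i)) ->
  mean P (fun x => \sum_(i <- s) F i x) = \sum_(i <- s) mean P (F i).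
Proof.
move=> bF; elim: s => [|i s IH].
  by rewrite big_nil; under [X in mean P X]eq_fun do rewrite big_nil; exact: mean_cst.
rewrite big_cons -IH; under [X in mean P X]eq_fun do rewrite big_cons.
by rewrite meanD//; exact: bmeas_sum.
Qed.

Lemma le_norm_mean P f : bmeas f -> `|mean P f| <= mean P (fun x => `|f x|).
Proof. by move=> bf; apply: le_normr_Rintegral => //; exact: bmeas_integrable. Qed.

Lemma mean_comp P (S : T -> T) f : measurable_fun setT S ->
  (forall A, measurable A -> P (S @^-1` A) = P A) -> bmeas f ->
  mean P (f \o S) = mean P f.
Proof.
move=> mS PS bf; rewrite /mean /Rintegral; congr fine.
have mf : measurable_fun setT (EFin \o f) by apply/measurable_EFinP; case: bf.
have iS : P.-integrable setT ((EFin \o f) \o S).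
  exact: (bmeas_integrable P _ (bmeas_comp _ _ mS bf)).
transitivity (\int[pushforward P S]_x (EFin \o f) x)%E.
  by rewrite integral_pushforward.
by apply: eq_measure_integral => A mA _; exact: PS.
Qed.

Lemma prob_fine_le P A B : measurable A -> measurable B -> A `<=` B ->
  fine (P A) <= fine (P B).
Proof.
by move=> mA mB AB; apply: fine_le; rewrite ?fin_num_measure// le_measure ?inE.
Qed.

Lemma prob_fine_ge0 P A : 0 <= fine (P A).
Proof. exact: fine_ge0. Qed.

Lemma prob_fine_le1 P A : measurable A -> fine (P A) <= 1.
Proof.
by move=> mA; rewrite -lee_fin fineK ?fin_num_measure// probability_le1.
Qed.

(** For values in [0, 1] this rounds [f] down to a multiple of 1/N. Written as an average of
    indicators of level sets, it lets statements about sets pass to functions by linearity. *)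
Definition grid (N : nat) f (x : T) : R :=
  N%:R^-1 * \sum_(0 <= i < N) \1_[set y | i.+1%:R / N%:R <= f y] x.

Lemma grid_bounds N f : (0 < N)%N -> (forall x, 0 <= f x <= 1) ->
  forall x, grid N f x <= f x <= grid N f x + N%:R^-1.
Proof.
move=> N0 f01 x; have /andP[f0 f1] := f01 x.
have NR : 0 < N%:R :> R by rewrite ltr0n.
pose t := Num.truncn (N%:R * f x).
have Nf0 : 0 <= N%:R * f x by rewrite mulr_ge0.
have tN : (t <= N)%N.
  by rewrite -ltnS truncn_lt_nat// (@le_lt_trans _ _ N%:R)// ?ltr_nat// ler_piMr.
have cnt K : \sum_(0 <= i < K) \1_[set y | i.+1%:R / N%:R <= f y] x = (minn K t)%:R :> R.
  elim: K => [|K IH]; first by rewrite big_nil min0n.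
  rewrite big_nat_recr//= IH indicE.
  have -> : (x \in [set y | K.+1%:R / N%:R <= f y]) = (K.+1 <= t)%N.
    rewrite truncn_ge_nat//; apply/idP/idP; rewrite inE /= ler_pdivrMr// mulrC//.
  rewrite -natrD; congr (_%:R); case: ltnP => h.
    by rewrite addn1 !(minn_idPl _)// ltnW.
  by rewrite addn0 !(minn_idPr _)// ltnW.
rewrite /grid cnt (minn_idPr tN).
have /andP[t1 t2] := truncn_itv Nf0.
have NV := mulVf (lt0r_neq0 NR).
apply/andP; split.
  by rewrite mulrC ler_pdivrMr// mulrC.
by rewrite -{2}[N%:R^-1]mulr1 -mulrDr mulrC ler_pdivlMr// mulrC natr1 ltW.
Qed.

Lemma measurable_ge_set f (c : R) : measurable_fun setT f -> measurable [set y | c <= f y].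
Proof.
move=> mf; have := mf measurableT _ (measurable_itv `[c, +oo[).
by rewrite setTI; congr (measurable _); apply/seteqP; split => y; rewrite /= in_itv /= andbT.
Qed.

Lemma bmeas_grid N f : measurable_fun setT f -> bmeas (grid N f).
Proof.
move=> mf; apply: bmeasZ; apply: bmeas_sum => i; apply: bmeas_indic.
exact: measurable_ge_set.
Qed.

Lemma mean_grid P N f : measurable_fun setT f ->
  mean P (grid N f) = N%:R^-1 * \sum_(0 <= i < N) fine (P [set y | i.+1%:R / N%:R <= f y]).
Proof.
move=> mf; rewrite meanZ; last first.
  by apply: bmeas_sum => i; apply: bmeas_indic; exact: measurable_ge_set.
rewrite mean_sum; last by move=> i; apply: bmeas_indic; exact: measurable_ge_set.
by congr (_ * _); apply: eq_bigr => i _; rewrite mean_indic//; exact: measurable_ge_set.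
Qed.

Lemma natinv_gt0_le (a b c : R) : (forall N, (0 < N)%N -> a <= b + c * N%:R^-1) -> a <= b.
Proof.
move=> h.
have F : b + c * N%:R^-1 @[N --> \oo] --> b.
  rewrite -[X in _ --> X]addr0; apply: cvgD; first exact: cvg_cst.
  by rewrite -[X in _ --> X](mulr0 c); apply: cvgMr; exact: cvg_natinv.
by apply: (cvgr_to_ge F); exists 1%N => // N /= N1; exact: h.
Qed.

(* Both factors are replaced by their N-step level-set approximations, so the
   bound on sets transfers with an error 2/N. *)
Lemma mixing_sets_to_means (P mu : probability T R) (F : set (set T)) (S : T -> T)
    (theta : R) f g :
  (forall A, F A -> measurable A) -> measurable_fun setT S -> 0 <= theta ->
  (forall A B, F A -> measurable B ->
    `|fine (P (A `&` S @^-1` B)) - fine (P A) * fine (P B)| <= theta * fine (mu B)) ->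
  (forall c, F [set x | c <= f x]) -> (forall x, 0 <= f x <= 1) ->
  measurable_fun setT g -> (forall x, 0 <= g x <= 1) ->
  `|mean P (fun x => f x * g (S x)) - mean P f * mean P g| <= theta * mean mu g.
Proof.
move=> Fm mS th0 mix Ff f01 mg g01.
have mf : measurable_fun setT f.
  apply: (measurability (@RGenCInfty.G R)) => [|/= _ [_] [r] -> <-].
    exact: RGenCInfty.measurableE.
  rewrite setTI; have := Fm _ (Ff r); congr (measurable _).
  by apply/seteqP; split => y; rewrite /= in_itv /= andbT.
have bf := bmeas01 _ mf f01; have bg := bmeas01 _ mg g01.
have bgS : bmeas (fun x => g (S x)) by exact: (bmeas_comp g S).
have bfg : bmeas (fun x => f x * g (S x)) by exact: bmeasM.
suff key N : (0 < N)%N ->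
    `|mean P (fun x => f x * g (S x)) - mean P f * mean P g| <= theta * mean mu g + 2 * N%:R^-1.
  exact: natinv_gt0_le key.
move=> N0; have NR : 0 < N%:R^-1 :> R by rewrite invr_gt0 ltr0n.
pose fN := grid N f; pose gN := grid N g.
have fb := grid_bounds N f N0 f01; have gb := grid_bounds N g N0 g01.
have fN0 x : 0 <= fN x.
  by rewrite mulr_ge0 ?(ltW NR)// sumr_ge0// => i _; rewrite indicE.
have gN0 x : 0 <= gN x.
  by rewrite mulr_ge0 ?(ltW NR)// sumr_ge0// => i _; rewrite indicE.
have bfN : bmeas fN by exact: bmeas_grid.
have bgN : bmeas gN by exact: bmeas_grid.
have bgNS : bmeas (fun x => gN (S x)) by exact: (bmeas_comp gN S).
have bfgN : bmeas (fun x => fN x * gN (S x)) by exact: bmeasM.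
have m1 : mean P (fun x => fN x * gN (S x)) <= mean P (fun x => f x * g (S x)).
  apply: mean_le => // x; apply: ler_pM => //.
    by have /andP[] := fb x.
  by have /andP[] := gb (S x).
have m2 : mean P (fun x => f x * g (S x)) <= mean P (fun x => fN x * gN (S x)) + 2 * N%:R^-1.
  rewrite -[X in _ <= _ + X](mean_cst P) -meanD//; last exact: bmeas_cst.
  apply: mean_le => //; first by apply: bmeasD => //; exact: bmeas_cst.
  move=> x; have /andP[f1 f2] := fb x; have /andP[g1 g2] := gb (S x).
  have /andP[f3 f4] := f01 x; have /andP[g3 g4] := g01 (S x).
  have h1 : f x * g (S x) <= (fN x + N%:R^-1) * g (S x) by exact: ler_wpM2r.
  have h2 : fN x * g (S x) <= fN x * (gN (S x) + N%:R^-1) by exact: ler_wpM2l.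
  have h3 : fN x * N%:R^-1 <= N%:R^-1 by rewrite ler_piMl ?(ltW NR)// (le_trans f1).
  have h4 : N%:R^-1 * g (S x) <= N%:R^-1 by rewrite ler_piMr ?(ltW NR).
  move: h1 h2; rewrite mulrDl mulrDr; lra.
have mfN : mean P fN <= mean P f by apply: mean_le => // x; have /andP[] := fb x.
have mgN : mean P gN <= mean P g by apply: mean_le => // x; have /andP[] := gb x.
have mfN' : mean P f <= mean P fN + N%:R^-1.
  rewrite -[X in _ <= _ + X](mean_cst P) -meanD//; last exact: bmeas_cst.
  by apply: mean_le => // [|x]; [apply: bmeasD => //; exact: bmeas_cst|have /andP[] := fb x].
have mgN' : mean P g <= mean P gN + N%:R^-1.
  rewrite -[X in _ <= _ + X](mean_cst P) -meanD//; last exact: bmeas_cst.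
  by apply: mean_le => // [|x]; [apply: bmeasD => //; exact: bmeas_cst|have /andP[] := gb x].
have mumg : mean mu gN <= mean mu g by apply: mean_le => // x; have /andP[] := gb x.
pose A i := [set y | i.+1%:R / N%:R <= f y]; pose B i := [set y | i.+1%:R / N%:R <= g y].
have mA i : measurable (A i) by exact: measurable_ge_set.
have mB i : measurable (B i) by exact: measurable_ge_set.
have mSB i : measurable (S @^-1` B i).
  by rewrite -[X in measurable X]setTI; exact: mS.
have prodE : mean P (fun x => fN x * gN (S x)) =
    N%:R^-1 * N%:R^-1 * \sum_(0 <= i < N) \sum_(0 <= j < N) fine (P (A i `&` S @^-1` B j)).
  have -> : (fun x => fN x * gN (S x)) = (fun x => N%:R^-1 * N%:R^-1 *
      \sum_(0 <= i < N) \sum_(0 <= j < N) \1_(A i `&` S @^-1` B j) x).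
    apply/funext => x; rewrite /fN /gN /grid mulrACA; congr (_ * _).
    rewrite big_distrlr /=; apply: eq_bigr => i _; apply: eq_bigr => j _.
    by rewrite indicI /= !indicE; congr (_ * _%:R); rewrite !inE.
  have bI i j : bmeas (\1_(A i `&` S @^-1` B j) : T -> R).
    by apply: bmeas_indic; exact: measurableI.
  rewrite meanZ; last by apply: bmeas_sum => i; exact: bmeas_sum.
  rewrite mean_sum; last by move=> i; exact: bmeas_sum.
  congr (_ * _); apply: eq_bigr => i _; rewrite mean_sum//.
  by apply: eq_bigr => j _; rewrite mean_indic//; exact: measurableI.
have prodE2 : mean P fN * mean P gN =
    N%:R^-1 * N%:R^-1 * \sum_(0 <= i < N) \sum_(0 <= j < N) (fine (P (A i)) * fine (P (B j))).
  by rewrite !mean_grid// mulrACA big_distrlr.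
have main : `|mean P (fun x => fN x * gN (S x)) - mean P fN * mean P gN| <= theta * mean mu g.
  apply: (@le_trans _ _ (theta * mean mu gN)); last exact: ler_wpM2l.
  rewrite prodE prodE2 -mulrBr -sumrB normrM ger0_norm ?mulr_ge0 ?(ltW NR)//.
  rewrite (mean_grid mu)// mulrCA -mulrA ler_pM2l//.
  apply: (@le_trans _ _ (N%:R^-1 * \sum_(0 <= i < N) (theta * \sum_(0 <= j < N) fine (mu (B j))))).
    rewrite ler_pM2l//; apply: (le_trans (ler_norm_sum _ _ _)); apply: ler_sum => i _.
    rewrite -sumrB mulr_sumr; apply: (le_trans (ler_norm_sum _ _ _)); apply: ler_sum => j _.
    by apply: mix; [exact: Ff|exact: mB].
  by rewrite sumr_const_nat subn0 mulrnAr -mulrnAl -mulr_natr mulVf ?mul1r// gt_eqF// -invr_gt0.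
have /andP[mf0 mf1] := mean_bounds P f 0 1 bf f01.
have /andP[mg0 mg1] := mean_bounds P g 0 1 bg g01.
have mfN0 : 0 <= mean P fN by exact: mean_ge0.
have mgN0 : 0 <= mean P gN by exact: mean_ge0.
have l1 : mean P fN * mean P gN <= mean P f * mean P g by exact: ler_pM.
have l2 : mean P f * mean P g <= mean P fN * mean P gN + 2 * N%:R^-1.
  have h1 : mean P f * mean P g <= (mean P fN + N%:R^-1) * mean P g by exact: ler_wpM2r.
  have h2 : mean P fN * mean P g <= mean P fN * (mean P gN + N%:R^-1) by exact: ler_wpM2l.
  have h3 : mean P fN * N%:R^-1 <= N%:R^-1 by rewrite ler_piMl ?(ltW NR)// (le_trans mfN).
  have h4 : N%:R^-1 * mean P g <= N%:R^-1 by rewrite ler_piMr ?(ltW NR).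
  move: h1 h2; rewrite mulrDl mulrDr; lra.
move: main; rewrite !ler_norml => /andP[? ?]; apply/andP; split; lra.
Qed.

End bounded_means.

(** * Mixing in fibred systems *)

Section sigma_algebra_closure.
Context {T : Type} (F : set (set T)).
Hypothesis sF : sigma_algebra setT F.

Lemma sa_setC A : F A -> F (~` A).
Proof. by case: sF => _ h _ /h; rewrite setTD. Qed.

Lemma sa_setT : F setT.
Proof. by rewrite -setC0; apply: sa_setC; case: sF. Qed.

Lemma sa_bigcup (A : nat -> set T) : (forall n, F (A n)) -> F (\bigcup_n A n).
Proof. by case: sF => _ _; exact. Qed.

Lemma sa_setU A B : F A -> F B -> F (A `|` B).
Proof.
move=> FA FB; rewrite -bigcup2E; apply: sa_bigcup => -[|[|n]] //=.
by case: sF.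
Qed.

Lemma sa_setI A B : F A -> F B -> F (A `&` B).
Proof.
move=> FA FB; rewrite -(setCK (A `&` B)) setCI; apply: sa_setC.
by apply: sa_setU; exact: sa_setC.
Qed.

Lemma sa_bigcap_lt k (A : nat -> set T) : (forall n, (n < k)%N -> F (A n)) ->
  F (\bigcap_(n in `I_k) A n).
Proof.
elim: k => [|k IH] FA.
  by rewrite II0 bigcap_set0; exact: sa_setT.
rewrite IIS bigcap_setU bigcap_set1; apply: sa_setI; last exact: FA.
by apply: IH => n nk; apply: FA; rewrite ltnS ltnW.
Qed.

Lemma sa_nat_preimage (u : T -> nat) : (forall n, F (u @^-1` [set n])) ->
  forall B : set nat, F (u @^-1` B).
Proof.
move=> Fu B.
have -> : u @^-1` B = \bigcup_n (if n \in B then u @^-1` [set n] else set0).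
  apply/seteqP; split => x /=.
    by move=> Bx; exists (u x) => //; rewrite mem_set.
  by move=> [n _]; case: ifPn => // /set_mem nB /= ->.
by apply: sa_bigcup => n; case: ifP => // _; case: sF.
Qed.

Lemma sa_natD (u v : T -> nat) : (forall B : set nat, F (u @^-1` B)) ->
  (forall B : set nat, F (v @^-1` B)) ->
  forall B : set nat, F ((fun x => (u x + v x)%N) @^-1` B).
Proof.
move=> Fu Fv; apply: sa_nat_preimage => n.
have -> : (fun x => (u x + v x)%N) @^-1` [set n] =
    \bigcup_i (u @^-1` [set i] `&` v @^-1` [set j | (i + j)%N = n]).
  by apply/seteqP; split => x /=; [move=> h; exists (u x)|move=> [i _ [<-]]].
by apply: sa_bigcup => i; exact: sa_setI.
Qed.

End sigma_algebra_closure.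

Lemma sa_preimage (T : Type) (S : T -> T) (F : set (set T)) :
  sigma_algebra setT F -> sigma_algebra setT [set A | F (S @^-1` A)].
Proof.
move=> sF; split => /=.
- by rewrite preimage_set0; case: sF.
- by move=> A FA; rewrite setTD preimage_setC; exact: sa_setC.
- by move=> A FA; rewrite preimage_bigcup; exact: sa_bigcup.
Qed.

(** The arithmetic of [lap_mul]: [a] and [b] are the means over k + l and over k + (h + 1) + l
    terms, [m] the mean over two blocks with the middle left out, [p] the product of means, [c] the
    mean over the gap. *)
Lemma quasi_mul_arith (R : realType) (a b c p m e t : R) :
  a <= b + (1 - c) -> m <= b + (1 - c) -> b <= a -> b <= p + e -> - e <= m - p ->
  e <= t -> c <= 1 -> `|a - p| <= t + 2 * (1 - c).
Proof. by move=> *; rewrite ler_norml; apply/andP; split; lra. Qed.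

Section negligible_difference.
Context {d : measure_display} {T : measurableType d} {R : realType}.
Implicit Types (P : probability T R) (A B C : set T).

Lemma negligible_eq P A B : measurable A -> measurable B ->
  P.-negligible (A `+` B) -> P A = P B.
Proof.
move=> mA mB nAB.
have half C D : measurable C -> measurable D -> P.-negligible (C `\` D) -> P C = P (C `&` D).
  move=> mC mD nCD; have z : P (C `\` D) = 0%E; last first.
    transitivity (P (C `\` D) + P (C `&` D))%E; first exact: measureDI.
    by rewrite z add0e.
  by apply/negligibleP => //; exact: measurableD.
rewrite (half A B)//; last by apply: negligibleS nAB => x; left.
rewrite [RHS](half B A)//; last by apply: negligibleS nAB => x; right.
by rewrite setIC.
Qed.

Lemma negligible_setYI P A B C : P.-negligible (A `+` B) ->
  P.-negligible ((A `&` C) `+` (B `&` C)).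
Proof.
apply: negligibleS => x [[[Ax Cx] nBC]|[[Bx Cx] nAC]].
  by left; split => // Bx; apply: nBC.
by right; split => // Ax; apply: nAC.
Qed.

End negligible_difference.

Section fibred.
Context {d : measure_display} {T : measurableType d} {R : realType}.
Variables (P mu : probability T R) (S : T -> T) (alpha : set (set T)).
Hypothesis hsys : probability_preserving_fibred_system P S alpha.
Hypothesis hmu : equivalent_measures mu P.

Lemma fibred_mS : measurable_fun setT S.
Proof. by case: hsys => -[[]]. Qed.

Lemma fibred_miter n : measurable_fun setT (iter n S).
Proof.
elim: n => [|n IH]; first exact: measurable_id.
have := measurableT_comp fibred_mS IH; congr (measurable_fun _).
Qed.

Lemma fibred_preim n A : measurable A -> measurable (iter n S @^-1` A).
Proof. by move=> mA; rewrite -[X in measurable X]setTI; exact: fibred_miter. Qed.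

Lemma fibred_inv n A : measurable A -> P (iter n S @^-1` A) = P A.
Proof.
move=> mA; elim: n => [|n IH] //; rewrite -IH.
case: hsys => _ /(_ _ (fibred_preim n _ mA)) <-; congr (P _).
by apply/seteqP; split => x; rewrite /preimage /= -iterS iterSr.
Qed.

Lemma fibred_malpha a : alpha a -> measurable a.
Proof. by case: hsys => -[_ [_ h _ _] _ _] _ /h. Qed.

(* The sigma-algebra of the first k coordinates, without the exact-cover
   assumption that would make it equal to that of the join. *)
Definition coord_sigma (k : nat) : set (set T) :=
  <<s [set A | exists j a, [/\ (j < k)%N, alpha a & A = iter j S @^-1` a]] >>.

Lemma coord_sigma_sa k : sigma_algebra setT (coord_sigma k).
Proof. exact: smallest_sigma_algebra. Qed.

Lemma coord_sigma_le k l : (k <= l)%N -> coord_sigma k `<=` coord_sigma l.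
Proof.
move=> kl; apply: smallest_sub; first exact: coord_sigma_sa.
move=> A [j [a [jk aa ->]]]; apply: sub_sigma_algebra; exists j, a; split => //.
exact: leq_trans kl.
Qed.

Lemma coord_sigma_measurable k A : coord_sigma k A -> measurable A.
Proof.
move: A; apply: smallest_sub; first exact: sigma_algebra_measurable.
by move=> A [j [a [jk aa ->]]]; apply: fibred_preim; exact: fibred_malpha.
Qed.

Lemma join_sub_coord k : <<s join_partition S alpha k >> `<=` coord_sigma k.
Proof.
apply: smallest_sub; first exact: coord_sigma_sa.
move=> A [c /= hc <-]; apply: sa_bigcap_lt; first exact: coord_sigma_sa.
move=> n nk; apply: sub_sigma_algebra; exists n, (c n); split => //; exact: hc.
Qed.

(** [alpha] is not empty, since otherwise the uncovered set would have mass 1. Repetitions in [en]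
    are harmless. *)
Lemma alpha_enum : exists en : nat -> set T, alpha = range en.
Proof.
case: hsys => -[_ [ca _ _ cov] _ _] _.
case/pfcard_geP : ca => [a0|[f]].
  have : P setT = 1%E := probability_setT P.
  by move: cov; rewrite a0 bigcup_set0 setC0 => -> /eqP; rewrite eqe eq_sym oner_eq0.
exists f; apply/seteqP; split => x.
  by move=> /(@surj _ _ _ _ f)[n _ <-]; exists n.
by move=> [n _ <-]; exact: (@funS _ _ _ _ f).
Qed.

(** Off the null set of points whose orbit leaves the cells, S^-j a is the union of the cylinders of
    length [k] with cell [a] in position [j]. Their index sequences are enumerated by [pickle],
    which makes the union countable. *)
Lemma coord_gen_ae k j a : (j < k)%N -> alpha a ->
  exists2 B, <<s join_partition S alpha k >> B &
    P.-negligible ((iter j S @^-1` a) `+` B).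
Proof.
move=> jk aa; have [en enE] := alpha_enum.
pose cyl (s : seq nat) := \bigcap_(i in `I_k) iter i S @^-1` (en (nth 0%N s i)).
pose G (n : nat) : set T := if unpickle n is Some s then
  (if `[< en (nth 0%N s j) = a >] then cyl s else set0) else set0.
exists (\bigcup_n G n).
  apply: sa_bigcup; first exact: smallest_sigma_algebra.
  move=> n; rewrite /G; case: unpickle => [s|]; last by case: (smallest_sigma_algebra setT (join_partition S alpha k)).
  case: ifP => _; last by case: (smallest_sigma_algebra setT (join_partition S alpha k)).
  apply: sub_sigma_algebra; exists (fun i => en (nth 0%N s i)) => //= i _.
  by rewrite enE; exists (nth 0%N s i).
pose N := ~` \bigcup_n en n.
have mN : measurable N.
  apply: measurableC; apply: bigcupT_measurable => n; apply: fibred_malpha.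
  by rewrite enE; exists n.
have nN : P N = 0%E.
  by case: hsys => -[_ [_ _ _ cov] _ _] _; move: cov; rewrite enE bigcup_image.
have nU : P.-negligible (\bigcup_i iter i S @^-1` N).
  apply: negligible_bigcup => i; apply/negligibleP; first exact: fibred_preim.
  by rewrite -[RHS]nN; exact: fibred_inv.
apply: negligibleS nU => x [[xa nx]|[[n _ xG] nxa]]; last first.
  exfalso; apply: nxa; move: xG; rewrite /G; case: unpickle => [s|]//.
  case: asboolP => // sa /(_ j jk) /=; by rewrite sa.
apply: contrapT => nN'; apply: nx.
have xen i : exists n, en n (iter i S x).
  apply: contrapT => h; apply: nN'; exists i => // -[n _ xn]; apply: h; by exists n.
have /choice[ch hch] := xen.
have [nj njE] : exists nj, en nj = a by move: aa; rewrite enE => -[nj _ <-]; exists nj.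
pose s := mkseq (fun i => if i == j then nj else ch i) k.
exists (pickle s) => //; rewrite /G pickleK.
have nthE i : (i < k)%N -> nth 0%N s i = if i == j then nj else ch i.
  by move=> ik; rewrite nth_mkseq.
case: asboolP => [_|]; last by rewrite nthE// eqxx.
move=> i /= ik; rewrite nthE//; case: eqP => [->|_]; last exact: hch.
by rewrite njE.
Qed.

Lemma coord_ae_join k A : coord_sigma k A ->
  exists2 B, <<s join_partition S alpha k >> B & P.-negligible (A `+` B).
Proof.
pose D := [set A | exists2 B, <<s join_partition S alpha k >> B & P.-negligible (A `+` B)].
suff : coord_sigma k `<=` D by exact.
have sJ := smallest_sigma_algebra setT (join_partition S alpha k).
apply: smallest_sub; last first.
  by move=> _ [j [a [jk aa ->]]]; exact: coord_gen_ae.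
split.
- exists set0; first by case: sJ.
  by rewrite setYK; exact: negligible_set0.
- move=> A0 [B sB nB]; exists (~` B); first exact: (sa_setC _ sJ).
  apply: negligibleS nB => x; rewrite setTD => -[[nA /contrapT Bx]|[nB /contrapT Ax]].
    by right.
  by left.
- move=> F FD; have /choice[B hB] : forall n, exists B, <<s join_partition S alpha k >> B /\ P.-negligible (F n `+` B).
    by move=> n; have [B ? ?] := FD n; exists B.
  exists (\bigcup_n B n); first by apply: sa_bigcup => // n; case: (hB n).
  apply: (@negligibleS _ _ _ _ (\bigcup_n (F n `+` B n))).
    move=> x [[[n _ Fx] nB]|[[n _ Bx] nF]]; exists n => //.
      by left; split => // Bx; apply: nB; exists n.
    by right; split => // Fx; apply: nF; exists n.
  by apply: negligible_bigcup => n; case: (hB n).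
Qed.

Lemma theta_coef_ge0 n : (0 <= theta_coef P mu S alpha n)%E.
Proof.
apply: (@le_trans _ _ (`|fine (P (set0 `&` iter (n + 1) S @^-1` setT))
   - fine (P set0) * fine (P setT)| / fine (mu setT))%:E).
  by rewrite lee_fin divr_ge0// fine_ge0.
apply: ereal_sup_ubound; exists 1%N, set0, setT; split => //.
- by case: (smallest_sigma_algebra setT (join_partition S alpha 1)).
- by rewrite probability_setT lte01.
Qed.

(** [A] is replaced by a set of the join, equal to it mod [P]. The supremum ranges over [mu B > 0];
    if [mu B = 0], then [P B = 0] by domination and both sides vanish. *)
Lemma theta_mixing_sets n k A B : (1 <= k)%N -> coord_sigma k A -> measurable B ->
  theta_coef P mu S alpha n \is a fin_num ->
  `|fine (P (A `&` iter (n + k) S @^-1` B)) - fine (P A) * fine (P B)|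
    <= fine (theta_coef P mu S alpha n) * fine (mu B).
Proof.
move=> k1 cA mB fin; have [A' sA' nA] := coord_ae_join k A cA.
have mA := coord_sigma_measurable _ _ cA.
have mA' : measurable A' by apply: (coord_sigma_measurable k); exact: join_sub_coord.
have mSB : measurable (iter (n + k) S @^-1` B) by exact: fibred_preim.
rewrite (negligible_eq P A A')// (negligible_eq P (A `&` _) (A' `&` iter (n + k) S @^-1` B)); last 3 first.
  exact: measurableI.
  exact: measurableI.
  exact: negligible_setYI.
have [mu0|mu0] := eqVneq (mu B) 0%E.
  have P0 : P B = 0%E.
    by case: hmu => _ /null_content_dominatesP; apply.
  have -> : P (A' `&` iter (n + k) S @^-1` B) = 0%E.
    apply/eqP; rewrite eq_le measure_ge0 andbT.
    apply: (@le_trans _ _ (P (iter (n + k) S @^-1` B))); last by rewrite fibred_inv// P0.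
    apply: le_measure; [|exact: mem_set|exact: subIsetr].
    by apply: mem_set; exact: measurableI.
  by rewrite mu0 P0 /= !mulr0 subrr normr0.
have muB : (0 < mu B)%E by rewrite lt0e mu0 measure_ge0.
have muBf : 0 < fine (mu B) by rewrite fine_gt0// muB ltey_eq fin_num_measure.
rewrite -ler_pdivrMr// -lee_fin fineK//.
by apply: ereal_sup_ubound; exists k, A', B; split.
Qed.

Lemma theta_mixing_means n k (f g : T -> R) : (1 <= k)%N ->
  theta_coef P mu S alpha n \is a fin_num ->
  (forall c, coord_sigma k [set x | c <= f x]) -> (forall x, 0 <= f x <= 1) ->
  measurable_fun setT g -> (forall x, 0 <= g x <= 1) ->
  `|mean P (fun x => f x * g (iter (n + k) S x)) - mean P f * mean P g|
    <= fine (theta_coef P mu S alpha n) * mean mu g.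
Proof.
move=> k1 fin cf f01 mg g01.
apply: (mixing_sets_to_means P mu (coord_sigma k)) => //.
- by move=> A; exact: coord_sigma_measurable.
- exact: fibred_miter.
- by apply: fine_ge0; exact: theta_coef_ge0.
- by move=> A B cA mB; exact: theta_mixing_sets.
Qed.

Lemma mean_iter n (f : T -> R) : bmeas f -> mean P (fun x => f (iter n S x)) = mean P f.
Proof.
move=> bf; apply: (mean_comp P (iter n S) f) => //; first exact: fibred_miter.
by move=> A mA; exact: fibred_inv.
Qed.

Variable (phi : T -> nat).
Hypothesis phi_gt0 : forall x, (0 < phi x)%N.
Hypothesis hphi : partition_measurable alpha phi.

Local Notation es := (ergodic_sum S phi).

Lemma es0 x : es 0 x = 0%N.
Proof. by rewrite /ergodic_sum big_geq. Qed.

Lemma esS k x : es k.+1 x = (es k x + phi (iter k.+1 S x))%N.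
Proof. by rewrite /ergodic_sum big_nat_recr. Qed.

Lemma esD k l x : es (k + l) x = (es k x + es l (iter k S x))%N.
Proof.
elim: l => [|l IH]; first by rewrite addn0 es0 addn0.
by rewrite addnS !esS IH addnA; congr (_ + phi _)%N; rewrite -iterD addSn addnC.
Qed.

Lemma es_ge k x : (k <= es k x)%N.
Proof.
by elim: k => [|k IH] //; rewrite esS -addn1 leq_add.
Qed.

Lemma es_le k l x : (k <= l)%N -> (es k x <= es l x)%N.
Proof. by move=> /subnKC <-; rewrite esD leq_addr. Qed.

Lemma coord_phi_iter j k (B : set nat) : (j < k)%N ->
  coord_sigma k ((fun x => phi (iter j S x)) @^-1` B).
Proof.
move=> jk; have := hphi B; rewrite -[coord_sigma k _]/([set A | coord_sigma k (iter j S @^-1` A)] (phi @^-1` B)).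
move: (phi @^-1` B); apply: smallest_sub.
  by apply: sa_preimage; exact: coord_sigma_sa.
by move=> a aa; apply: sub_sigma_algebra; exists j, a.
Qed.

(** [es k] reads the coordinates 1, ..., k, since the sum starts at [phi \o S]. This is the source
    of [k.+1] here and of [h.+1] in the gap bounds. *)
Lemma coord_es k (B : set nat) : coord_sigma k.+1 (es k @^-1` B).
Proof.
elim: k B => [|k IH] B.
  have -> : es 0 @^-1` B = if 0%N \in B then setT else set0.
    apply/seteqP; split => x /=; rewrite es0.
      by move=> B0; rewrite mem_set.
    by case: ifPn => // /set_mem.
  case: ifP => _; first by apply: sa_setT; exact: coord_sigma_sa.
  by case: (coord_sigma_sa 1).
have -> : es k.+1 @^-1` B = (fun x => (es k x + phi (iter k.+1 S x))%N) @^-1` B.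
  by apply/seteqP; split => x /=; rewrite esS.
apply: sa_natD => [|B'|B']; first exact: coord_sigma_sa.
  by apply: (coord_sigma_le k.+1) => //; exact: IH.
exact: coord_phi_iter.
Qed.

Lemma measurable_es_set k (B : set nat) : measurable (es k @^-1` B).
Proof. by apply: coord_sigma_measurable; exact: coord_es. Qed.

Lemma measurable_esR k : measurable_fun setT (fun x => (es k x)%:R : R).
Proof.
move=> _ B mB; rewrite setTI.
exact: (measurable_es_set k (fun n => B (n%:R))).
Qed.

Lemma measurable_es_fun k (h : nat -> R) : measurable_fun setT (fun x => h (es k x)).
Proof.
move=> _ B mB; rewrite setTI.
exact: (measurable_es_set k (fun n => B (h n))).
Qed.

Definition expes (y : R) (k : nat) (x : T) : R := expR (- ((es k x)%:R / y)).
Definition lap (y : R) (k : nat) : R := mean P (expes y k).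

Lemma expes01 y k x : 0 <= y -> 0 <= expes y k x <= 1.
Proof. by move=> y0; rewrite expR_ge0 -expR0 ler_expR oppr_le0 divr_ge0. Qed.

Lemma bmeas_expes y k : 0 <= y -> bmeas (expes y k).
Proof.
move=> y0; apply: bmeas01; last by move=> x; exact: expes01.
exact: (measurable_es_fun k (fun n => expR (- (n%:R / y)))).
Qed.

Lemma expesD y k l x : expes y (k + l) x = expes y k x * expes y l (iter k S x).
Proof. by rewrite /expes esD natrD mulrDl opprD expRD. Qed.

Lemma coord_expes y k c : coord_sigma k.+1 [set x | c <= expes y k x].
Proof. exact: (coord_es k (fun n => c <= expR (- (n%:R / y)))). Qed.

Lemma lap01 y k : 0 <= y -> 0 <= lap y k <= 1.
Proof.
by move=> y0; apply: mean_bounds; [exact: bmeas_expes|move=> x; exact: expes01].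
Qed.

Lemma lap_le y k l : 0 <= y -> (k <= l)%N -> lap y l <= lap y k.
Proof.
move=> y0 kl; apply: mean_le; try exact: bmeas_expes.
by move=> x; rewrite ler_expR lerN2 ler_wpM2r ?invr_ge0// ler_nat es_le.
Qed.

Lemma lap0 y : lap y 0 = 1.
Proof.
rewrite /lap (_ : expes y 0 = fun=> 1); first exact: mean_cst.
by apply/funext => x; rewrite /expes es0 mul0r oppr0 expR0.
Qed.

Lemma expes_le y k x : 0 <= y -> expes y k x <= expR (- (k%:R / y)).
Proof. by move=> y0; rewrite ler_expR lerN2 ler_wpM2r ?invr_ge0// ler_nat es_ge. Qed.

Local Notation theta n := (fine (theta_coef P mu S alpha n)).

(* Normalising the second factor by its deterministic bound e^(-l/y) makes the
   mixing error summable in l. *)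
Lemma lap_mix y k l h : 0 < y -> theta_coef P mu S alpha h \is a fin_num ->
  `|mean P (fun x => expes y k x * expes y l (iter (k + h.+1) S x)) - lap y k * lap y l|
    <= theta h * expR (- (l%:R / y)).
Proof.
move=> y0 fin; have y0' := ltW y0.
set E := expR _; have E0 : 0 < E by exact: expR_gt0.
pose g x := E^-1 * expes y l x.
have bg : bmeas g by apply: bmeasZ; exact: bmeas_expes.
have g01 x : 0 <= g x <= 1.
  rewrite mulr_ge0 ?invr_ge0 ?(ltW E0) ?expR_ge0//= ler_pdivrMl// mulr1.
  exact: expes_le.
have := theta_mixing_means h k.+1 (expes y k) g isT fin (coord_expes y k)
  (fun x => expes01 y k x y0') (proj1 bg) g01.
have -> : (fun x => expes y k x * g (iter (h + k.+1) S x)) =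
    (fun x => E^-1 * (expes y k x * expes y l (iter (k + h.+1) S x))).
  by apply/funext => x; rewrite /g mulrCA addnS addnC -addnS.
have bkl : bmeas (fun x => expes y k x * expes y l (iter (k + h.+1) S x)).
  apply: bmeasM; first exact: bmeas_expes.
  by apply: (bmeas_comp (expes y l)); [exact: fibred_miter|exact: bmeas_expes].
rewrite meanZ// (_ : mean P g = E^-1 * lap y l); last first.
  by rewrite /g meanZ//; exact: bmeas_expes.
rewrite mulrCA -mulrBr normrM ger0_norm ?invr_ge0 ?(ltW E0)// ler_pdivrMl//.
move=> /le_trans; apply; rewrite mulrC ler_wpM2r ?(ltW E0)// ler_piMr//.
  by apply: fine_ge0; exact: theta_coef_ge0.
by have /andP[] := mean_bounds mu g 0 1 bg g01.
Qed.

Lemma lap_gap y k l h : 0 < y -> theta_coef P mu S alpha h \is a fin_num ->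
  lap y (k + h.+1 + l) <= lap y k * lap y l + theta h * expR (- (l%:R / y)).
Proof.
move=> y0 fin; have y0' := ltW y0.
have := lap_mix y k l h y0 fin; rewrite ler_norml lerBlDl => /andP[_]; apply: le_trans.
have bS j i : bmeas (fun x => expes y j (iter i S x)).
  by apply: (bmeas_comp (expes y j)); [exact: fibred_miter|exact: bmeas_expes].
apply: mean_le; [exact: bmeas_expes|apply: bmeasM; [exact: bmeas_expes|exact: bS]|].
move=> x; rewrite expesD expesD ler_wpM2r ?expR_ge0// ler_piMr ?expR_ge0//.
by have /andP[] := expes01 y h.+1 (iter k S x) y0'.
Qed.

Lemma lap_mul y k l h : 0 < y -> theta_coef P mu S alpha h \is a fin_num ->
  `|lap y (k + l) - lap y k * lap y l| <= theta h + 2 * (1 - lap y h.+1).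
Proof.
move=> y0 fin; have y0' := ltW y0.
have th0 : 0 <= theta h by apply: fine_ge0; exact: theta_coef_ge0.
have bS j i : bmeas (fun x => expes y j (iter i S x)).
  by apply: (bmeas_comp (expes y j)); [exact: fibred_miter|exact: bmeas_expes].
have bE j : bmeas (expes y j) by exact: bmeas_expes.
have th1 : theta h * expR (- (l%:R / y)) <= theta h.
  by rewrite ler_piMr// -expR0 ler_expR oppr_le0 divr_ge0.
(* On [0, 1] one has a <= a b + (1 - b); invariance of [P] reduces the mean of the trailing factor b
   to [lap y h.+1]. The same inequality, applied to the factor in the middle, gives [up]. *)
have low : lap y (k + l) <= lap y (k + h.+1 + l) + (1 - lap y h.+1).
  have -> : (k + h.+1 + l = (k + l) + h.+1)%N by rewrite addnAC.
  have e : mean P (fun x => expes y ((k + l) + h.+1) x + (1 - expes y h.+1 (iter (k + l) S x))) =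
      lap y (k + l + h.+1) + (1 - lap y h.+1).
    rewrite meanD//; last by apply: bmeasB => //; exact: bmeas_cst.
    by rewrite meanB ?mean_cst ?mean_iter//; exact: bmeas_cst.
  rewrite -e; apply: mean_le => //; first by apply: bmeasD => //; apply: bmeasB => //; exact: bmeas_cst.
  move=> x; rewrite [in X in _ <= X]expesD.
  have /andP[a0 a1] := expes01 y (k + l) x y0'.
  have /andP[b0 b1] := expes01 y h.+1 (iter (k + l) S x) y0'.
  by nra.
have up : mean P (fun x => expes y k x * expes y l (iter (k + h.+1) S x)) <=
    lap y (k + h.+1 + l) + (1 - lap y h.+1).
  have e : mean P (fun x => expes y (k + h.+1 + l) x + (1 - expes y h.+1 (iter k S x))) =
      lap y (k + h.+1 + l) + (1 - lap y h.+1).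
    rewrite meanD//; last by apply: bmeasB => //; exact: bmeas_cst.
    by rewrite meanB ?mean_cst ?mean_iter//; exact: bmeas_cst.
  rewrite -e; apply: mean_le => //; first exact: bmeasM.
    by apply: bmeasD => //; apply: bmeasB => //; exact: bmeas_cst.
  move=> x; rewrite [in X in _ <= X]expesD expesD.
  have /andP[a0 a1] := expes01 y k x y0'.
  have /andP[b0 b1] := expes01 y h.+1 (iter k S x) y0'.
  have /andP[c0 c1] := expes01 y l (iter (k + h.+1) S x) y0'.
  have := mulr_ge0 a0 c0.
  have : expes y k x * expes y l (iter (k + h.+1) S x) <= 1 by rewrite mulr_ile1.
  set ac := _ * _ in b0 b1 * => ac1 ac0.
  rewrite mulrAC -/ac; nra.
have mono : lap y (k + h.+1 + l) <= lap y (k + l) by apply: lap_le => //; lia.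
have /andP[_ l1] := lap01 y h.+1 y0'.
have := lap_mix y k l h y0 fin; rewrite ler_norml => /andP[mx _].
exact: (quasi_mul_arith _ _ _ _ _ _ _ _ low up mono (lap_gap y k l h y0 fin) mx th1 l1).
Qed.

Lemma lap_cvg1 k (y : nat -> R) : y n @[n --> \oo] --> +oo ->
  lap (y n) k @[n --> \oo] --> (1 : R).
Proof.
move=> yoo.
(* [y n] may be negative for small [n]; the value 1 there keeps the domination by 1 valid at every
   index. *)
pose F n x : \bar R := (if 0 <= y n then expes (y n) k x else 1)%:E.
have F01 n x : (`|F n x| <= 1)%E.
  rewrite /F; case: ifP => h; rewrite lee_fin ?normr1//.
  by have /andP[h0 h1] := expes01 (y n) k x h; rewrite ger0_norm.
have := @dominated_cvg _ _ _ P setT measurableT F (fun=> 1%E) (fun=> 1%E).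
have mF n : measurable_fun setT (F n).
  have [h|h] := boolP (0 <= y n).
    have -> : F n = EFin \o expes (y n) k by apply/funext => x; rewrite /F h.
    by apply/measurable_EFinP; case: (bmeas_expes (y n) k h).
  have -> : F n = cst 1%E by apply/funext => x; rewrite /F (negbTE h).
  exact: measurable_cst.
have FF x : setT x -> F n x @[n --> \oo] --> 1%E.
  move=> _; apply: cvg_EFin; first by apply: nearW.
  have : expes (y n) k x @[n --> \oo] --> (1 : R).
    rewrite -expR0; apply: continuous_cvg; first exact: continuous_expR.
    rewrite -oppr0; apply: cvgN; rewrite -(mulr0 (es k x)%:R); apply: cvgMr.
    by apply/gtr0_cvgV0; [exact: (cvgryPgt _).1|].
  apply: cvg_trans; apply: near_eq_cvg.
  by apply: filterS (cvgy_ge _ yoo 0) => n h; rewrite /= h.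
move=> /(_ mF FF (fun _ _ => isT)).
have i1 : P.-integrable setT (fun=> 1%E : \bar R).
  exact: (bmeas_integrable P _ (bmeas_cst 1)).
move=> /(_ i1 (fun n x _ => F01 n x)).
have -> : (\int[P]_(x in setT) 1)%E = 1%E :> \bar R.
  by rewrite integral_cst// mul1e; exact: probability_setT.
move=> h0; have h : fine (\int[P]_(x in setT) F n x)%E @[n --> \oo] --> (1 : R).
  by apply: fine_cvg; exact: h0.
apply: cvg_trans h; apply: near_eq_cvg.
apply: filterS (cvgy_ge _ yoo 0) => n hn.
by rewrite /lap /mean /Rintegral /F hn.
Qed.

End fibred.

(** * Laplace transforms of ergodic sums *)

Section exponential_integrals.
Context {R : realType}.
Local Notation leb := (@lebesgue_measure R).
Local Notation Rpos := (`]0, +oo[%classic : set R).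

Lemma is_derive_Nexp (x : R) : is_derive x 1 (fun t : R => - expR (- t)) (expR (- x)).
Proof.
have h1 : is_derive x 1 (fun t : R => expR (- t)) (- expR (- x)).
  have := @is_derive1_comp R expR -%R x (expR (- x)) (-1) (is_derive_expR _) (is_deriveNid x 1).
  by rewrite mulrN1.
have := @is_deriveN _ _ _ _ _ _ _ h1; by rewrite opprK.
Qed.

Lemma integral_exp_tail (y : R) :
  (\int[leb]_(x in `[y, +oo[) (expR (- x))%:E = (expR (- y))%:E)%E.
Proof.
have cN : continuous (fun t : R => expR (- t)).
  move=> z; apply: continuous_comp; last exact: continuous_expR.
  exact: (@continuousN _ R^o).
rewrite (@ge0_continuous_FTC2y _ _ (fun x => - (expR (- x))) _ 0)//.
- by rewrite EFinN oppeK add0e.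
- exact: continuous_subspaceT.
- by rewrite -oppr0; apply: cvgN; exact: cvgr_expR.
- by apply: cvgN; apply/cvg_at_right_filter; exact: cN.
- by move=> x _; rewrite derive1E; have [_ ->] := is_derive_Nexp x.
Qed.

Lemma integral_exp_tail_open (y : R) :
  (\int[leb]_(x in `]y, +oo[) (expR (- x))%:E = (expR (- y))%:E)%E.
Proof.
rewrite -integral_exp_tail; apply: integral_itv_obnd_cbnd.
by apply/measurable_EFinP; apply: measurable_funTS; apply: measurableT_comp.
Qed.

Lemma integrable_exp_le (f : R -> R) (c : R) : measurable_fun Rpos f ->
  (forall u, 0 < u -> 0 <= f u <= c * expR (- (2^-1) * u)) ->
  leb.-integrable Rpos (EFin \o f).
Proof.
move=> mf fc.
have h2 : 0 < 2^-1 :> R by rewrite invr_gt0.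
have iH : leb.-integrable Rpos (EFin \o (fun u => c * expR (- (2^-1) * u))).
  have := @integrableZl _ _ _ leb _ _ c _ (integrable_exp_pos _ h2).
  by move=> /(_ (measurable_itv _)); apply: eq_integrable.
apply: (@le_integrable _ _ _ leb Rpos _ _ _ _ _ iH).
- exact: measurable_itv.
- exact/measurable_EFinP.
- move=> u; rewrite /= in_itv /= andbT => u0; have /andP[h0 h1] := fc u u0.
  by rewrite lee_fin (ger0_norm h0) ger0_norm// (le_trans h0).
Qed.

Lemma exp_half (u : R) : expR (- u) = expR (- 2^-1 * u) * expR (- 2^-1 * u).
Proof. by rewrite -expRD; congr expR; field. Qed.

Lemma one_add_exp_le (u : R) : 0 < u -> (1 + u) * expR (- u) <= 2 * expR (- 2^-1 * u).
Proof.
move=> u0; rewrite exp_half mulrA ler_wpM2r ?expR_ge0//.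
have e2 : 1 + u <= 2 * expR (2^-1 * u).
  by have := expR_ge1Dx (2^-1 * u); lra.
apply: (le_trans (ler_wpM2r (expR_ge0 _) e2)).
by rewrite -mulrA -expRD mulNr subrr expR0 mulr1.
Qed.

Lemma powR_le (r x y : R) : 0 <= r -> 0 <= x -> x <= y -> x `^ r <= y `^ r.
Proof.
move=> r0 x0 xy; apply: (ge0_ler_powR r0) => //; rewrite nnegrE//.
exact: le_trans xy.
Qed.

Lemma Gamma_integrable (r : R) : 0 <= r ->
  leb.-integrable Rpos (EFin \o (fun t => t `^ r * expR (- t))).
Proof.
move=> r0; pose N := (Num.truncn r).+1.
(* From t^r <= (1 + t)^N and the term of order [N] of the exponential series at (1 + t) / 2. *)
apply: (integrable_exp_le _ (N`!%:R * 2 ^+ N * expR 2^-1)).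
  apply: measurable_funM; first by apply: measurable_funTS; exact: measurable_powR.
  by apply: measurable_funTS; apply: measurableT_comp.
move=> u u0; rewrite mulr_ge0 ?powR_ge0 ?expR_ge0//= exp_half mulrA.
apply: ler_wpM2r; first exact: expR_ge0.
rewrite mulNr expRN -ler_pdivlMr ?invr_gt0 ?expR_gt0// invrK.
have u1 : 1 <= 1 + u by rewrite lerDl ltW.
have u2 : 0 <= 1 + u by rewrite addr_ge0 ?ltW.
apply: (@le_trans _ _ ((1 + u) ^+ N)).
  rewrite -powR_mulrn//; apply: (@le_trans _ _ ((1 + u) `^ r)).
    by apply: powR_le => //; rewrite ?ltW// ltrDr.
  by apply: ler_powR => //; apply/ltW; exact: truncnS_gt.
have := expR_ge1Dxn (Num.truncn r) (divr_ge0 u2 (ler0n R 2)); rewrite -/N => h.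
have e : expR ((1 + u) / 2) = expR 2^-1 * expR (2^-1 * u).
  by rewrite -expRD; congr expR; field.
have : ((1 + u) / 2) ^+ N / N`!%:R <= expR 2^-1 * expR (2^-1 * u).
  by rewrite -e; apply: le_trans h; rewrite lerDr.
have N0 : 0 < N`!%:R :> R by rewrite ltr0n fact_gt0.
rewrite ler_pdivrMr// expr_div_n ler_pdivrMr ?exprn_gt0// => /le_trans; apply.
by rewrite le_eqVlt; apply/orP; left; apply/eqP; ring.
Qed.

(** On [1, +oo[ the integrand is at least e^(-t), so the integral is at least e^(-1). *)
Lemma Gamma_gt0 (gamma : R) : 0 <= gamma -> 0 < Gamma (1 + gamma).
Proof.
move=> g0.
apply: (@lt_le_trans _ _ (expR (- 1))); first exact: expR_gt0.
rewrite /Gamma addrAC subrr add0r /Rintegral -lee_fin fineK; last first.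
  by apply: integrable_fin_num; [exact: measurable_itv|exact: Gamma_integrable].
rewrite -integral_exp_tail.
have sub : `[1, +oo[%classic `<=` Rpos.
  by move=> x /=; rewrite !in_itv /= !andbT; apply: lt_le_trans.
have mf : measurable_fun Rpos (fun t => (t `^ gamma * expR (- t))%:E).
  by have /integrableP[] := Gamma_integrable _ g0.
apply: (@le_trans _ _ (\int[leb]_(x in `[1%R, +oo[) (x `^ gamma * expR (- x))%:E)%E).
  apply: ge0_le_integral.
  - exact: measurable_itv.
  - by move=> x _; rewrite lee_fin expR_ge0.
  - by apply/measurable_EFinP; apply: measurable_funTS; apply: measurableT_comp.
  - by apply: measurable_funS mf => //; exact: measurable_itv.
  - move=> x; rewrite /= in_itv /= andbT => x1; rewrite lee_fin ler_peMl ?expR_ge0//.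
    by have := powR_le gamma 1 x g0 ler01 x1; rewrite powR1.
apply: ge0_subset_integral => //; try exact: measurable_itv.
by move=> x _; rewrite lee_fin mulr_ge0 ?powR_ge0 ?expR_ge0.
Qed.

Lemma integral_powR_exp (r : R) : 0 <= r ->
  (\int[leb]_(x in Rpos) (x `^ r * expR (- x))%:E = (Gamma (1 + r))%:E)%E.
Proof.
move=> r0; rewrite /Gamma addrAC subrr add0r /Rintegral fineK//.
by apply: integrable_fin_num; [exact: measurable_itv|exact: Gamma_integrable].
Qed.

End exponential_integrals.

(** * Convergence of the Laplace transform of phi_n / b(n) *)

Section laplace_limit.
Context {d : measure_display} {T : measurableType d} {R : realType}.
Variables (P mu : probability T R) (S : T -> T) (alpha : set (set T)).
Variables (phi : T -> nat) (gamma : R) (b : nat -> R).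
Hypothesis hsys : probability_preserving_fibred_system P S alpha.
Hypothesis hmu : equivalent_measures mu P.
Hypothesis hmix : theta_mixing P mu S alpha.
Hypothesis phi_gt0 : forall x, (0 < phi x)%N.
Hypothesis hphi : partition_measurable alpha phi.
Hypothesis hgamma : 0 < gamma <= 1.

Local Notation leb := (@lebesgue_measure R).
Local Notation Rpos := (`]0, +oo[%classic : set R).
Local Notation es := (ergodic_sum S phi).
Local Notation a := (occupation P S phi).
Local Notation lap := (lap P S phi).

Let pr k n := fine (P [set x | (es k x <= n)%N]).

Let mes_le k n : measurable [set x | (es k x <= n)%N].
Proof. exact: (measurable_es_set P S alpha hsys phi hphi k [set m | (m <= n)%N]). Qed.

Let pr_ge0 k n : 0 <= pr k n. Proof. exact: fine_ge0. Qed.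

Let pr_le1 k n : pr k n <= 1. Proof. exact: prob_fine_le1. Qed.

Let pr_nd k m n : (m <= n)%N -> pr k m <= pr k n.
Proof. by move=> mn; apply: prob_fine_le => // x /= h; exact: leq_trans mn. Qed.

Let pr0 k n : (n < k)%N -> pr k n = 0.
Proof.
move=> nk; rewrite /pr (_ : [set x | _] = set0) ?measure0//.
apply/seteqP; split => x //= h.
by have := leq_trans (es_ge S phi phi_gt0 k x) h; rewrite leqNgt nk.
Qed.

Lemma occupation_ge0 n : 0 <= a n.
Proof. by apply: sumr_ge0 => k _; exact: prob_fine_ge0. Qed.

(** phi >= 1 gives phi_k >= k, so the terms with k > n vanish and a(n) is really the sum over all k.
    Its monotonicity follows. *)
Lemma occupation_stable n K : (n <= K)%N -> \sum_(1 <= k < K.+1) pr k n = a n.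
Proof.
move=> nK; rewrite (@big_cat_nat _ _ _ n.+1)//= [X in _ + X]big_nat [X in _ + X]big1 ?addr0//.
by move=> i /andP[ni _]; exact: pr0.
Qed.

Lemma occupation_nd m n : (m <= n)%N -> a m <= a n.
Proof.
move=> mn; rewrite -(occupation_stable m n mn); apply: ler_sum => i _; exact: pr_nd.
Qed.

Lemma occupation_le n : a n <= n%:R.
Proof.
rewrite /occupation; apply: (@le_trans _ _ (\sum_(1 <= k < n.+1) 1)).
  by apply: ler_sum => i _; exact: pr_le1.
by rewrite sumr_const_nat subSS subn0.
Qed.

Let mexp : measurable_fun Rpos (fun u : R => expR (- u)).
Proof. by apply: measurable_funTS; apply: measurableT_comp. Qed.

Let mpr k y : 0 <= y -> measurable_fun Rpos (fun u : R => at_real (pr k) (u * y)).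
Proof.
move=> y0; apply: nondecreasing_measurable; first exact: measurable_itv.
by move=> s t st; apply: pr_nd; apply: le_truncn; rewrite ler_wpM2r.
Qed.

(** Fubini, with e^(-s) written as the integral of e^(-u) over u >= s for s = phi_k / y. [0 < k]
    makes s positive, so u <= 0 contributes nothing. *)
Lemma lap_layer y k : 0 < y -> (0 < k)%N ->
  lap y k = Rintegral leb Rpos (fun u => at_real (pr k) (u * y) * expR (- u)).
Proof.
move=> y0 k0; rewrite /lap /mean /Rintegral; congr fine.
pose Z : set (T * measurableTypeR R) := [set z | 0 <= z.2 * y - (es k z.1)%:R].
have mZ : measurable Z.
  apply: (measurable_ge_set (fun z : T * measurableTypeR R => z.2 * y - (es k z.1)%:R)).
  apply: measurable_funB.
    by apply: measurable_funM => //; exact: measurable_snd.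
  by apply: (measurableT_comp (measurable_esR P S alpha hsys phi hphi k)); exact: measurable_fst.
pose f (z : T * measurableTypeR R) : \bar R := (expR (- z.2) * \1_Z z)%:E.
have mf : measurable_fun setT f.
  apply/measurable_EFinP; apply: measurable_funM; last exact: measurable_indic.
  apply: (@measurableT_comp _ _ _ _ _ _ (fun u : R => expR (- u))); last exact: measurable_snd.
  exact: measurableT_comp.
have f0 z : (0 <= f z)%E by rewrite lee_fin mulr_ge0 ?expR_ge0// indicE.
have es1 x : 0 < (es k x)%:R / y.
  by rewrite divr_gt0// ltr0n (leq_trans k0)// (es_ge S phi phi_gt0).
have := @fubini_tonelli _ _ _ _ _ P leb f mf f0.
have -> : (\int[P]_x \int[leb]_u f (x, u) = \int[P]_x (expes S phi y k x)%:E)%E.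
  apply: eq_integral => x _; rewrite /expes -integral_exp_tail [RHS]integral_mkcond.
  apply: eq_integral => u _; rewrite /f /patch /= indicE.
  have -> : ((x, u) \in Z) = (u \in `[(es k x)%:R / y, +oo[%classic).
    by apply/idP/idP; rewrite !inE /Z /= in_itv /= andbT subr_ge0 ler_pdivrMr.
  by case: ifP => _; rewrite ?mulr1// mulr0.
move=> ->; rewrite [RHS]integral_mkcond; apply: eq_integral => u _.
rewrite /patch; case: ifPn => [|nu].
  rewrite inE /= in_itv /= andbT => u0.
  pose W := [set x | (es k x <= Num.truncn (u * y))%N].
  have mW : measurable W by exact: mes_le.
  have WE x : ((x, u) \in Z) = (x \in W).
    by apply/idP/idP; rewrite !inE /Z /W /= truncn_ge_nat ?mulr_ge0 ?(ltW u0) ?(ltW y0)// subr_ge0.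
  transitivity (\int[P]_x ((expR (- u))%:E * (\1_W x)%:E))%E.
    by apply: eq_integral => x _; rewrite /f /= indicE WE -indicE EFinM.
  rewrite ge0_integralZl.
  - have -> : (\int[P]_x (\1_W x)%:E = P W)%E by rewrite integral_indic ?setIT.
    rewrite EFinM muleC; congr (_ * _)%E.
    by rewrite /at_real /pr fineK ?fin_num_measure.
  - exact: measurableT.
  - by apply/measurable_EFinP; exact: measurable_indic.
  - by move=> x _; rewrite lee_fin indicE.
  - by rewrite lee_fin expR_ge0.
apply: integral0_eq => x _; rewrite /f /= indicE (_ : (x, u) \in Z = false) ?mulr0//.
apply/negbTE; rewrite notin_setE /Z /= subr_ge0 -ler_pdivrMr// => h.
move: nu; rewrite notin_setE /= in_itv /= andbT; apply.
exact: lt_le_trans h.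
Qed.

(** At each [u] the partial sums of the integrands reach a(u y) e^(-u) after finitely many terms and
    never exceed it. The limit is thus its own dominating function, integrable since [a n <= n]. *)
Lemma lap_sum_cvg y : 0 < y ->
  \sum_(1 <= k < K.+1) lap y k @[K --> \oo] -->
  Rintegral leb Rpos (fun u => at_real a (u * y) * expR (- u)).
Proof.
move=> y0; have y0' := ltW y0.
pose F K u := \sum_(1 <= k < K.+1) at_real (pr k) (u * y) * expR (- u).
have mF K : measurable_fun Rpos (F K).
  rewrite /F; apply: measurable_sum => k.
  by apply: measurable_funM => //; exact: mpr.
have ma : measurable_fun Rpos (fun u => at_real a (u * y) * expR (- u)).
  apply: measurable_funM => //; apply: nondecreasing_measurable; first exact: measurable_itv.
  by move=> s t st; apply: occupation_nd; apply: le_truncn; rewrite ler_wpM2r.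
have dom u : 0 < u -> 0 <= at_real a (u * y) * expR (- u) <= (2 * y) * expR (- 2^-1 * u).
  move=> u0; rewrite mulr_ge0 ?expR_ge0 ?occupation_ge0//=.
  have uy : 0 <= u * y by rewrite mulr_ge0// ltW.
  apply: (@le_trans _ _ (y * ((1 + u) * expR (- u)))).
    rewrite mulrA ler_wpM2r ?expR_ge0//; apply: (le_trans (occupation_le _)).
    have /andP[h _] := truncn_itv uy; apply: (le_trans h).
    by rewrite mulrC ler_wpM2l// lerDr.
  by rewrite -(mulrC y) -mulrA ler_pM2l// one_add_exp_le.
have FE K u : F K u = (\sum_(1 <= k < K.+1) at_real (pr k) (u * y)) * expR (- u).
  by rewrite /F mulr_suml.
have Fle K u : 0 < u -> 0 <= F K u <= at_real a (u * y) * expR (- u).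
  move=> u0; have p0 k : 0 <= at_real (pr k) (u * y) by exact: pr_ge0.
  rewrite FE mulr_ge0 ?expR_ge0 ?sumr_ge0//=.
    rewrite ler_wpM2r ?expR_ge0// /at_real.
    rewrite -(occupation_stable _ (maxn (Num.truncn (u * y)) K) (leq_maxl _ _)).
    rewrite [leRHS](@big_cat_nat _ _ _ K.+1)//= ?ltnS ?leq_maxr// lerDl.
    by apply: sumr_ge0 => i _; exact: pr_ge0.
have ia : leb.-integrable Rpos (EFin \o (fun u => at_real a (u * y) * expR (- u))).
  exact: (integrable_exp_le _ _ ma dom).
have C : (\int[leb]_(u in Rpos) (F K u)%:E)%E @[K --> \oo] -->
    (\int[leb]_(u in Rpos) (at_real a (u * y) * expR (- u))%:E)%E.
  apply: (@dominated_cvg _ _ _ leb Rpos _ (fun K u => (F K u)%:E) _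
    (fun u => (at_real a (u * y) * expR (- u))%:E)).
  - exact: measurable_itv.
  - by move=> n; apply/measurable_EFinP; exact: mF.
  - move=> v; rewrite /= in_itv /= andbT => v0; apply: cvg_EFin; first by apply: nearW.
    under eq_fun do rewrite FE.
    apply: cvgMl; apply: cvg_near_cst; exists (Num.truncn (v * y)) => // K /= hK.
    exact: occupation_stable.
  - by [].
  - exact: ia.
  - move=> n u; rewrite /= in_itv /= andbT => u0; have /andP[h0 h1] := Fle n u u0.
    by rewrite lee_fin ger0_norm.
have ipr k : leb.-integrable Rpos (EFin \o (fun u => at_real (pr k) (u * y) * expR (- u))).
  apply: (integrable_exp_le _ 2); first by apply: measurable_funM => //; exact: mpr.
  move=> u u0; rewrite mulr_ge0 ?expR_ge0 ?pr_ge0//=.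
  apply: le_trans (one_add_exp_le u u0); rewrite ler_wpM2r ?expR_ge0//.
  by apply: (le_trans (pr_le1 _ _)); rewrite lerDl ltW.
have iF K : leb.-integrable Rpos (EFin \o F K).
  apply: (integrable_exp_le _ (2 * y)) => // u u0.
  have /andP[h0 h1] := Fle K u u0; rewrite h0 /=; apply: (le_trans h1).
  by have /andP[] := dom u u0.
have sumE K : \sum_(1 <= k < K.+1) lap y k = fine (\int[leb]_(u in Rpos) (F K u)%:E)%E.
  rewrite -[RHS]/(Rintegral leb Rpos (F K)).
  elim: K => [|K IH].
    rewrite big_nil /Rintegral integral0_eq// => u _.
    by rewrite /F big_nil.
  rewrite big_nat_recr//= IH lap_layer// -RintegralD; [|exact: measurable_itv|exact: iF|exact: ipr].
  by congr fine; apply: eq_integral => u _; rewrite /F [in RHS]big_nat_recr.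
under eq_fun do rewrite sumE.
apply: fine_cvg; rewrite fineK//.
by apply: integrable_fin_num => //; exact: measurable_itv.
Qed.

Hypothesis ha : regularly_varying a gamma.
Hypothesis hadapted : adapted a (theta_coef P mu S alpha).
Hypothesis hb : asymp_inverse a b.

Lemma theta_fin_near : \forall n \near \oo, theta_coef P mu S alpha n \is a fin_num.
Proof. by have /fine_cvgP[] := hmix. Qed.

Lemma inverse_cvgy : b n @[n --> \oo] --> +oo.
Proof.
case: hb => _ ab.
exact: (inverse_pinfty a b occupation_nd ab).
Qed.

Lemma laplace_limit lam : 0 < lam ->
  lap (b n / lam) n @[n --> \oo] --> expR (- (lam `^ gamma / Gamma (1 + gamma))).
Proof.
move=> lam0; have [_ ab] := hb; have boo := inverse_cvgy.
have xoo : b n / lam @[n --> \oo] --> +oo.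
  apply/cvgryPge => M; near=> n; rewrite ler_pdivlMr//.
  by near: n; exact: cvgy_ge.
(* [b] is arbitrary at small indices; the maximum makes the scale positive throughout and changes
   nothing eventually. *)
pose x n : R := Num.max (b n / lam) 1.
have x0 n : 0 < x n by rewrite /x lt_max ltr01 orbT.
have xE : \forall n \near \oo, x n = b n / lam.
  by apply: filterS (cvgy_ge _ xoo 1) => n h; rewrite /x; apply/max_idPl.
have xoo' : x n @[n --> \oo] --> +oo.
  by apply: cvg_trans xoo; apply: near_eq_cvg; apply: filterS xE => n ->.
pose c := Gamma (1 + gamma) * lam `^ (- gamma).
have c0 : 0 < c by rewrite mulr_gt0 ?powR_gt0// Gamma_gt0//; case/andP: hgamma => /ltW.
pose A n := Rintegral leb Rpos (fun u => at_real a (u * x n) * expR (- u)).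
have Ac : A n / n%:R @[n --> \oo] --> c.
  have := karamata_abel a gamma b occupation_ge0 occupation_nd hgamma ha ab lam lam0.
  apply: cvg_trans; apply: near_eq_cvg; apply: filterS xE => n xn.
  by rewrite /A xn.
pose th h : R := fine (theta_coef P mu S alpha h).
have [g0 _ hg0] := theta_fin_near.
have th0 h : 0 <= th h by apply: fine_ge0; exact: theta_coef_ge0.
have th_cvg : th @ \oo --> (0 : R) by apply: fine_cvg.
pose N n := Num.truncn (b n).
have Noo : N n @[n --> \oo] --> \oo by exact: cvg_truncn.
(* The gap is a(b(n)), about n: long enough for adaptedness with [delta = 1], and at most [2 n] as
   [renewal_core] requires. *)
pose g n := Num.truncn (1 * a (N n)).
have aNoo : a (N n) @[n --> \oo] --> +oo.
  apply/cvgryPge => M; near=> n.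
  have n0 : 0 < n%:R :> R by near: n; exact: near_nat_gt0.
  have h1 : 1 / 2 <= at_real a (b n) / n%:R by near: n; apply: (cvgr_ge _ ab); lra.
  have h2 : 2 * M <= n%:R by near: n; exact: (cvgy_ge _ (@cvgr_idn R)).
  by move: h1; rewrite ler_pdivlMr// /at_real -/(N n); lra.
have goo : g n @[n --> \oo] --> \oo.
  by apply: cvg_truncn; under eq_fun do rewrite mul1r.
have g_bnd : \forall n \near \oo, (g0 <= g n <= 2 * n)%N.
  near=> n; apply/andP; split.
    by near: n; apply: (goo [set m | (g0 <= m)%N]); exists g0.
  have n0 : 0 < n%:R :> R by near: n; exact: near_nat_gt0.
  have : at_real a (b n) / n%:R <= 2 by near: n; apply: (cvgr_le _ ab); lra.
  rewrite ler_pdivrMr// => h; rewrite /g mul1r -ltnS truncn_lt_nat ?occupation_ge0//.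
  by apply: (le_lt_trans h); rewrite -natrM ltr_nat.
have thx : th (g n) * x n / n%:R @[n --> \oo] --> (0 : R).
  have h1 := hadapted 1 ltr01.
  have h2 : (((N n)%:R / a (N n))%:E * theta_coef P mu S alpha (g n))%E @[n --> \oo] --> 0%E.
    exact: (cvg_comp _ _ Noo h1).
  have h3 : (N n)%:R / a (N n) * th (g n) @[n --> \oo] --> (0 : R).
    have h3 : fine (((N n)%:R / a (N n))%:E * theta_coef P mu S alpha (g n))%E @[n --> \oo] --> (0 : R).
      by apply: fine_cvg; exact: h2.
    apply: cvg_trans h3; apply: near_eq_cvg; near=> n => /=.
    rewrite fineM//; apply: hg0.
    by near: n; apply: (goo [set m | (g0 <= m)%N]); exists g0.
  (* x n / n is at most (N / a(N)) (2 / lam) (a(N) / n): the first factor times theta vanishes by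
     adaptedness at [N n], the last tends to 1, and the middle one comes from [b n <= 2 * N n]. *)
  have h4 : ((N n)%:R / a (N n) * th (g n)) * (2 / lam) * (at_real a (b n) / n%:R) @[n --> \oo] --> (0 : R).
    rewrite -(mul0r (1 : R)); apply: cvgM => //.
    by rewrite -(mul0r (2 / lam)); apply: cvgMl.
  apply: (@squeeze_cvgr _ _ _ _ (fun=> 0) (fun n => ((N n)%:R / a (N n) * th (g n)) * (2 / lam) * (at_real a (b n) / n%:R))) => //; last exact: cvg_cst.
  near=> n.
  have n0 : 0 < n%:R :> R by near: n; exact: near_nat_gt0.
  have aN : 0 < a (N n).
    apply: (@lt_le_trans _ _ 1) => //; near: n; exact: cvgy_ge.
  have xn : x n = b n / lam by near: n.
  have b1 : 1 <= b n by near: n; exact: cvgy_ge.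
  have b0 : 0 <= b n by exact: le_trans b1.
  have /andP[t1 t2] := truncn_itv b0.
  have bN : b n <= 2 * (N n)%:R.
    have N1 : 1 <= (N n)%:R :> R by rewrite ler1n truncn_gt0.
    by move: t2; rewrite -natr1 -/(N n); lra.
  rewrite mulr_ge0 ?invr_ge0 ?(ltW n0)//=; last by rewrite mulr_ge0 ?th0 ?(ltW (x0 n)).
  rewrite /at_real -/(N n) xn.
  have -> : (N n)%:R / a (N n) * th (g n) * (2 / lam) * (a (N n) / n%:R) =
     th (g n) * (2 * (N n)%:R / lam) / n%:R by field; rewrite !gt_eqF.
  rewrite ler_wpM2r ?invr_ge0 ?(ltW n0)// ler_wpM2l// ler_wpM2r// invr_ge0 ltW//.
have core : lap (x n) n @[n --> \oo] --> expR (- c^-1).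
  apply: (@renewal_core _ (fun n k => lap (x n) k) th x A g0 g c) => //.
  - by move=> n k; apply: (lap01 P S alpha hsys phi hphi); exact: ltW.
  - by move=> n k l kl; apply: (lap_le P S alpha hsys phi hphi) => //; exact: ltW.
  - by move=> n; exact: lap0.
  - by apply: nearW => n k l h gh; apply: (lap_gap P mu S alpha hsys hmu phi phi_gt0 hphi) => //; apply: hg0.
  - by apply: nearW => n k l h gh; apply: (lap_mul P mu S alpha hsys hmu phi phi_gt0 hphi) => //; apply: hg0.
  - by move=> k; exact: (lap_cvg1 P S alpha hsys phi hphi).
  - by apply: nearW => n; exact: lap_sum_cvg.
  - by apply: nearW.
have -> : lam `^ gamma / Gamma (1 + gamma) = c^-1 by rewrite /c powRN invfM invrK mulrC.
apply: cvg_trans core; apply: near_eq_cvg; apply: filterS xE => n ->//.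
Unshelve. all: by end_near. Qed.

End laplace_limit.

(** * Moments of the Mittag-Leffler distribution *)

Section continuous_functionals.
Context {R : realType}.

(** The method of moments on [0, 1], by a three-epsilon argument. It is stated for functionals in
    order to serve both the weighted means of the determinacy proof, where the sequence is constant,
    and the ergodic sums. *)
Lemma cvg_continuous_functional (Ln : nat -> (R -> R) -> R) (L : (R -> R) -> R) (G : R -> R) :
  {within `[0, 1], continuous G} ->
  (\forall n \near \oo, forall (p : {poly R}) e,
    (forall x, 0 <= x <= 1 -> `|G x - p.[x]| <= e) -> `|Ln n G - Ln n (horner p)| <= e) ->
  (forall (p : {poly R}) e,
    (forall x, 0 <= x <= 1 -> `|G x - p.[x]| <= e) -> `|L G - L (horner p)| <= e) ->
  (\forall n \near \oo, forall p : {poly R},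
    Ln n (horner p) = \sum_(i < size p) p`_i * Ln n (fun x => x ^+ i)) ->
  (forall p : {poly R}, L (horner p) = \sum_(i < size p) p`_i * L (fun x => x ^+ i)) ->
  (forall i, Ln n (fun x => x ^+ i) @[n --> \oo] --> L (fun x => x ^+ i)) ->
  Ln n G @[n --> \oo] --> L G.
Proof.
move=> cG hLn hL pLn pL lim; apply/cvgrPdist_le => e e0.
have e30 : 0 < e / 3 by rewrite divr_gt0.
have [p hp] := weierstrass G (e / 3) e30 cG.
have limp : Ln n (horner p) @[n --> \oo] --> L (horner p).
  rewrite pL; have : \sum_(i < size p) p`_i * Ln n (fun x => x ^+ i) @[n --> \oo] -->
      \sum_(i < size p) p`_i * L (fun x => x ^+ i).
    by apply: cvg_sumr => i; apply: cvgMr.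
  by apply: cvg_trans; apply: near_eq_cvg; apply: filterS pLn => n ->.
have hLp := hL p (e / 3) hp.
near=> n.
have h1 : `|Ln n G - Ln n (horner p)| <= e / 3.
  have : forall (p : {poly R}) e,
    (forall x, 0 <= x <= 1 -> `|G x - p.[x]| <= e) -> `|Ln n G - Ln n (horner p)| <= e by near: n.
  by apply.
have h2 : `|L (horner p) - Ln n (horner p)| <= e / 3.
  by near: n; move/cvgrPdist_le : limp; exact.
have -> : L G - Ln n G = (L G - L (horner p)) + (L (horner p) - Ln n (horner p)) - (Ln n G - Ln n (horner p)).
  by ring.
rewrite (le_trans (ler_normB _ _))// (le_trans (lerD (ler_normD _ _) (lexx _)))//.
lra.
Unshelve. all: by end_near. Qed.

End continuous_functionals.

(** * Taylor remainders of e^(-x) *)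

Section exponential_taylor.
Context {R : realType}.

Lemma is_derive_nneg_le (f f' : R -> R) (x : R) : (forall y : R, is_derive y 1 f (f' y)) ->
  (forall y, 0 < y -> 0 <= f' y) -> 0 <= x -> f 0 <= f x.
Proof.
move=> hf f0 x0.
have cf : continuous f.
  by move=> y; apply/differentiable_continuous/derivable1_diffP; case: (hf y).
apply: (@ger0_derive1_ndecry R f 0) => //.
- by move=> y; rewrite in_itv /= andbT => y0; rewrite derive1E; have [_ ->] := hf y; exact: f0.
- exact: continuous_subspaceT.
Qed.

Lemma is_derive_cpow n (k z : R) :
  is_derive z 1 (fun t : R => k * t ^+ n.+1) (k * n.+1%:R * z ^+ n).
Proof.
have H : is_derive z 1 (fun t : R => t ^+ n.+1) (n.+1%:R * z ^+ n).
  elim: n => [|n IH].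
    have -> : (fun t : R => t ^+ 1) = id by apply/funext => t; rewrite expr1.
    by rewrite mul1r expr0; exact: is_derive_id.
  have := is_deriveM IH (is_derive_id z 1).
  have -> : (fun t : R => t ^+ n.+1) * id = (fun t : R => t ^+ n.+2).
    by apply/funext => t; rewrite [in RHS]exprSr.
  move=> h; apply: (is_derive_eq h).
  by rewrite /GRing.scale /= mulr1 -[n.+2%:R]natr1 !exprS; ring.
have := is_deriveZ k H.
by rewrite /GRing.scale /= mulrA.
Qed.

Let tay J (x : R) := \sum_(j < J) (- x) ^+ j / j`!%:R.

Let is_derive_tay J (x : R) : is_derive x 1 (tay J.+1) (- tay J x).
Proof.
elim: J => [|J IH].
  have -> : tay 1 = cst 1.
    by apply/funext => y; rewrite /tay big_ord_recl big_ord0 expr0 fact0 divr1 addr0.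
  by rewrite /tay big_ord0 oppr0; exact: is_derive_cst.
have -> : tay J.+2 = tay J.+1 + (fun y => (J.+1`!%:R^-1 * (-1) ^+ J.+1) * (y ^+ J.+1)).
  apply/funext => y; rewrite /tay big_ord_recr /= [in RHS]/GRing.add /=.
  by congr (_ + _); rewrite [(- y) ^+ _]exprNn mulrC mulrA.
apply: (is_derive_eq (is_deriveD IH (is_derive_cpow J _ x))).
rewrite {2}/tay big_ord_recr /= opprD; congr (_ + _).
rewrite factS natrM exprS [(- x) ^+ _]exprNn.
by field; rewrite ?natr1 ?nat1r ?pnatr_eq0 -?lt0n ?fact_gt0.
Qed.

Lemma exp_taylor J (x : R) : 0 <= x ->
  `|expR (- x) - \sum_(j < J) (- x) ^+ j / j`!%:R| <= x ^+ J / J`!%:R.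
Proof.
(* With this sign [r J.+1] vanishes at 0 and has derivative [r J], so both bounds follow by
   integrating those of the previous order. *)
pose r J x := (-1) ^+ J * (expR (- x) - tay J x).
suff H : forall y, 0 <= y -> 0 <= r J y <= y ^+ J / J`!%:R.
  move=> x0; have /andP[h0 h1] := H x x0.
  have -> : expR (- x) - tay J x = (-1) ^+ J * r J x.
    by rewrite /r mulrA -expr2 sqrr_sign mul1r.
  by rewrite normrM normrX normrN1 expr1n mul1r ger0_norm.
elim: J => [|J IH] y y0.
  rewrite /r /tay big_ord0 subr0 !expr0 mul1r fact0 divr1 expR_ge0 /=.
  by rewrite -expR0 ler_expR oppr_le0.
have dr (z : R) : is_derive z 1 (r J.+1) (r J z).
  have -> : r J.+1 = (fun t => (-1) ^+ J *: (- expR (- t) + tay J.+1 t) : R).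
    by apply/funext => t; rewrite /r exprS mulN1r mulNr -mulrN opprB addrC.
  exact: (is_deriveZ ((-1) ^+ J) (is_deriveD (is_derive_Nexp z) (is_derive_tay J z))).
have fact0R n : 0 < n`!%:R :> R by rewrite ltr0n fact_gt0.
have r0 : r J.+1 0 = 0.
  rewrite /r /tay big_ord_recl /= expr0 fact0 divr1 oppr0 expR0 big1 ?addr0 ?subrr ?mulr0// => i _.
  by rewrite expr0n /= mul0r.
apply/andP; split.
  rewrite -r0; apply: (is_derive_nneg_le _ _ _ dr) => // z z0.
  by have /andP[] := IH z (ltW z0).
have dq (z : R) : is_derive z 1 (fun t => t ^+ J.+1 / J.+1`!%:R - r J.+1 t) (z ^+ J / J`!%:R - r J z).
  have -> : (fun t => t ^+ J.+1 / J.+1`!%:R - r J.+1 t) =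
     (fun t => (J.+1`!%:R^-1 * (t ^+ J.+1))) - r J.+1.
    by apply/funext => t; rewrite mulrC.
  apply: (is_derive_eq (is_deriveB (is_derive_cpow J _ z) (dr z))); congr (_ - _).
  rewrite factS natrM.
  by field; rewrite ?natr1 ?nat1r ?pnatr_eq0 -?lt0n ?fact_gt0.
have := is_derive_nneg_le _ _ y dq _ y0.
rewrite r0 expr0n /= mul0r subr0 subr_ge0; apply => z z0.
by rewrite subr_ge0; have /andP[] := IH z (ltW z0).
Qed.

End exponential_taylor.

Lemma leq_bin_exp n m : ('C(n, m) <= 2 ^ n)%N.
Proof.
elim: n m => [|n IH] [|m]; rewrite ?bin0 ?bin0n ?expn_gt0//.
by rewrite binS expnS mul2n -addnn leq_add.
Qed.

(** * Moment determinacy of the exponential law *)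

Section weighted_moments.
Context {d : measure_display} {Z : measurableType d} {R : realType}.
Variables (m : {measure set Z -> \bar R}) (rho V : Z -> R) (c : R).

(** The moments of the exponential law of mean [c]; [p = 0] says that [rho] has total mass 1. The
    weight allows laws to be carried by Lebesgue measure, on the line or in a product. *)
Definition exponential_moments :=
  [/\ measurable_fun setT rho, measurable_fun setT V,
      forall z, 0 <= rho z, forall z, 0 <= V z &
      forall p, (\int[m]_z (rho z * V z ^+ p)%:E)%E = (p`!%:R * c ^+ p)%:E].

Definition wmean (h : R -> R) : R := Rintegral m setT (fun z => rho z * h (V z)).

Hypothesis hexp : exponential_moments.

Let mrho : measurable_fun setT rho. Proof. by case: hexp. Qed.
Let mV : measurable_fun setT V. Proof. by case: hexp. Qed.
Let rho0 z : 0 <= rho z. Proof. by case: hexp. Qed.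
Let V0 z : 0 <= V z. Proof. by case: hexp. Qed.

Lemma Rintegral_lincomb (I : Type) (s : seq I) (a : I -> R) (F : I -> Z -> R) :
  (forall i, m.-integrable setT (EFin \o F i)) ->
  m.-integrable setT (EFin \o (fun z => \sum_(i <- s) a i * F i z)) /\
  Rintegral m setT (fun z => \sum_(i <- s) a i * F i z) = \sum_(i <- s) a i * Rintegral m setT (F i).
Proof.
move=> iF; elim: s => [|i s [IH1 IH2]].
  split; first by under eq_fun do rewrite big_nil; exact: integrable0.
  by rewrite big_nil /Rintegral integral0_eq// => z _; rewrite big_nil.
have iaF : m.-integrable setT (EFin \o (fun z => a i * F i z)).
  have := @integrableZl _ _ _ m _ _ (a i) _ (iF i).
  by move=> /(_ measurableT); apply: eq_integrable.
split.
  under eq_fun do rewrite big_cons.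
  have := @integrableD _ _ _ m setT measurableT _ _ iaF IH1.
  by apply: eq_integrable.
rewrite big_cons -IH2 -RintegralZl// -RintegralD//.
by apply: eq_Rintegral => z _; rewrite big_cons.
Qed.

Lemma wmean_integrable_pow p : m.-integrable setT (EFin \o (fun z => rho z * V z ^+ p)).
Proof.
apply/integrableP; split.
  by apply/measurable_EFinP; apply: measurable_funM => //; exact: measurable_funX.
under eq_integral do rewrite /= ger0_norm ?mulr_ge0 ?exprn_ge0//.
by case: hexp => _ _ _ _ ->; rewrite ltry.
Qed.

Lemma wmean_integrable_le (h : R -> R) p (C : R) : measurable_fun setT h ->
  (forall v, 0 <= v -> `|h v| <= C * v ^+ p) ->
  m.-integrable setT (EFin \o (fun z => rho z * h (V z))).
Proof.
move=> mh hC.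
have := @integrableZl _ _ _ m _ measurableT C _ (wmean_integrable_pow p).
apply: le_integrable => //.
  by apply/measurable_EFinP; apply: measurable_funM => //; exact: measurableT_comp.
move=> z _; rewrite /= lee_fin !normrM mulrCA ger0_norm// ler_wpM2l//.
apply: (le_trans (hC _ (V0 z))); rewrite -normrM; exact: ler_norm.
Qed.

Lemma wmean_pow p : wmean (fun v => v ^+ p) = p`!%:R * c ^+ p.
Proof. by rewrite /wmean /Rintegral; case: hexp => _ _ _ _ ->. Qed.

Let mpe p (theta : R) : measurable_fun setT (fun v : R => v ^+ p * expR (- (theta * v))).
Proof.
apply: measurable_funM; first exact: measurable_funX.
apply: measurableT_comp => //; apply: measurable_funN.
by apply: measurable_funM.
Qed.

Lemma wmean_integrable_exp p theta : 0 <= theta ->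
  m.-integrable setT (EFin \o (fun z => rho z * (V z ^+ p * expR (- (theta * V z))))).
Proof.
move=> t0; apply: (wmean_integrable_le (fun v => v ^+ p * expR (- (theta * v))) p 1) => //.
move=> v v0; rewrite ger0_norm ?mulr_ge0 ?exprn_ge0 ?expR_ge0// mul1r ler_piMr ?exprn_ge0//.
by rewrite -expR0 ler_expR oppr_le0 mulr_ge0.
Qed.

(** [exp_taylor] at [eta * V z], with the factor e^(-theta V) <= 1 dropped from the remainder. The
    powers [p] are carried along because expanding at [theta] calls for the means of all v^(p+j)
    e^(-theta v). *)
Lemma wmean_taylor p theta eta J : 0 <= theta -> 0 <= eta ->
  `|wmean (fun v => v ^+ p * expR (- ((theta + eta) * v))) -
    \sum_(j < J) ((- eta) ^+ j / j`!%:R) * wmean (fun v => v ^+ (p + j) * expR (- (theta * v)))|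
  <= eta ^+ J / J`!%:R * ((p + J)`!%:R * c ^+ (p + J)).
Proof.
move=> t0 e0.
have [i1 e1] := Rintegral_lincomb _ (index_enum 'I_J) (fun j => (- eta) ^+ j / j`!%:R)
  (fun j z => rho z * (V z ^+ (p + j) * expR (- (theta * V z))))
  (fun j => wmean_integrable_exp (p + j) theta t0).
rewrite /wmean -e1 -RintegralB//; last by apply: wmean_integrable_exp; rewrite addr_ge0.
apply: (le_trans (le_normr_Rintegral _ _)) => //.
  have := @integrableB _ _ _ m setT measurableT _ _ (wmean_integrable_exp p (theta + eta) (addr_ge0 t0 e0)) i1.
  by apply: eq_integrable.
rewrite -wmean_pow /wmean -RintegralZl//; last exact: wmean_integrable_pow.
apply: le_Rintegral => //.
- have := @integrableB _ _ _ m setT measurableT _ _ (wmean_integrable_exp p (theta + eta) (addr_ge0 t0 e0)) i1.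
  by move=> /integrable_abse; apply: eq_integrable.
- have := @integrableZl _ _ _ m _ measurableT (eta ^+ J / J`!%:R) _ (wmean_integrable_pow (p + J)).
  by apply: eq_integrable.
move=> z _.
have -> : \sum_(j < J) (- eta) ^+ j / j`!%:R * (rho z * (V z ^+ (p + j) * expR (- (theta * V z)))) =
   rho z * (V z ^+ p * expR (- (theta * V z))) * \sum_(j < J) (- (eta * V z)) ^+ j / j`!%:R.
  rewrite mulr_sumr; apply: eq_bigr => j _.
  have -> : - (eta * V z) = (- eta) * V z by rewrite mulNr.
  by rewrite exprD exprMn; ring.
have -> : rho z * (V z ^+ p * expR (- ((theta + eta) * V z))) =
   rho z * (V z ^+ p * expR (- (theta * V z))) * expR (- (eta * V z)).
  by rewrite mulrDl opprD expRD !mulrA.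
rewrite -mulrBr normrM ger0_norm ?mulr_ge0 ?exprn_ge0 ?expR_ge0//.
have := exp_taylor J (eta * V z) (mulr_ge0 e0 (V0 z)).
move=> /(ler_wpM2l (mulr_ge0 (rho0 z) (mulr_ge0 (exprn_ge0 p (V0 z)) (expR_ge0 (- (theta * V z)))))).
move=> /le_trans; apply.
have ee : expR (- (theta * V z)) <= 1 by rewrite -expR0 ler_expR oppr_le0 mulr_ge0.
rewrite [leRHS](_ : _ = rho z * (V z ^+ p * 1) * ((eta * V z) ^+ J / J`!%:R)); last first.
  by rewrite exprD exprMn; ring.
apply: ler_wpM2r; first by rewrite divr_ge0// exprn_ge0// mulr_ge0.
by apply: ler_wpM2l => //; apply: ler_wpM2l => //; exact: exprn_ge0.
Qed.

Lemma wmean_integrable_bounded (h : R -> R) (C : R) : measurable_fun setT h ->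
  (forall v, 0 <= v -> `|h v| <= C) ->
  m.-integrable setT (EFin \o (fun z => rho z * h (V z))).
Proof.
by move=> mh hC; apply: (wmean_integrable_le h 0 C) => // v v0; rewrite expr0 mulr1 hC.
Qed.

Let mexpd (delta : R) : measurable_fun setT (fun v : R => expR (- (delta * v))).
Proof.
by apply: measurableT_comp => //; apply: measurable_funN; apply: measurable_funM.
Qed.

Let expd01 (delta v : R) : 0 <= delta -> 0 <= v -> 0 <= expR (- (delta * v)) <= 1.
Proof. by move=> d0 v0; rewrite expR_ge0 -expR0 ler_expR oppr_le0 mulr_ge0. Qed.

Let int_pow delta i : 0 <= delta ->
  m.-integrable setT (EFin \o (fun z => rho z * expR (- (delta * V z)) ^+ i)).
Proof.
move=> d0; apply: (wmean_integrable_bounded (fun v => expR (- (delta * v)) ^+ i) 1).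
  by apply: measurable_funX; exact: mexpd.
move=> v v0; have /andP[a0 a1] := expd01 delta v d0 v0.
by rewrite ger0_norm ?exprn_ge0// exprn_ile1.
Qed.

Lemma wmean_poly delta (p : {poly R}) : 0 <= delta ->
  wmean (fun v => p.[expR (- (delta * v))]) =
  \sum_(i < size p) p`_i * wmean (fun v => expR (- (delta * v)) ^+ i).
Proof.
move=> d0.
have [_ e] := Rintegral_lincomb _ (index_enum 'I_(size p)) (fun i => p`_i)
  (fun i z => rho z * expR (- (delta * V z)) ^+ i) (fun i => int_pow delta i d0).
rewrite /wmean -e; apply: eq_Rintegral => z _.
by rewrite horner_coef mulr_sumr; apply: eq_bigr => i _; rewrite mulrCA.
Qed.

Lemma wmean_contract delta (G : R -> R) (p : {poly R}) e : 0 <= delta ->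
  measurable_fun setT G -> (forall x, 0 <= G x <= 1) ->
  (forall x, 0 <= x <= 1 -> `|G x - p.[x]| <= e) ->
  `|wmean (fun v => G (expR (- (delta * v)))) - wmean (fun v => p.[expR (- (delta * v))])| <= e.
Proof.
move=> d0 mG G01 Gp.
have mp : measurable_fun setT (horner p).
  have -> : horner p = (fun x => \sum_(i < size p) p`_i * x ^+ i).
    by apply/funext => x; rewrite horner_coef.
  by apply: measurable_sum => i; apply: measurable_funM => //; exact: measurable_funX.
have iG : m.-integrable setT (EFin \o (fun z => rho z * G (expR (- (delta * V z))))).
  apply: (wmean_integrable_bounded (fun v => G (expR (- (delta * v)))) 1).
    exact: measurableT_comp.
  by move=> v _; have /andP[a0 a1] := G01 (expR (- (delta * v))); rewrite ger0_norm.
have ip : m.-integrable setT (EFin \o (fun z => rho z * p.[expR (- (delta * V z))])).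
  apply: (wmean_integrable_bounded (fun v => p.[expR (- (delta * v))]) (e + 1)).
    exact: measurableT_comp.
  move=> v v0; have := Gp _ (expd01 delta v d0 v0); have /andP[a0 a1] := G01 (expR (- (delta * v))).
  by rewrite ler_norml => /andP[b0 b1]; rewrite ler_norml; apply/andP; split; lra.
have i0 := wmean_integrable_pow 0.
rewrite /wmean -RintegralB//.
apply: (le_trans (le_normr_Rintegral _ _)) => //.
  by have := @integrableB _ _ _ m setT measurableT _ _ iG ip; apply: eq_integrable.
apply: (@le_trans _ _ (Rintegral m setT (fun z => e * (rho z * V z ^+ 0)))); last first.
  rewrite RintegralZl// -[Rintegral _ _ _]/(wmean (fun v => v ^+ 0)) wmean_pow.
  by rewrite expr0 mul1r mulr1.
apply: le_Rintegral => //.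
- have := @integrableB _ _ _ m setT measurableT _ _ iG ip.
  by move=> /integrable_abse; apply: eq_integrable.
- by have := @integrableZl _ _ _ m _ measurableT e _ i0; apply: eq_integrable.
move=> z _; rewrite -mulrBr normrM ger0_norm// expr0 mulr1 mulrC ler_wpM2r//.
by apply: Gp; exact: expd01.
Qed.

Lemma wmean_dominated (G : nat -> R -> R) (h : R -> R) : (forall n, measurable_fun setT (G n)) ->
  (forall n v, 0 <= G n v <= 1) -> (forall v, 0 <= v -> G n v @[n --> \oo] --> h v) ->
  wmean (G n) @[n --> \oo] --> wmean h.
Proof.
move=> mG G01 Gh.
have mGV n : measurable_fun setT (fun z => (rho z * G n (V z))%:E).
  by apply/measurable_EFinP; apply: measurable_funM => //; exact: measurableT_comp.
have dom n z : setT z -> (`|(rho z * G n (V z))%:E| <= (rho z * V z ^+ 0)%:E)%E.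
  move=> _; have /andP[a0 a1] := G01 n (V z).
  by rewrite lee_fin expr0 mulr1 ger0_norm ?mulr_ge0// ler_piMr.
have lim z : setT z -> (rho z * G n (V z))%:E @[n --> \oo] --> (rho z * h (V z))%:E.
  by move=> _; apply: cvg_EFin; [exact: nearW|apply: cvgMr; exact: Gh].
have i0 := wmean_integrable_pow 0.
have fin z : setT z -> (rho z * V z ^+ 0)%:E \is a fin_num by [].
have C := @dominated_cvg _ _ _ m setT measurableT _ _ (fun z => (rho z * V z ^+ 0)%:E) mGV lim fin i0 dom.
have ih : m.-integrable setT (fun z => (rho z * h (V z))%:E).
  apply: (@le_integrable _ _ _ m setT measurableT _ (fun z => (rho z * V z ^+ 0)%:E)) => //.
    exact: (emeasurable_fun_cvg _ _ mGV lim).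
  move=> z zT; rewrite /= lee_fin [leRHS]ger0_norm ?mulr_ge0 ?exprn_ge0//.
  have ca : `|rho z * G n (V z)| @[n --> \oo] --> `|rho z * h (V z)|.
    by apply: cvg_norm; apply: cvgMr; exact: Gh.
  apply: (cvgr_to_le ca); apply: nearW => n.
  by have := dom n z zT; rewrite /= lee_fin.
apply: fine_cvg; rewrite fineK//.
exact: integrable_fin_num.
Qed.

End weighted_moments.

Section determinacy.
Context {d1 d2 : measure_display} {Z1 : measurableType d1} {Z2 : measurableType d2} {R : realType}.
Variables (m1 : {measure set Z1 -> \bar R}) (rho1 V1 : Z1 -> R).
Variables (m2 : {measure set Z2 -> \bar R}) (rho2 V2 : Z2 -> R) (c : R).
Hypothesis c0 : 0 < c.
Hypothesis h1 : exponential_moments m1 rho1 V1 c.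
Hypothesis h2 : exponential_moments m2 rho2 V2 c.

(** (p + J)! <= 2^(p + J) p! J! leaves a geometric factor of ratio 2 eta c <= 1/2; this fixes the
    step length 1 / (4c). *)
Lemma factorial_moment_bound p J (eta : R) : 0 <= eta <= (4 * c)^-1 ->
  eta ^+ J / J`!%:R * ((p + J)`!%:R * c ^+ (p + J)) <= p`!%:R * (2 * c) ^+ p * 2^-1 ^+ J.
Proof.
move=> /andP[e0 e1].
have cb : (p + J)`!%:R <= 2 ^+ (p + J) * p`!%:R * J`!%:R :> R.
  rewrite -natrX -!natrM ler_nat -(bin_fact (leq_addr J p)) addKn mulnA.
  by rewrite leq_mul2r leq_mul2r leq_bin_exp !orbT.
have J0 : 0 < J`!%:R :> R by rewrite ltr0n fact_gt0.
have c0' := ltW c0.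
apply: (@le_trans _ _ (eta ^+ J / J`!%:R * (2 ^+ (p + J) * p`!%:R * J`!%:R * c ^+ (p + J)))).
  apply: ler_wpM2l; first by rewrite divr_ge0// exprn_ge0.
  by apply: ler_wpM2r => //; exact: exprn_ge0.
have -> : eta ^+ J / J`!%:R * (2 ^+ (p + J) * p`!%:R * J`!%:R * c ^+ (p + J)) =
   p`!%:R * (2 * c) ^+ p * (2 * (eta * c)) ^+ J.
  by rewrite !exprD !exprMn; field; rewrite gt_eqF.
apply: ler_wpM2l; first by rewrite mulr_ge0// exprn_ge0// mulr_ge0.
apply: lerXn2r; rewrite ?nnegrE ?mulr_ge0 ?invr_ge0//.
have ec : eta * c <= 4^-1 by rewrite -ler_pdivlMr// -invfM.
by lra.
Qed.

(* Moment determinacy: the Taylor series in the exponent converges on a step of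
   length [1 / (4 c)], uniformly in the starting point [theta]. *)
Lemma wmean_exp_step theta eta : 0 <= theta -> 0 <= eta <= (4 * c)^-1 ->
  (forall p, wmean m1 rho1 V1 (fun v => v ^+ p * expR (- (theta * v))) =
             wmean m2 rho2 V2 (fun v => v ^+ p * expR (- (theta * v)))) ->
  forall p, wmean m1 rho1 V1 (fun v => v ^+ p * expR (- ((theta + eta) * v))) =
            wmean m2 rho2 V2 (fun v => v ^+ p * expR (- ((theta + eta) * v))).
Proof.
move=> t0 e01 IH p; have /andP[e0 _] := e01; apply/eqP; rewrite -subr_eq0 -normr_le0.
set a := wmean m1 _ _ _; set b := wmean m2 _ _ _.
have lim : 2 * (p`!%:R * (2 * c) ^+ p * 2^-1 ^+ J) @[J --> \oo] --> (0 : R).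
  rewrite -[X in _ --> X](mulr0 2); apply: cvgMr.
  rewrite -[X in _ --> X](mulr0 (p`!%:R * (2 * c) ^+ p)); apply: cvgMr.
  by apply: cvg_expr; rewrite ger0_norm ?invr_ge0// invf_lt1// ltr1n.
apply: (cvgr_to_ge lim); apply: nearW => J.
have T1 := wmean_taylor m1 rho1 V1 c h1 p theta eta J t0 e0.
have T2 := wmean_taylor m2 rho2 V2 c h2 p theta eta J t0 e0.
have B := factorial_moment_bound p J eta e01.
move: T1; under eq_bigr do rewrite IH; move=> T1.
set s := \sum_(_ < _) _ in T1 T2.
have -> : a - b = (a - s) - (b - s) by ring.
apply: (le_trans (ler_normB _ _)).
apply: (le_trans (lerD (le_trans T1 B) (le_trans T2 B))).
by rewrite -mulr2n -[leLHS]mulr_natl.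
Qed.

Let delta := (4 * c)^-1.
Let delta0 : 0 < delta. Proof. by rewrite invr_gt0 mulr_gt0. Qed.

Lemma wmean_exp_eq n p : wmean m1 rho1 V1 (fun v => v ^+ p * expR (- ((n%:R * delta) * v))) =
  wmean m2 rho2 V2 (fun v => v ^+ p * expR (- ((n%:R * delta) * v))).
Proof.
elim: n p => [|n IH] p.
  have e : (fun v : R => v ^+ p * expR (- ((0%:R * delta) * v))) = (fun v => v ^+ p).
    by apply/funext => v; rewrite !mul0r oppr0 expR0 mulr1.
  by rewrite e (wmean_pow _ _ _ c h1) (wmean_pow _ _ _ c h2).
rewrite -natr1 mulrDl mul1r; apply: wmean_exp_step => //.
  by rewrite mulr_ge0// ltW.
by rewrite (ltW delta0) lexx.
Qed.

(** The Laplace transforms agree at the multiples of [delta], hence so do the means of polynomials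
    in u = e^(-delta v). Weierstrass extends this to the continuous ramps [G n], which tend to the
    indicator of u < e^(-delta), that is, of v > 1. *)
Lemma wmean_tail_eq :
  wmean m1 rho1 V1 (fun v => (1 < v)%R%:R) = wmean m2 rho2 V2 (fun v => (1 < v)%R%:R).
Proof.
have d0 := ltW delta0.
pose t := expR (- (delta * 1)).
pose G n u : R := Num.min 1 (Num.max 0 (n%:R * (t - u))).
have G01 n u : 0 <= G n u <= 1.
  by rewrite /G ge_min lexx /= le_min ler01 le_max lexx.
have cG n : continuous (G n).
  have cl : continuous (fun u : R => n%:R * (t - u)).
    by move=> u; apply: cvgMr; apply: cvgB; [exact: cvg_cst|exact: cvg_id].
  have c1 : continuous ((cst 0 : R -> R) \max (fun u : R => n%:R * (t - u))).
    by apply: max_fun_continuous => // u; exact: cvg_cst.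
  by apply: min_fun_continuous => // u; exact: cvg_cst.
have mG n : measurable_fun setT (G n) by exact: continuous_measurable_fun.
have Geq n : wmean m1 rho1 V1 (fun v => G n (expR (- (delta * v)))) =
    wmean m2 rho2 V2 (fun v => G n (expR (- (delta * v)))).
  pose L1 (F : R -> R) := wmean m1 rho1 V1 (fun v => F (expR (- (delta * v)))).
  pose L2 (F : R -> R) := wmean m2 rho2 V2 (fun v => F (expR (- (delta * v)))).
  have : L1 (G n) @[_ --> \oo] --> L2 (G n).
    apply: (@cvg_continuous_functional _ (fun=> L1) L2 (G n)).
    - exact: continuous_subspaceT.
    - by apply: nearW => _ p e hp; apply: (wmean_contract m1 rho1 V1 c h1 delta (G n)).
    - by move=> p e hp; apply: (wmean_contract m2 rho2 V2 c h2 delta (G n)).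
    - by apply: nearW => _ p; apply: (wmean_poly m1 rho1 V1 c h1 delta).
    - by move=> p; apply: (wmean_poly m2 rho2 V2 c h2 delta).
    move=> i; have -> : L1 (fun x => x ^+ i) = L2 (fun x => x ^+ i); last exact: cvg_cst.
    have e : (fun v : R => expR (- (delta * v)) ^+ i) = (fun v => v ^+ 0 * expR (- ((i%:R * delta) * v))).
      by apply/funext => v; rewrite expr0 mul1r -expRM_natl mulrN mulrA.
    by rewrite /L1 /L2 e; exact: wmean_exp_eq.
  move=> h; apply: (@cvg_unique _ (@Rhausdorff R) ((fun=> L1 (G n)) @ \oo)) => //.
  exact: cvg_cst.
have limG v : 0 <= v -> G n (expR (- (delta * v))) @[n --> \oo] --> ((1 < v)%R%:R : R).
  move=> v0; have [v1|v1] := ltP 1 v.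
    have ut : 0 < t - expR (- (delta * v)).
      by rewrite subr_gt0 /t ltr_expR ltrN2 ltr_pM2l.
    apply: cvg_near_cst; near=> n.
    have h : 1 <= n%:R * (t - expR (- (delta * v))).
      rewrite -ler_pdivrMr//; near: n; exact: (cvgy_ge _ (@cvgr_idn R)).
    by rewrite /G; apply/min_idPl; rewrite le_max h orbT.
  apply: cvg_near_cst; apply: nearW => n; rewrite /G.
  have h : n%:R * (t - expR (- (delta * v))) <= 0.
    by rewrite mulr_ge0_le0// subr_le0 /t ler_expR lerN2 ler_pM2l.
  by rewrite (max_idPl h); apply/min_idPr; exact: ler01.
have mGe n : measurable_fun setT (fun v : R => G n (expR (- (delta * v)))).
  apply: measurableT_comp => //; apply: measurableT_comp => //.
  by apply: measurable_funN; apply: measurable_funM.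
have C1 := wmean_dominated m1 rho1 V1 c h1 (fun n v => G n (expR (- (delta * v)))) _ mGe
  (fun n v => G01 n _) limG.
have C2 := wmean_dominated m2 rho2 V2 c h2 (fun n v => G n (expR (- (delta * v)))) _ mGe
  (fun n v => G01 n _) limG.
have E : (fun n => wmean m1 rho1 V1 (fun v => G n (expR (- (delta * v))))) =
    (fun n => wmean m2 rho2 V2 (fun v => G n (expR (- (delta * v))))) by apply/funext.
have C1' : wmean m2 rho2 V2 (fun v => G n (expR (- (delta * v)))) @[n --> \oo] -->
    wmean m1 rho1 V1 (fun v => (1 < v)%R%:R) by rewrite -E.
exact: (@cvg_unique _ (@Rhausdorff R) _ _ _ _ C1' C2).
Unshelve. all: by end_near. Qed.

End determinacy.

(** * The Gamma function at integers *)

Section gamma_integers.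
Context {R : realType}.
Local Notation leb := (@lebesgue_measure R).
Local Notation Rpos := (`]0, +oo[%classic : set R).

(** The polynomial from repeated integration by parts: [- (gq p x * expR (- x))] is a primitive of
    x^p e^(-x). *)
Let gq := fix gq p (x : R) := if p is p'.+1 then x ^+ p + p%:R * gq p' x else 1.

Let is_derive_gq p (x : R) : is_derive x 1 (gq p) (gq p x - x ^+ p).
Proof.
elim: p => [|p IH]; first by rewrite expr0 subrr; exact: is_derive_cst.
have h := is_deriveD (is_derive_cpow p 1 x) (is_deriveZ p.+1%:R IH).
have -> : gq p.+1 = (fun t => 1 * t ^+ p.+1) + (p.+1%:R *: gq p).
  by apply/funext => t; rewrite [RHS]/GRing.add /= mul1r.
apply: (is_derive_eq h); rewrite mul1r /GRing.scale /=.
have -> : ((fun t : R => 1 * t ^+ p.+1) + p.+1%:R \*: gq p) x = x ^+ p.+1 + p.+1%:R * gq p x.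
  by rewrite [LHS]/GRing.add /= mul1r.
ring.
Qed.

Let is_derive_gqexp p (x : R) : is_derive x 1 (fun t => - (gq p t * expR (- t))) (x ^+ p * expR (- x)).
Proof.
have h := is_deriveM (is_derive_gq p x) (is_derive_Nexp x).
have -> : (fun t => - (gq p t * expR (- t))) = gq p * (fun t => - expR (- t)).
  by apply/funext => t; rewrite /GRing.mul /= mulrN.
apply: (is_derive_eq h); rewrite /GRing.scale /=; ring.
Qed.

Let cvg_pow_exp p : x ^+ p * expR (- x) @[x --> +oo] --> (0 : R).
Proof.
have ub : p.+1`!%:R * x^-1 @[x --> +oo] --> (0 : R).
  rewrite -[X in _ --> X](mulr0 p.+1`!%:R); apply: cvgMr.
  apply/cvgrPdist_le => e e0; near=> x.
  have xe : e^-1 < x by near: x; apply: nbhs_pinfty_gt; rewrite num_real.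
  have x0 : 0 < x by apply: lt_trans xe; rewrite invr_gt0.
  by rewrite sub0r normrN gtr0_norm ?invr_gt0// invf_ple ?posrE// ltW.
apply: (@squeeze_cvgr _ _ _ _ (cst 0) (fun x : R => p.+1`!%:R * x^-1)) => //; last exact: cvg_cst.
near=> x.
have x0 : 0 < x by near: x; exact: nbhs_pinfty_gt.
apply/andP; split; first by rewrite mulr_ge0 ?exprn_ge0 ?expR_ge0// ltW.
rewrite expRN ler_pdivrMr ?expR_gt0// mulrAC ler_pdivlMr// -exprSr.
have := expR_ge1Dxn p (ltW x0) => h.
rewrite -ler_pdivrMl ?ltr0n ?fact_gt0// mulrC; apply: le_trans h; by rewrite lerDr.
Unshelve. all: by end_near. Qed.

Let cvg_gqexp p : gq p x * expR (- x) @[x --> +oo] --> (0 : R).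
Proof.
elim: p => [|p IH].
  have := cvg_pow_exp 0; under eq_fun do rewrite expr0.
  by apply.
have : x ^+ p.+1 * expR (- x) + p.+1%:R * (gq p x * expR (- x)) @[x --> +oo] --> (0 + p.+1%:R * 0 : R).
  by apply: cvgD; [exact: cvg_pow_exp|apply: cvgMr; exact: IH].
rewrite mulr0 addr0; apply: cvg_trans; apply: near_eq_cvg; apply: nearW => x /=.
by ring.
Qed.

Let gq0 p : gq p 0 = p`!%:R.
Proof. by elim: p => [|p IH] //=; rewrite expr0n /= add0r IH factS natrM. Qed.

Lemma integral_pow_exp p : (\int[leb]_(x in Rpos) (x ^+ p * expR (- x))%:E = p`!%:R%:E)%E.
Proof.
have cF (x : R) : {for x, continuous (fun t => - (gq p t * expR (- t)))}.
  by apply/differentiable_continuous/derivable1_diffP; case: (is_derive_gqexp p x).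
have cf : continuous (fun x : R => x ^+ p * expR (- x)).
  move=> x; apply: cvgM; first exact: exprn_continuous.
  apply: continuous_comp; last exact: continuous_expR.
  exact: (@continuousN _ R^o).
rewrite integral_itv_obnd_cbnd; last first.
  by apply/measurable_EFinP; apply: measurable_funTS; exact: continuous_measurable_fun.
rewrite (@ge0_continuous_FTC2y _ _ (fun t => - (gq p t * expR (- t))) _ 0)//.
- by rewrite oppr0 expR0 gq0 mulr1 sub0e -EFinN opprK.
- by move=> x x0; rewrite mulr_ge0 ?exprn_ge0 ?expR_ge0.
- exact: continuous_subspaceT.
- by rewrite -oppr0; apply: cvgN; exact: cvg_gqexp.
- by move=> x _; case: (is_derive_gqexp p x).
- by apply: cvg_at_right_filter; exact: cF.
- by move=> x _; rewrite derive1E; have [_ ->] := is_derive_gqexp p x.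
Qed.

Lemma Gamma_nat p : Gamma (1 + p%:R) = p`!%:R :> R.
Proof.
apply: EFin_inj; rewrite -integral_powR_exp// -integral_pow_exp.
apply: eq_integral => x; rewrite inE /= in_itv /= andbT => x0.
by rewrite powR_mulrn// ltW.
Qed.

End gamma_integers.

(** * Laplace transform of the stable law from the Mittag-Leffler moments *)

Section mittag_leffler_laplace.
Context {d : measure_display} {W : measurableType d} {R : realType}.
Variables (P : probability W R) (Y : {RV P >-> R}) (gamma lam : R).
Hypotheses (gamma0 : 0 < gamma) (lam0 : 0 < lam) (hY : mittag_leffler Y gamma).
Local Notation leb := (@lebesgue_measure R).
Local Notation Rpos := (`]0, +oo[%classic : set R).

Let c := Gamma (1 + gamma) * lam `^ (- gamma).
Let c0 : 0 < c. Proof. by rewrite mulr_gt0 ?powR_gt0// Gamma_gt0// ltW. Qed.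

Let rho (x : measurableTypeR R) : R := expR (- x) * \1_Rpos x.

Let mrho : measurable_fun setT rho.
Proof.
apply: measurable_funM; last exact: measurable_indic.
by apply: measurableT_comp => //; exact: measurable_funN.
Qed.

Let rho0 x : 0 <= rho x.
Proof. by rewrite mulr_ge0 ?expR_ge0// indicE. Qed.

Let integral_rho (f : R -> R) :
  (\int[leb]_x (rho x * f x)%:E = \int[leb]_(x in Rpos) (f x * expR (- x))%:E)%E.
Proof.
rewrite [RHS]integral_mkcond; apply: eq_integral => x _.
rewrite /rho /patch indicE; case: ifP => _; last by rewrite mulr0 mul0r.
by rewrite mulr1 mulrC.
Qed.

Let V2 (x : measurableTypeR R) : R := c * `|x|.

Let exp_moments_line : exponential_moments leb rho V2 c.
Proof.
split => //.
- by apply: measurable_funM => //; exact: measurableT_comp.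
- by move=> x; rewrite mulr_ge0// ltW.
move=> p; rewrite (integral_rho (fun x => V2 x ^+ p)).
rewrite mulrC EFinM -integral_pow_exp -ge0_integralZl.
- apply: eq_integral => x; rewrite inE /= in_itv /= andbT => x0.
  by rewrite -EFinM /V2 gtr0_norm// exprMn mulrA.
- exact: measurable_itv.
- apply/measurable_EFinP; apply: measurable_funM; first exact: measurable_funX.
  by apply: measurable_funTS; apply: measurableT_comp.
- move=> x; rewrite /= in_itv /= andbT => x0; rewrite lee_fin mulr_ge0 ?exprn_ge0 ?expR_ge0//.
  exact: ltW.
- by rewrite lee_fin exprn_ge0// ltW.
Qed.

(* For [X] exponential and independent of [Y], [X^gamma Y / lam^gamma] has the
   moments [p! c^p] of an exponential variable, and it exceeds 1 iff
   [X > lam Y^(-1/gamma)]. *)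
Let rho1 (z : W * measurableTypeR R) : R := rho z.2.
Let V1 (z : W * measurableTypeR R) : R := z.2 `^ gamma * (Y z.1 * lam `^ (- gamma)).

Let mrho1 : measurable_fun setT rho1.
Proof. by apply: (measurableT_comp mrho); exact: measurable_snd. Qed.

Let mV1 : measurable_fun setT V1.
Proof.
apply: measurable_funM.
  apply: (@measurableT_comp _ _ _ _ _ _ (fun x : R => x `^ gamma)); first exact: measurable_powR.
  exact: measurable_snd.
apply: measurable_funM => //.
by apply: measurableT_comp => //; exact: measurable_fst.
Qed.

Let Y0 w : 0 <= Y w. Proof. by case: hY. Qed.

Let V10 z : 0 <= V1 z. Proof. by rewrite !mulr_ge0 ?powR_ge0. Qed.

Let fubini1 (h : R -> R) : measurable_fun setT h -> (forall x, 0 <= h x) ->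
  (\int[P \x leb]_z (rho1 z * h (V1 z))%:E =
   \int[P]_w \int[leb]_(x in Rpos) (h (V1 (w, x)) * expR (- x))%:E)%E.
Proof.
move=> mh h0.
have mf : measurable_fun setT (fun z => (rho1 z * h (V1 z))%:E).
  by apply/measurable_EFinP; apply: measurable_funM => //; exact: measurableT_comp.
rewrite fubini_tonelli1//; last by move=> z; rewrite lee_fin mulr_ge0// rho0.
apply: eq_integral => w _; rewrite /fubini_F.
exact: (integral_rho (fun x => h (V1 (w, x)))).
Qed.

Let mpow p : measurable_fun setT (fun v : R => `|v| ^+ p).
Proof. by apply: measurable_funX; exact: normr_measurable. Qed.

(** Integrating x^(p gamma) e^(-x) produces Gamma(1 + p gamma), which cancels the denominator of the
    Mittag-Leffler moment. *)
Let exp_moments_prod : exponential_moments (P \x leb)%E rho1 V1 c.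
Proof.
split => //; first by move=> z; exact: rho0.
move=> p; have pg : 0 <= p%:R * gamma by rewrite mulr_ge0// ltW.
(* [fubini1] asks for a function that is non-negative on the whole line, hence the absolute
   value. *)
have -> : (\int[P \x leb]_z (rho1 z * V1 z ^+ p)%:E =
           \int[P \x leb]_z (rho1 z * `|V1 z| ^+ p)%:E)%E.
  by apply: eq_integral => z _; rewrite (ger0_norm (V10 z)).
rewrite (fubini1 _ (mpow p) (fun x => exprn_ge0 p (normr_ge0 x))).
transitivity (\int[P]_w ((lam `^ (- gamma) ^+ p * Gamma (1 + p%:R * gamma))%:E * (Y w ^+ p)%:E))%E.
  apply: eq_integral => w _.
  rewrite (_ : (_ * _)%E = ((lam `^ (- gamma) ^+ p * Y w ^+ p)%:E * (Gamma (1 + p%:R * gamma))%:E)%E); last first.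
    by rewrite -!EFinM; congr EFin; ring.
  rewrite -integral_powR_exp//.
  rewrite -ge0_integralZl.
  - apply: eq_integral => x; rewrite inE /= in_itv /= andbT => x0.
    rewrite -EFinM ger0_norm// /V1 /= !exprMn; congr EFin.
    rewrite [p%:R * _]mulrC powRrM powR_mulrn ?powR_ge0//; ring.
  - exact: measurable_itv.
  - apply/measurable_EFinP; apply: measurable_funM.
      by apply: measurable_funTS; exact: measurable_powR.
    by apply: measurable_funTS; apply: measurableT_comp.
  - by move=> x _; rewrite lee_fin mulr_ge0 ?powR_ge0 ?expR_ge0.
  - by rewrite lee_fin mulr_ge0 ?exprn_ge0// powR_ge0.
have G0 := Gamma_gt0 _ pg.
rewrite ge0_integralZl//.
- have [_ /(_ p)] := hY; rewrite unlock => ->.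
  rewrite -EFinM /c exprMn; congr EFin; field.
  by rewrite gt_eqF.
- by apply/measurable_EFinP; exact: measurable_funX.
- by move=> w _; rewrite lee_fin exprn_ge0.
- by rewrite lee_fin mulr_ge0 ?exprn_ge0 ?powR_ge0 ?ltW.
Qed.

(* [e^(- lam Z)] for [Z = Y^(-1/gamma)], hence [0] where [Y = 0]. *)
Definition exp_stable (w : W) : R :=
  if Y w == 0 then 0 else expR (- (lam / Y w `^ gamma^-1)).

Let mtail : measurable_fun setT (fun v : R => (1 < v)%R%:R : R).
Proof.
have -> : (fun v : R => (1 < v)%R%:R : R) = \1_(`]1%R, +oo[%classic).
  by apply/funext => v; rewrite indicE mem_setE in_itv /= andbT.
exact: measurable_indic.
Qed.

(** Both sides are the weighted mass of v > 1. On the line it is e^(-1/c); in the product,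
    integrating over the exponential variable first leaves its tail at lam Y^(-1/gamma), which is
    [exp_stable]. *)
Lemma mittag_leffler_laplace :
  Rintegral P setT exp_stable = expR (- (lam `^ gamma / Gamma (1 + gamma))).
Proof.
have := wmean_tail_eq _ _ _ _ _ _ c c0 exp_moments_prod exp_moments_line.
rewrite /wmean /Rintegral (fubini1 (fun v => (1 < v)%R%:R))// (integral_rho (fun x => (1 < V2 x)%R%:R)).
have -> : (\int[leb]_(x in Rpos) (((1 < V2 x)%R%:R : R) * expR (- x))%:E = (expR (- c^-1))%:E)%E.
  rewrite -integral_exp_tail_open integral_mkcond [RHS]integral_mkcond; apply: eq_integral => x _.
  rewrite /patch !mem_setE !in_itv /= !andbT /V2; have [x0|x0] := ltP 0 x; last first.
    have -> : (c^-1 < x) = false by apply/negbTE; rewrite -leNgt (le_trans x0)// invr_ge0 ltW.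
    by [].
  rewrite (gtr0_norm x0) -ltr_pdivrMl// mulr1; case: ifP => _; first by rewrite mul1r.
  by rewrite mul0r.
rewrite /c powRN invfM invrK [X in _ = expR (- X)]mulrC => <-; congr fine; apply: eq_integral => w _.
rewrite /exp_stable; have [yw|yw] := eqVneq (Y w) 0.
  by rewrite integral0_eq// => x _; rewrite /V1 /= yw mul0r mulr0 ltr10 mul0r.
have y0 : 0 < Y w by rewrite lt_neqAle eq_sym yw Y0.
have r0 : 0 < Y w `^ gamma^-1 by exact: powR_gt0.
rewrite -integral_exp_tail_open integral_mkcond [RHS]integral_mkcond; apply: eq_integral => x _.
rewrite /patch !mem_setE !in_itv /= !andbT; have [x0|x0] := ltP 0 x; last first.
  have -> : (lam / Y w `^ gamma^-1 < x) = false.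
    by apply/negbTE; rewrite -leNgt (le_trans x0)// divr_ge0// ltW.
  by [].
have -> : (1 < V1 (w, x)) = (lam / Y w `^ gamma^-1 < x).
  rewrite /V1 /= powRN mulrA ltr_pdivlMr ?powR_gt0// mul1r ltr_pdivrMr//.
  have -> : x `^ gamma * Y w = (x * Y w `^ gamma^-1) `^ gamma.
    by rewrite powRM ?(ltW x0) ?(ltW r0)// -powRrM mulVf ?gt_eqF// powRr1// ltW.
  apply/idP/idP; last by apply: gt0_ltr_powR; rewrite ?nnegrE ?mulr_ge0 ?ltW.
  by apply: contraTT; rewrite -!leNgt => h; apply: powR_le; rewrite ?mulr_ge0 ?(ltW x0) ?(ltW r0) ?(ltW gamma0).
by case: ifP => _; rewrite ?mul1r ?mul0r.
Qed.

End mittag_leffler_laplace.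

(** * Mixing limits under absolutely continuous measures *)

Section bounded_density.
Context {d : measure_display} {T : measurableType d} {R : realType}.
Implicit Types (P Q : probability T R) (f g h : T -> R) (A : set T).

Lemma prob_tail_cvg P f : measurable_fun setT f ->
  fine (P [set x | n%:R < f x]) @[n --> \oo] --> (0 : R).
Proof.
move=> mf; pose F n := [set x | n%:R < f x].
have mF n : measurable (F n).
  have -> : F n = f @^-1` `]n%:R, +oo[.
    by apply/seteqP; split => x /=; rewrite in_itv /= andbT.
  by rewrite -[X in measurable X]setTI; exact: mf.
have F0 : \bigcap_n F n = set0.
  rewrite -subset0 => x /(_ (Num.truncn (f x)).+1 I) /=; rewrite /F /=.
  by move/lt_trans/(_ (truncnS_gt _)); rewrite ltxx.
have nF : nonincreasing_seq F.
  move=> m n mn; apply/subsetPset => x; rewrite /F /=; apply: le_lt_trans.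
  by rewrite ler_nat.
have P0 : (P (F 0%N) < +oo)%E.
  by rewrite (le_lt_trans (probability_le1 _ _))// ltry.
have mI : measurable (\bigcap_n F n) by rewrite F0.
have := nonincreasing_cvg_mu P0 mF mI nF; rewrite F0 measure0.
by move/fine_cvg; exact.
Qed.

(** [E] is a set {f <= n} for the Radon-Nikodym derivative f of [Q], with [n] so large that both
    measures nearly ignore its complement. The bound is n + 1 to keep [M] positive. *)
Lemma bounded_density P Q (e : R) : Q `<< P -> 0 < e ->
  exists E h M, [/\ measurable E, fine (P (~` E)) <= e, fine (Q (~` E)) <= e &
    [/\ 0 < M, measurable_fun setT h, forall x, 0 <= h x <= M &
    forall g, measurable_fun setT g -> (forall x, 0 <= g x <= 1) ->
      mean Q (fun x => \1_E x * g x) = mean P (fun x => h x * g x)]].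
Proof.
move=> QP e0.
pose F := Radon_Nikodym_SigmaFinite.f Q P.
have F0 : forall x, (0 <= F x)%E by exact: Radon_Nikodym_SigmaFinite.f_ge0.
have Ffin : forall x, F x \is a fin_num by exact: Radon_Nikodym_SigmaFinite.f_fin_num.
have iF : P.-integrable setT F by exact: Radon_Nikodym_SigmaFinite.f_integrable.
pose f x := fine (F x).
have fF x : (f x)%:E = F x by rewrite fineK.
have mf : measurable_fun setT f.
  apply/measurable_EFinP; have /integrableP[mF _] := iF.
  by apply: eq_measurable_fun mF => x _; rewrite /= fF.
have tP := prob_tail_cvg P f mf.
have tQ := prob_tail_cvg Q f mf.
near \oo => n.
pose E := [set x | f x <= n%:R].
have Ec : ~` E = [set x | n%:R < f x].
  by apply/seteqP; split => x /=; rewrite /E /= ltNge => /negP.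
have mE : measurable E.
  have -> : E = f @^-1` `]-oo, n%:R].
    by apply/seteqP; split => x /=; rewrite in_itv /=.
  by rewrite -[X in measurable X]setTI; exact: mf.
exists E, (fun x => \1_E x * f x), (n%:R + 1); split => //.
- rewrite Ec; near: n; have /cvgrPdist_le/(_ _ e0) := tP.
  by apply: filterS => n; rewrite sub0r normrN ger0_norm// fine_ge0.
- rewrite Ec; near: n; have /cvgrPdist_le/(_ _ e0) := tQ.
  by apply: filterS => n; rewrite sub0r normrN ger0_norm// fine_ge0.
have f0 x : 0 <= f x by exact: fine_ge0.
split.
- by rewrite ltr_wpDl.
- by apply: measurable_funM => //; exact: measurable_indic.
- move=> x; rewrite indicE; case: (boolP (x \in E)).
    by rewrite inE /E /= mul1r f0 /= => /le_trans; apply; rewrite lerDl.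
  by rewrite mul0r lexx /= addr_ge0.
move=> g mg g01; rewrite /mean /Rintegral; congr fine.
have mEg : measurable_fun setT (fun x => \1_E x * g x).
  by apply: measurable_funM => //; exact: measurable_indic.
rewrite -(@Radon_Nikodym_SigmaFinite.change_of_variables _ _ _ Q P QP)//.
- by apply: eq_integral => x _; rewrite -/F -fF -EFinM; congr EFin; ring.
- by move=> x; rewrite lee_fin mulr_ge0//; have /andP[] := g01 x.
- exact/measurable_EFinP.
Unshelve. all: by end_near. Qed.

End bounded_density.

(** * From mixing on events to every absolutely continuous probability *)

Section mixing_limits.
Context {d : measure_display} {T : measurableType d} {R : realType}.
Variables (P : probability T R) (U : nat -> T -> R) (l : R).
Hypothesis mU : forall n, measurable_fun setT (U n).
Hypothesis U01 : forall n x, 0 <= U n x <= 1.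

Let bU n : bmeas (U n). Proof. exact: bmeas01. Qed.

Let bIU n A : measurable A -> bmeas (fun x => \1_A x * U n x).
Proof. by move=> mA; apply: bmeasM => //; exact: bmeas_indic. Qed.

Definition mixing_on (A : set T) :=
  measurable A /\ mean P (fun x => \1_A x * U n x) @[n --> \oo] --> fine (P A) * l.

Let mixing_onT_bound : mixing_on setT -> 0 <= l <= 1.
Proof.
move=> [_]; rewrite probability_setT /= mul1r => h.
have b n : 0 <= mean P (fun x => \1_setT x * U n x) <= 1.
  apply: mean_bounds; first exact: bIU.
  by move=> x; rewrite indicE in_setT mul1r.
by apply/andP; split; [apply: (cvgr_to_ge h)|apply: (cvgr_to_le h)]; apply: nearW => n;
  have /andP[] := b n.
Qed.

Let mean_indic_diff n A B : measurable A -> measurable B -> B `<=` A ->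
  mean P (fun x => \1_(A `\` B) x * U n x) =
  mean P (fun x => \1_A x * U n x) - mean P (fun x => \1_B x * U n x).
Proof.
move=> mA mB BA; rewrite -meanB; [|exact: bIU|exact: bIU].
congr mean; apply/funext => x; rewrite -mulrBl; congr (_ * _).
rewrite !indicE in_setD; have [xB|xB] := boolP (x \in B); last by rewrite andbT subr0.
have -> : x \in A by move: xB; rewrite !inE; exact: BA.
by rewrite subrr.
Qed.

Let prob_diff A B : measurable A -> measurable B -> B `<=` A ->
  fine (P (A `\` B)) = fine (P A) - fine (P B).
Proof.
move=> mA mB BA; rewrite -!mean_indic//; last exact: measurableD.
rewrite -meanB; [|exact: bmeas_indic|exact: bmeas_indic].
congr mean; apply/funext => x.
rewrite !indicE in_setD; have [xB|xB] := boolP (x \in B); last by rewrite andbT subr0.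
have -> : x \in A by move: xB; rewrite !inE; exact: BA.
by rewrite subrr.
Qed.

(** Proper differences pass by linearity. For increasing unions, the part not yet exhausted costs at
    most its probability, uniformly in [n], because [U n <= 1]. *)
Lemma mixing_on_lambda : mixing_on setT -> lambda_system setT mixing_on.
Proof.
move=> hT; have /andP[l0 l1] := mixing_onT_bound hT.
split => //.
  move=> A B BA [mA hA] [mB hB]; split; first exact: measurableD.
  rewrite prob_diff// mulrBl; under eq_fun do rewrite mean_indic_diff//.
  exact: cvgB.
move=> F ndF hF.
have mF i : measurable (F i) by case: (hF i).
have mFU : measurable (\bigcup_i F i) by exact: bigcup_measurable.
split => //.
have cF : fine (P (F i)) @[i --> \oo] --> fine (P (\bigcup_i F i)).
  have C := nondecreasing_cvg_mu mF mFU ndF (mu := P).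
  by apply: fine_cvg; rewrite fineK ?fin_num_measure//; exact: C.
apply/cvgrPdist_le => e e0.
have e30 : 0 < e / 3 by rewrite divr_gt0.
near \oo => i.
have d1 : fine (P (\bigcup_i F i `\` F i)) <= e / 3.
  rewrite prob_diff//; last by move=> x Fx; exists i.
  rewrite (le_trans (ler_norm _))//; near: i.
  by have /cvgrPdist_le/(_ _ e30) := cF.
have [_ hi] := hF i.
near=> n.
have d2 : `|fine (P (F i)) * l - mean P (fun x => \1_(F i) x * U n x)| <= e / 3.
  by near: n; have /cvgrPdist_le/(_ _ e30) := hi.
have sub : F i `<=` \bigcup_i F i by move=> x Fx; exists i.
have := mean_indic_diff n _ _ mFU (mF i) sub.
have := prob_diff _ _ mFU (mF i) sub.
have : 0 <= mean P (fun x => \1_(\bigcup_i F i `\` F i) x * U n x) <= fine (P (\bigcup_i F i `\` F i)).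
  apply/andP; split.
    apply: mean_ge0 => x; rewrite mulr_ge0 ?indicE//.
    by have /andP[] := U01 n x.
  rewrite -mean_indic; last exact: measurableD.
  apply: mean_le; [apply: bIU; exact: measurableD|apply: bmeas_indic; exact: measurableD|].
  by move=> x; have /andP[_ u1] := U01 n x; rewrite ler_piMr// indicE.
move: d1 d2.
move: (mean _ _) (mean _ _) (mean _ _) (fine _) (fine _) (fine _) => a b c p q r.
rewrite !ler_norml => p3 /andP[q1 q2] /andP[a0 ap] pq ab.
have r0 := le_trans a0 ap.
have rl0 : 0 <= r * l by rewrite mulr_ge0.
have rl1 : r * l <= r by rewrite ler_piMr.
have e1 : r * l = p * l - q * l by rewrite pq mulrBl.
by apply/andP; split; lra.
Unshelve. all: by end_near. Qed.

Lemma mixing_on_sigma (G : set (set T)) : setI_closed G -> G setT -> G `<=` mixing_on ->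
  (forall A, measurable A -> exists2 B, <<s G >> B & P.-negligible (A `+` B)) ->
  forall A, measurable A -> mixing_on A.
Proof.
move=> GI GT GH gen A mA; split => //.
have sG : <<s G >> `<=` mixing_on.
  by apply: lambda_system_subset => //; exact: mixing_on_lambda (GH _ GT).
have [B GB AB] := gen A mA; have [mB hB] := sG B GB.
rewrite (negligible_eq P A B mA mB AB).
suff e n : mean P (fun x => \1_A x * U n x) = mean P (fun x => \1_B x * U n x).
  by under eq_fun do rewrite e.
apply/eqP; rewrite -subr_eq0 -meanB; [|exact: bIU|exact: bIU].
rewrite -normr_le0; apply: (le_trans (le_norm_mean _ _ _)).
  by apply: bmeasB; exact: bIU.
have mAB : measurable (A `+` B) by apply: measurableU; exact: measurableD.
apply: (@le_trans _ _ (mean P \1_(A `+` B))); last first.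
  rewrite mean_indic// (_ : P (A `+` B) = 0%E)//.
  by exact: measure_negligible.
apply: mean_le; [|exact: bmeas_indic|].
  have [m1 [M hM]] := bmeasB _ _ (bIU n _ mA) (bIU n _ mB).
  split; first exact: measurableT_comp.
  by exists M => x; rewrite normr_id.
move=> x; have /andP[u0 u1] := U01 n x.
rewrite -mulrBl normrM (ger0_norm u0) (le_trans (ler_piMr _ u1))//.
rewrite !indicE in_setU !in_setD.
by case: (x \in A); case: (x \in B); rewrite /= ?subrr ?normr0 ?subr0 ?sub0r ?normrN ?normr1.
Qed.

Lemma mixing_mean : (forall A, measurable A -> mixing_on A) ->
  forall Q : probability T R, Q `<< P -> mean Q (U n) @[n --> \oo] --> l.
Proof.
move=> hA Q QP; have /andP[l0 l1] := mixing_onT_bound (hA _ measurableT).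
have bnd (h : T -> R) (M : R) : 0 < M -> measurable_fun setT h -> (forall x, 0 <= h x <= M) ->
    mean P (fun x => h x * U n x) @[n --> \oo] --> mean P h * l.
  move=> M0 mh hM; apply/cvgrPdist_le => e e0.
  pose f x := h x / M.
  have mf : measurable_fun setT f by apply: measurable_funM.
  have f01 x : 0 <= f x <= 1.
    by have /andP[h0 h1] := hM x; rewrite divr_ge0 ?(ltW M0)//= ler_pdivrMr// mul1r.
  have bf : bmeas f by exact: bmeas01.
  have hf : h = (fun x => M * f x) by apply/funext => x; rewrite mulrC divfK// gt_eqF.
  near \oo => N.
  have N0 : (0 < N)%N by near: N; exact: nbhs_infty_gt.
  have NM : M * N%:R^-1 <= e / 3.
    near: N; have : M * n%:R^-1 @[n --> \oo] --> (0 : R).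
      by rewrite -[X in _ --> X](mulr0 M); apply: cvgMr; exact: cvg_natinv.
    move/cvgrPdist_le/(_ (e / 3)); rewrite divr_gt0// => /(_ isT); apply: filterS => n.
    by rewrite sub0r normrN; apply: le_trans; exact: ler_norm.
  have gb := grid_bounds N f N0 f01.
  have bg := bmeas_grid N f mf.
  have cg : mean P (fun x => grid N f x * U n x) @[n --> \oo] --> mean P (grid N f) * l.
    have -> : (fun n => mean P (fun x => grid N f x * U n x)) =
      (fun n => N%:R^-1 * \sum_(0 <= i < N) mean P (fun x => \1_[set y | i.+1%:R / N%:R <= f y] x * U n x)).
      apply/funext => n; rewrite -mean_sum; last first.
        by move=> i; apply: bIU; exact: measurable_ge_set.
      rewrite -meanZ; last by apply: bmeas_sum => i; apply: bIU; exact: measurable_ge_set.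
      by congr mean; apply/funext => x; rewrite /grid -mulrA mulr_suml.
    rewrite mean_grid// -mulrA mulr_suml; apply: cvgMr; apply: cvg_sumr => i.
    by have [] := hA _ (measurable_ge_set f (i.+1%:R / N%:R) mf).
  have e3M : 0 < e / 3 / M by rewrite !divr_gt0.
  near=> n.
  have c1 : `|mean P (grid N f) * l - mean P (fun x => grid N f x * U n x)| <= e / 3 / M.
    by near: n; have /cvgrPdist_le/(_ _ e3M) := cg.
  have b1 : 0 <= mean P (fun x => f x - grid N f x) <= N%:R^-1.
    apply: mean_bounds; first exact: bmeasB.
    by move=> x; have /andP[g0 g1] := gb x; rewrite subr_ge0 g0 lerBlDl.
  have b2 : 0 <= mean P (fun x => (f x - grid N f x) * U n x) <= N%:R^-1.
    apply: mean_bounds; first by apply: bmeasM => //; exact: bmeasB.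
    move=> x; have /andP[g0 g1] := gb x; have /andP[u0 u1] := U01 n x.
    have g2 : 0 <= f x - grid N f x by rewrite subr_ge0.
    by rewrite mulr_ge0//= (le_trans (ler_piMr _ u1))// lerBlDl.
  have e1 : mean P (fun x => (f x - grid N f x) * U n x) =
      mean P (fun x => f x * U n x) - mean P (fun x => grid N f x * U n x).
    rewrite -meanB; [|exact: bmeasM|exact: bmeasM].
    by congr mean; apply/funext => x; rewrite mulrBl.
  rewrite hf meanZ//.
  have -> : (fun x => M * f x * U n x) = (fun x => M * (f x * U n x)).
    by apply/funext => x; rewrite mulrA.
  rewrite meanZ; last exact: bmeasM.
  rewrite -mulrA -mulrBr normrM (gtr0_norm M0) mulrC -ler_pdivlMr//.
  have NM' : N%:R^-1 <= e / 3 / M by rewrite ler_pdivlMr// mulrC.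
  have -> : e / M = e / 3 / M + e / 3 / M + e / 3 / M by field; rewrite gt_eqF.
  move: b1 b2 c1 NM'; rewrite e1 meanB//.
  move: (e / 3 / M) (mean _ _) (mean _ _) (mean _ _) (mean _ _) (N%:R^-1) => e' a b p q w.
  rewrite !ler_norml => /andP[a0 a1] /andP[b0 b1] /andP[c0 c1] wm.
  have k1 : (q - p) * l <= q - p by rewrite ler_piMr.
  have k0 : 0 <= (q - p) * l by rewrite mulr_ge0.
  move: k0 k1; rewrite mulrBl => k0 k1.
  by apply/andP; split; lra.
apply/cvgrPdist_le => e e0.
have e40 : 0 < e / 4 by rewrite divr_gt0.
have [E [h [M [mE _ QE [M0 mh hM Eh]]]]] := bounded_density P Q (e / 4) QP e40.
have bh : bmeas h.
  split => //; exists M => x; have /andP[h0 h1] := hM x; by rewrite ger0_norm.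
have Ph : mean P h = fine (Q E).
  have := Eh (cst 1) (measurable_cst _) (fun x => etrans (congr1 (fun b => b && _) ler01) (lexx _)).
  have -> : (fun x => \1_E x * cst 1 x) = \1_E :> (T -> R) by apply/funext => x; rewrite mulr1.
  have -> : (fun x => h x * cst 1 x) = h by apply/funext => x; rewrite mulr1.
  by rewrite mean_indic.
have QE1 : fine (Q E) = 1 - fine (Q (~` E)).
  by rewrite probability_setC// fineB ?fin_num_measure//= opprB addrC subrK.
have q0 : 0 <= fine (Q (~` E)) by exact: fine_ge0.
near=> n.
have c1 : `|mean P h * l - mean P (fun x => h x * U n x)| <= e / 4.
  by near: n; have /cvgrPdist_le/(_ _ e40) := bnd h M M0 mh hM.
move: c1; rewrite -(Eh _ (mU n) (U01 n)) Ph QE1.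
have mEc : measurable (~` E) by exact: measurableC.
have s : mean Q (U n) = mean Q (fun x => \1_E x * U n x) + mean Q (fun x => \1_(~` E) x * U n x).
  rewrite -meanD; [|exact: bIU|exact: bIU].
  congr mean; apply/funext => x; rewrite -mulrDl !indicE in_setC.
  by case: (x \in E); rewrite /= ?addr0 ?add0r mul1r.
have : 0 <= mean Q (fun x => \1_(~` E) x * U n x) <= fine (Q (~` E)).
  apply/andP; split.
    by apply: mean_ge0 => x; rewrite mulr_ge0 ?indicE//; have /andP[] := U01 n x.
  rewrite -mean_indic//; apply: mean_le; [exact: bIU|exact: bmeas_indic|].
  by move=> x; have /andP[_ u1] := U01 n x; rewrite ler_piMr// indicE.
rewrite s; move: QE q0.
move: (mean _ _) (mean _ _) (fine _) => a b q q1 q0 /andP[b0 bq].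
rewrite !ler_norml => /andP[c0 c1].
have k1 : q * l <= q by rewrite ler_piMr.
have k0 : 0 <= q * l by rewrite mulr_ge0.
move: c0 c1; rewrite mulrBl mul1r => c0 c1.
by apply/andP; split; lra.
Unshelve. all: by end_near. Qed.

End mixing_limits.

(** * Asymptotic independence of the ergodic sums from a fixed event *)

Section strong_laplace.
Context {d : measure_display} {T : measurableType d} {R : realType}.
Variables (P mu : probability T R) (S : T -> T) (alpha : set (set T)) (phi : T -> nat).
Hypothesis hsys : probability_preserving_fibred_system P S alpha.
Hypothesis hmu : equivalent_measures mu P.
Hypothesis hmix : theta_mixing P mu S alpha.
Hypothesis hphi : partition_measurable alpha phi.

Local Notation es := (ergodic_sum S phi).
Local Notation lap := (lap P S phi).
Local Notation expes := (expes S phi).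
Local Notation theta n := (fine (theta_coef P mu S alpha n)).

(* Both sides compare to [phi_(n+j) = phi_n + phi_j o S^n = phi_j + phi_n o S^j]. *)
Lemma expes_shift_le (y : R) n j x : 0 <= y ->
  `|expes y n x - expes y n (iter j S x)| <= (1 - expes y j (iter n S x)) + (1 - expes y j x).
Proof.
move=> y0; have h1 := expesD S phi y n j x; have h2 := expesD S phi y j n x.
have e : expes y n x * expes y j (iter n S x) = expes y j x * expes y n (iter j S x).
  by rewrite -h1 -h2 addnC.
have /andP[a0 a1] := expes01 S phi y n x y0.
have /andP[b0 b1] := expes01 S phi y n (iter j S x) y0.
have /andP[c0 c1] := expes01 S phi y j x y0.
have /andP[d0 d1] := expes01 S phi y j (iter n S x) y0.
move: e a0 a1 b0 b1 c0 c1 d0 d1.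
move: (expes y n x) (expes y j (iter n S x)) (expes y j x) (expes y n (iter j S x)) => a w c b.
move=> e a0 a1 b0 b1 c0 c1 d0 d1.
rewrite ler_norml; apply/andP; split.
  have : b * (1 - c) <= 1 - c by rewrite ler_piMl// subr_ge0.
  have : a * w <= a by rewrite ler_piMr.
  by move: e; lra.
have : a * (1 - w) <= 1 - w by rewrite ler_piMl// subr_ge0.
have : c * b <= b by rewrite ler_piMl.
by move: e; lra.
Qed.

Let mS n : measurable_fun setT (iter n S). Proof. exact: (fibred_miter P S alpha hsys). Qed.

Let bex (y : R) k : 0 <= y -> bmeas (expes y k). Proof. exact: (bmeas_expes P S alpha hsys phi hphi). Qed.

Lemma mean_expes_shift (f : T -> R) (y : R) n j : measurable_fun setT f ->
  (forall x, 0 <= f x <= 1) -> 0 <= y ->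
  `|mean P (fun x => f x * expes y n x) - mean P (fun x => f x * expes y n (iter j S x))|
    <= 2 * (1 - lap y j).
Proof.
move=> mf f01 y0; have bf := bmeas01 f mf f01.
have bs k i : bmeas (fun x => expes y k (iter i S x)).
  by apply: (bmeas_comp (expes y k) (iter i S)) => //; exact: bex.
have b1 : bmeas (fun x => 1 - expes y j (iter n S x)) by apply: bmeasB => //; exact: bmeas_cst.
have b2 : bmeas (fun x => 1 - expes y j x) by apply: bmeasB; [exact: bmeas_cst|exact: bex].
rewrite -meanB; [|apply: bmeasM => //; exact: bex|exact: bmeasM].
have bd : bmeas (fun x => f x * expes y n x - f x * expes y n (iter j S x)).
  by apply: bmeasB; apply: bmeasM => //; exact: bex.
apply: (le_trans (le_norm_mean _ _ bd)).
have -> : 2 * (1 - lap y j) = mean P (fun x => (1 - expes y j (iter n S x)) + (1 - expes y j x)).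
  rewrite meanD// (meanB _ _ _ (bmeas_cst 1) (bs j n)) (meanB _ _ _ (bmeas_cst 1) (bex y j y0)).
  by rewrite mean_cst (mean_iter P S alpha hsys n (expes y j)) ?/lap; [ring|exact: bex].
apply: mean_le.
- have [m1 [M hM]] := bd; split; first exact: measurableT_comp.
  by exists M => x; rewrite normr_id.
- exact: bmeasD.
move=> x; have /andP[f0 f1] := f01 x.
rewrite -mulrBr normrM (ger0_norm f0).
apply: (le_trans _ (expes_shift_le y n j x y0)).
by rewrite ler_piMl.
Qed.

(** Shifting the ergodic sum by the fixed time [h + k] is free in the limit, since
    [lap (y n) (h + k)] tends to 1. After the shift, mixing over the gap [h] separates it from [A];
    [h] is chosen before [n]. *)
Let mixing_coord (y : nat -> R) (l : R) k A : (forall n, 0 < y n) ->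
  y n @[n --> \oo] --> +oo -> lap (y n) n @[n --> \oo] --> l -> (0 < k)%N ->
  coord_sigma S alpha k A -> mixing_on P (fun n => expes (y n) n) l A.
Proof.
move=> y0 yoo ll k0 cA; have mA := coord_sigma_measurable P S alpha hsys k A cA.
split => //; apply/cvgrPdist_le => e e0.
have e40 : 0 < e / 4 by rewrite divr_gt0.
have [thf tht] : (\forall n \near \oo, theta_coef P mu S alpha n \is a fin_num) /\
    theta n @[n --> \oo] --> (0 : R).
  by have /fine_cvgP := hmix.
near \oo => h.
have hf : theta_coef P mu S alpha h \is a fin_num by near: h.
have he : theta h <= e / 4.
  near: h; have /cvgrPdist_le/(_ _ e40) := tht; apply: filterS => n.
  by rewrite sub0r normrN; apply: le_trans; exact: ler_norm.
have l1 := lap_cvg1 P S alpha hsys phi hphi (h + k) y yoo.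
have e80 : 0 < e / 8 by rewrite divr_gt0.
near=> n.
have t1 : 1 - lap (y n) (h + k) <= e / 8.
  rewrite (le_trans (ler_norm _))//; near: n.
  by have /cvgrPdist_le/(_ _ e80) := l1.
have t2 : `|l - lap (y n) n| <= e / 4.
  by near: n; have /cvgrPdist_le/(_ _ e40) := ll.
have y0n := ltW (y0 n).
have A01 x : 0 <= (\1_A x : R) <= 1 by rewrite indicE; case: (_ \in _); rewrite ?lexx ?ler01.
have mI : measurable_fun setT (\1_A : T -> R) by exact: measurable_indic.
have s1 := mean_expes_shift (\1_A) (y n) n (h + k) mI A01 y0n.
have s2 : `|mean P (fun x => \1_A x * expes (y n) n (iter (h + k) S x)) -
    fine (P A) * lap (y n) n| <= theta h.
  have cI c : coord_sigma S alpha k [set x | c <= (\1_A x : R)].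
    have [c0|c0] := leP c 0.
      have -> : [set x | c <= (\1_A x : R)] = setT; last exact: sa_setT (coord_sigma_sa S alpha k).
      by apply/seteqP; split => // x _ /=; rewrite (le_trans c0)// indicE.
    have [c1|c1] := leP c 1.
      have -> : [set x | c <= (\1_A x : R)] = A => //.
      apply/seteqP; split => x /=; rewrite indicE.
        by case: (boolP (x \in A)) => [|_]; rewrite ?inE// leNgt c0.
      by move=> Ax; rewrite mem_set.
    have -> : [set x | c <= (\1_A x : R)] = ~` setT.
      rewrite setCT; apply/seteqP; split => x //=.
      by apply/negP; rewrite -ltNge indicE (le_lt_trans _ c1)//; case: (_ \in _).
    exact: sa_setC (coord_sigma_sa S alpha k) _ (sa_setT _ (coord_sigma_sa S alpha k)).
  have [mex _] := bex (y n) n y0n.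
  have e01 x := expes01 S phi (y n) n x y0n.
  have := theta_mixing_means P mu S alpha hsys hmu h k (\1_A) (expes (y n) n) k0 hf cI A01 mex e01.
  rewrite mean_indic// => /le_trans; apply.
  have /andP[m0 m1] : 0 <= mean mu (expes (y n) n) <= 1.
    by apply: mean_bounds => //; exact: bex.
  by rewrite ler_piMr// fine_ge0// (theta_coef_ge0 P mu S alpha).
have pA0 : 0 <= fine (P A) by exact: fine_ge0.
have pA1 : fine (P A) <= 1 by exact: prob_fine_le1.
have t3 : `|fine (P A) * l - fine (P A) * lap (y n) n| <= e / 4.
  by rewrite -mulrBr normrM (ger0_norm pA0) (le_trans (ler_piMl _ pA1)).
move: s1 s2 t3 t1 he.
move: (mean _ _) (mean _ _) (fine (P A) * l) (fine (P A) * _) (lap _ _) (theta h) => a b p q w t.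
rewrite !ler_norml => /andP[a0 a1] /andP[b0 b1] /andP[c0 c1] d1 d2.
by apply/andP; split; lra.
Unshelve. all: by end_near. Qed.

Lemma lap_strong (y : nat -> R) (l : R) (Q : probability T R) : Q `<< P ->
  y n @[n --> \oo] --> +oo -> lap (y n) n @[n --> \oo] --> l ->
  mean Q (expes (y n) n) @[n --> \oo] --> l.
Proof.
move=> QP yoo ll; pose z n := Num.max 1 (y n).
have yz : \forall n \near \oo, z n = y n.
  by apply: filterS (cvgy_ge _ yoo 1) => n y1; rewrite /z; apply/max_idPr.
have z0 n : 0 < z n by rewrite lt_max ltr01.
have zoo : z n @[n --> \oo] --> +oo.
  by apply: cvg_trans yoo; apply: near_eq_cvg; apply: filterS yz => n ->.
have lz : lap (z n) n @[n --> \oo] --> l.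
  by apply: cvg_trans ll; apply: near_eq_cvg; apply: filterS yz => n ->.
have : mean Q (expes (z n) n) @[n --> \oo] --> l; last first.
  by apply: cvg_trans; apply: near_eq_cvg; apply: filterS yz => n ->.
have me n : measurable_fun setT (expes (z n) n) by case: (bex (z n) n (ltW (z0 n))).
have e01 n x : 0 <= expes (z n) n x <= 1 by apply: expes01; exact: ltW.
apply: (mixing_mean P (fun n => expes (z n) n) l me e01) => // A mA.
(* The events read off finitely many coordinates form a pi-system; the generator property supplies
   every other event mod [P]. *)
pose G := [set A | exists2 k, (0 < k)%N & coord_sigma S alpha k A].
apply: (mixing_on_sigma P (fun n => expes (z n) n) l me e01 G) => //.
- move=> B C [k k0 hB] [j j0 hC]; exists (maxn k j); first by rewrite leq_max k0.
  apply: (sa_setI _ (coord_sigma_sa S alpha (maxn k j))).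
    by apply: coord_sigma_le hB; exact: leq_maxl.
  by apply: coord_sigma_le hC; exact: leq_maxr.
- by exists 1%N => //; apply: sa_setT; exact: coord_sigma_sa.
- by move=> B [k k0 hB]; exact: mixing_coord hB.
move=> B mB; have [hf _] := hsys.
have [C hC BC] := fibred_generator hf mB.
have sub : [set iter n S @^-1` a | n in [set: nat] & a in alpha] `<=` G.
  move=> _ [n _ [a aa <-]]; exists n.+1 => //; apply: sub_sigma_algebra.
  by exists n, a.
have hC' : <<s G >> C by apply: (smallest_sub _ _ hC); [exact: smallest_sigma_algebra|move=> D /sub; exact: sub_sigma_algebra].
exists C => //.
have mC : measurable C.
  apply: (smallest_sub (sigma_algebra_measurable _) _ hC') => D [k _]; exact: (coord_sigma_measurable P S alpha hsys).
by exists (B `+` C); split => //; apply: measurableU; exact: measurableD.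
Qed.

End strong_laplace.

(** * Stable limits *)

Section laplace_chart.
Context {R : realType}.
Variable g : \bar R -> R.
Hypothesis cg : {within [set x | (0 <= x)%E], continuous g}.

(* [u = e^-t] identifies [0, +oo] with [0, 1]. *)
Definition exp_chart (u : R) : R := if u <= 0 then g +oo%E else g (- ln u)%:E.

Lemma exp_chart_expR (t : R) : exp_chart (expR (- t)) = g t%:E.
Proof. by rewrite /exp_chart leNgt expR_gt0 /= expRK opprK. Qed.

Let cvg_comp_within (F : set_system R) (y : \bar R) (h : R -> \bar R) : Filter F ->
  (0 <= y)%E -> h x @[x --> F] --> y -> (\forall x \near F, 0 <= h x)%E ->
  g (h x) @[x --> F] --> g y.
Proof.
move=> FF y0 hy h0 A nA; have := (@subspace_continuousP _ _ _ _).1 cg y y0 A nA.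
rewrite /nbhs /= /within /= => /hy; rewrite /nbhs /= => hA.
by apply: filterS2 h0 hA => x hx; apply.
Qed.

Let cvg_ln (x : R) : 0 < x -> (- ln u)%:E @[u --> x] --> (- ln x)%:E.
Proof.
move=> x0; apply: cvg_EFin; first exact: nearW.
by apply: cvgN; exact: continuous_ln.
Qed.

Let ln_ge0 (x : R) : 0 < x -> x <= 1 -> (0 <= (- ln x)%:E)%E.
Proof. by move=> x0 x1; rewrite lee_fin oppr_ge0 ln_le0. Qed.

(** The endpoint 0 is where the continuity of [g] at +oo enters. *)
Lemma exp_chart_continuous : {within `[0, 1], continuous exp_chart}.
Proof.
apply/(continuous_within_itvP _ ltr01); split.
- move=> x; rewrite in_itv /= => /andP[x0 x1].
  rewrite /continuous_at {2}/exp_chart leNgt x0 /=.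
  have nx : \forall u \near x, 0 < u < 1.
    by near=> u; apply/andP; split; near: u; [exact: lt_nbhsr|exact: lt_nbhsl].
  have : g (- ln u)%:E @[u --> x] --> g (- ln x)%:E.
    apply: cvg_comp_within; [exact: ln_ge0 (ltW _)|exact: cvg_ln|].
    by apply: filterS nx => u /andP[u0 u1]; apply: ln_ge0 => //; exact: ltW.
  apply: cvg_trans; apply: near_eq_cvg; apply: filterS nx => u /andP[u0 u1].
  by rewrite /exp_chart leNgt u0.
- rewrite {2}/exp_chart lexx.
  have nx : \forall u \near (0 : R)^'+, 0 < u < 1.
    by near=> u; apply/andP; split; near: u; [exact: nbhs_right_gt|exact: nbhs_right_lt].
  have : g (- ln u)%:E @[u --> (0 : R)^'+] --> g +oo%E.
    apply: cvg_comp_within => //.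
      apply/cvgeyPge => M; near=> u.
      have u0 : 0 < u by near: u; exact: nbhs_right_gt.
      have uM : u < expR (- M) by near: u; apply: nbhs_right_lt; exact: expR_gt0.
      by rewrite lee_fin lerNr -[leRHS]expRK ler_ln ?posrE ?expR_gt0// ltW.
    by apply: filterS nx => u /andP[u0 u1]; apply: ln_ge0 => //; exact: ltW.
  apply: cvg_trans; apply: near_eq_cvg; apply: filterS nx => u /andP[u0 u1].
  by rewrite /exp_chart leNgt u0.
rewrite {2}/exp_chart leNgt ltr01 /=.
have nx : \forall u \near (1 : R)^'-, 0 < u < 1.
  by near=> u; apply/andP; split; near: u; [exact: nbhs_left_gt|exact: nbhs_left_lt].
have : g (- ln u)%:E @[u --> (1 : R)^'-] --> g (- ln 1)%:E.
  apply: cvg_comp_within; [exact: ln_ge0|apply: cvg_at_left_filter; exact: cvg_ln|].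
  by apply: filterS nx => u /andP[u0 u1]; apply: ln_ge0 => //; exact: ltW.
apply: cvg_trans; apply: near_eq_cvg; apply: filterS nx => u /andP[u0 u1].
by rewrite /exp_chart leNgt u0.
Unshelve. all: by end_near. Qed.

End laplace_chart.

Section unit_interval_functionals.
Context {d : measure_display} {T : measurableType d} {R : realType}.
Variables (P : probability T R) (X : T -> R).
Hypothesis mX : measurable_fun setT X.
Hypothesis X01 : forall x, 0 <= X x <= 1.

Let bX i : bmeas (fun x => X x ^+ i).
Proof.
apply: bmeas01; first exact: measurable_funX.
by move=> x; have /andP[h0 h1] := X01 x; rewrite exprn_ge0// exprn_ile1.
Qed.

Lemma bmeas_horner (p : {poly R}) : bmeas (fun x => p.[X x]).
Proof.
have -> : (fun x => p.[X x]) = (fun x => \sum_(i < size p) p`_i * X x ^+ i).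
  by apply/funext => x; rewrite horner_coef.
by apply: bmeas_sum => i; apply: bmeasZ.
Qed.

Lemma mean_horner (p : {poly R}) :
  mean P (fun x => p.[X x]) = \sum_(i < size p) p`_i * mean P (fun x => X x ^+ i).
Proof.
have -> : (fun x => p.[X x]) = (fun x => \sum_(i < size p) p`_i * X x ^+ i).
  by apply/funext => x; rewrite horner_coef.
rewrite mean_sum; last by move=> i; apply: bmeasZ.
by apply: eq_bigr => i _; rewrite meanZ.
Qed.

Lemma bmeas_within (G : R -> R) : {within `[0, 1], continuous G} -> bmeas (fun x => G (X x)).
Proof.
move=> cG; split.
  have mG : measurable_fun (`[0, 1]%classic : set R) G by apply: subspace_continuous_measurable_fun.
  have sub : [set X x | x in setT] `<=` `[0, 1]%classic.
    by move=> _ [x _ <-]; rewrite /= in_itv /=; exact: X01.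
  exact: measurable_comp (measurable_itv _) sub mG mX.
(* Boundedness is read off from a polynomial at distance at most 1 from [G]. *)
have [p hp] := weierstrass G 1 ltr01 cG; have [_ [M hM]] := bmeas_horner p.
exists (1 + M) => x; rewrite -[G _](subrK p.[X x]) (le_trans (ler_normD _ _))//.
by rewrite lerD// hp.
Qed.

Lemma mean_within_le (G : R -> R) (p : {poly R}) e : {within `[0, 1], continuous G} ->
  (forall x, 0 <= x <= 1 -> `|G x - p.[x]| <= e) ->
  `|mean P (fun x => G (X x)) - mean P (fun x => p.[X x])| <= e.
Proof.
move=> cG hp; have bG := bmeas_within G cG; have bp := bmeas_horner p.
rewrite -meanB// ler_norml; apply: mean_bounds; first exact: bmeasB.
by move=> x; rewrite -ler_norml hp.
Qed.

End unit_interval_functionals.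

Lemma expectation_mean {d : measure_display} {T : measurableType d} {R : realType}
  (P : probability T R) (f : T -> R) : bmeas f -> ('E_P[f] = (mean P f)%:E)%E.
Proof.
move=> bf; rewrite unlock /mean /Rintegral fineK//.
by apply: integrable_fin_num => //; exact: bmeas_integrable.
Qed.

Section exp_stable.
Context {d : measure_display} {W : measurableType d} {R : realType}.
Variables (P : probability W R) (Y : {RV P >-> R}) (gamma : R).
Hypothesis gamma0 : 0 < gamma.
Hypothesis Y0 : forall w, 0 <= Y w.

Local Notation ex := (exp_stable P Y gamma).

Lemma exp_stable01 lam w : 0 <= lam -> 0 <= ex lam w <= 1.
Proof.
move=> l0; rewrite /exp_stable; case: ifP => _; first by rewrite lexx ler01.
by rewrite expR_ge0 -expR0 ler_expR oppr_le0 divr_ge0// powR_ge0.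
Qed.

Lemma measurable_exp_stable lam : measurable_fun setT (ex lam).
Proof.
pose A := Y @^-1` `]0, +oo[%classic.
have mA : measurable A by rewrite -[A]setTI; exact: measurable_funP.
have -> : ex lam = (fun w => expR (- (lam * Y w `^ (- gamma^-1))) * \1_A w).
  apply/funext => w; rewrite /exp_stable indicE /A.
  have [yw|yw] := eqVneq (Y w) 0.
    by rewrite (_ : w \in _ = false) ?mulr0//; apply/negbTE; rewrite notin_setE /= in_itv /= yw ltxx.
  have -> : w \in Y @^-1` `]0, +oo[ by rewrite inE /= in_itv /= andbT lt_neqAle eq_sym yw Y0.
  by rewrite mulr1 powRN.
apply: measurable_funM; last exact: measurable_indic.
apply: measurableT_comp => //; apply: measurable_funN; apply: measurable_funM => //.
by apply: (measurableT_comp (measurable_powR _)).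
Qed.

Lemma exp_stable_exp i w : ex 1 w ^+ i.+1 = ex i.+1%:R w.
Proof.
rewrite /exp_stable; case: ifP => _; first by rewrite expr0n.
by rewrite -expRM_natl mulrN mul1r.
Qed.

Lemma exp_chart_stable (g : \bar R -> R) w : exp_chart g (ex 1 w) = g (stable_of Y gamma w).
Proof.
have gi : gamma^-1 != 0 by rewrite invr_eq0 gt_eqF.
rewrite /stable_of inver /exp_stable; have [yw|yw] := eqVneq (Y w) 0.
  by rewrite yw powR0// eqxx /exp_chart lexx.
by rewrite exp_chart_expR powR_eq0 (negbTE yw) /= mul1r.
Qed.

End exp_stable.

Section stable_limit.
Context {d : measure_display} {T : measurableType d} {R : realType}.
Variables (P mu : probability T R) (S : T -> T) (alpha : set (set T)).
Variables (phi : T -> nat) (gamma : R) (b : nat -> R).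
Hypothesis hsys : probability_preserving_fibred_system P S alpha.
Hypothesis hmu : equivalent_measures mu P.
Hypothesis hmix : theta_mixing P mu S alpha.
Hypothesis phi_gt0 : forall x, (0 < phi x)%N.
Hypothesis hphi : partition_measurable alpha phi.
Hypothesis hgamma : 0 < gamma <= 1.
Hypothesis ha : regularly_varying (occupation P S phi) gamma.
Hypothesis hadapted : adapted (occupation P S phi) (theta_coef P mu S alpha).
Hypothesis hb : asymp_inverse (occupation P S phi) b.

(** In the chart u = e^(-t) the moment of order [i.+1] is the Laplace transform at [lam = i.+1], so
    [lap_strong] and [mittag_leffler_laplace] provide all the moments that
    [cvg_continuous_functional] needs. *)
Lemma stable_limit (d' : measure_display) (W : measurableType d')
    (P' : probability W R) (Y : {RV P' >-> R}) : mittag_leffler Y gamma ->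
  strongly_converges P (fun n x => ((ergodic_sum S phi n x)%:R / b n)%:E)
    P' (stable_of Y gamma).
Proof.
move=> hY g cg Q QP; have [Y0 _] := hY; have /andP[gamma0 _] := hgamma.
have boo := inverse_cvgy P S alpha phi b hsys phi_gt0 hphi hb.
have cG := exp_chart_continuous g cg; set G := exp_chart g in cG.
have b0 := cvgy_ge _ boo 1.
have mX n : 1 <= b n -> measurable_fun setT (expes S phi (b n) n).
  move=> bn; have [] // := bmeas_expes P S alpha hsys phi hphi (b n) n.
  exact: le_trans bn.
have X01 n x : 1 <= b n -> 0 <= expes S phi (b n) n x <= 1.
  by move=> bn; apply: expes01; exact: le_trans bn.
have mZ := measurable_exp_stable P' Y gamma Y0 1.
have Z01 w := exp_stable01 P' Y gamma 1 w ler01.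
have -> : ('E_P'[fun w => g (stable_of Y gamma w)])%E =
    (mean P' (fun w => G (exp_stable P' Y gamma 1 w)))%:E.
  rewrite -expectation_mean; last exact: bmeas_within.
  by congr expectation; apply/funext => w; rewrite /G exp_chart_stable.
have : (mean Q (fun x => G (expes S phi (b n) n x)))%:E @[n --> \oo] -->
    (mean P' (fun w => G (exp_stable P' Y gamma 1 w)))%:E; last first.
  apply: cvg_trans; apply: near_eq_cvg; apply: filterS b0 => n bn.
  rewrite -expectation_mean; last by apply: bmeas_within => //; [exact: mX|move=> x; exact: X01].
  by congr expectation; apply/funext => x; rewrite /G exp_chart_expR.
apply: cvg_EFin; first exact: nearW.
apply: (cvg_continuous_functional (fun n F => mean Q (fun x => F (expes S phi (b n) n x)))
  (fun F => mean P' (fun w => F (exp_stable P' Y gamma 1 w)))) => //.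
- apply: filterS b0 => n bn p e hp; apply: mean_within_le => //; first exact: mX.
  by move=> x; exact: X01.
- by move=> p e hp; exact: mean_within_le.
- apply: filterS b0 => n bn p; apply: mean_horner; first exact: mX.
  by move=> x; exact: X01.
- by move=> p; exact: mean_horner.
case=> [|i].
  have e1 (dd : measure_display) (V : measurableType dd) (q : probability V R) (X : V -> R) :
      mean q (fun v => X v ^+ 0) = 1 by rewrite -(mean_cst q 1).
  by rewrite e1; under eq_fun do rewrite e1; exact: cvg_cst.
have i0 : 0 < i.+1%:R :> R by rewrite ltr0n.
have -> : (fun w => exp_stable P' Y gamma 1 w ^+ i.+1) = exp_stable P' Y gamma i.+1%:R.
  by apply/funext => w; rewrite exp_stable_exp.
rewrite [mean P' _](mittag_leffler_laplace P' Y gamma i.+1%:R gamma0 i0 hY).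
have LL := laplace_limit P mu S alpha phi gamma b hsys hmu hmix phi_gt0 hphi hgamma ha hadapted hb i.+1%:R i0.
have yoo : b n / i.+1%:R @[n --> \oo] --> +oo.
  apply/cvgryPge => M; apply: filterS (cvgy_ge _ boo (M * i.+1%:R)) => n.
  by rewrite ler_pdivlMr.
have := lap_strong P mu S alpha phi hsys hmu hmix hphi (fun n => b n / i.+1%:R) _ Q QP yoo LL.
apply: cvg_trans; apply: near_eq_cvg; apply: nearW => n; congr mean; apply/funext => x.
by rewrite /expes -expRM_natl mulrN invfM invrK; congr (expR (- _)); ring.
Qed.

End stable_limit.

(** * Deviations below the mean *)

Section maximal_inequality.
Context {d : measure_display} {T : measurableType d} {R : realType}.
Variables (P : probability T R) (S : T -> T) (B : set T) (eta : R).
Hypothesis mS : measurable_fun setT S.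
Hypothesis SP : forall A, measurable A -> P (S @^-1` A) = P A.
Hypothesis mB : measurable B.
Hypothesis eta0 : 0 < eta.

(* The running maximum over [0 <= n <= N] of the partial sums of [1_B - eta] *)
Fixpoint excess (N : nat) (x : T) : R :=
  if N is N'.+1 then Num.max 0 (\1_B x - eta + excess N' (S x)) else 0.

(** The points whose every initial orbit segment spends at most a proportion [eta] of its time in
    [B]. *)
Definition rarely_in : set T := [set x | forall N, excess N x <= 0].

Let excess_ge0 N x : 0 <= excess N x.
Proof. by case: N => [|N] //=; rewrite le_max lexx. Qed.

Let excess_nd N x : excess N x <= excess N.+1 x.
Proof.
elim: N x => [|N IH] x /=; first by rewrite le_max lexx.
by rewrite ge_max !le_max lexx /=; rewrite lerD2l IH orbT.
Qed.

Let bmeas_excess N : bmeas (excess N).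
Proof.
elim: N => [|N IH]; first exact: bmeas_cst.
have [mf [M hM]] : bmeas (fun x => \1_B x - eta + excess N (S x)).
  apply: bmeasD; last exact: bmeas_comp.
  by apply: bmeasB; [exact: bmeas_indic|exact: bmeas_cst].
split; first by apply: measurable_maxr.
exists M => x /=; rewrite ger0_norm ?le_max ?lexx// ge_max (le_trans _ (hM x))//=.
by rewrite (le_trans _ (hM x))// ler_norm.
Qed.

Lemma visits_excess n x : \sum_(k < n) \1_B (iter k S x) - eta * n%:R <= excess n x.
Proof.
elim: n x => [|n IH] x; first by rewrite big_ord0 mulr0 subrr.
rewrite big_ord_recl /= le_max; apply/orP; right.
have := IH (S x).
have -> : \sum_(k < n) \1_B (iter k S (S x)) = \sum_(i < n) \1_B (S (iter i S x)) :> R.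
  by apply: eq_bigr => i _; rewrite -iterSr.
by rewrite -natr1 mulrDr mulr1; lra.
Qed.

Lemma visits_rarely n x : rarely_in x -> \sum_(k < n) \1_B (iter k S x) <= eta * n%:R.
Proof. by move=> /(_ n); have := visits_excess n x; lra. Qed.

Lemma measurable_rarely : measurable rarely_in.
Proof.
have -> : rarely_in = \bigcap_N [set x | excess N x <= 0].
  by apply/seteqP; split => x h => [N _|N]; exact: h.
apply: bigcap_measurable => // N _; have [mN _] := bmeas_excess N.
have -> : [set x | excess N x <= 0] = excess N @^-1` `]-oo, 0].
  by apply/seteqP; split => x /=; rewrite in_itv /=.
by rewrite -[X in measurable X]setTI; exact: mN.
Qed.

(* Garsia: [excess N - excess N o S <= 1_{excess N > 0} (1_B - eta)], and the
   left-hand side has mean zero. *)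
Lemma maximal_inequality : fine (P (~` rarely_in)) <= fine (P B) / eta.
Proof.
pose A N := [set x | 0 < excess N x].
have mA N : measurable (A N).
  have [mN _] := bmeas_excess N.
  have -> : A N = excess N @^-1` `]0, +oo[.
    by apply/seteqP; split => x /=; rewrite in_itv /= andbT.
  by rewrite -[X in measurable X]setTI; exact: mN.
have step N : fine (P (A N)) <= fine (P B) / eta.
  have bI C : measurable C -> bmeas (\1_C : T -> R) by exact: bmeas_indic.
  rewrite ler_pdivlMr// -!mean_indic// mulrC -meanZ; last exact: bI.
  have : mean P (fun x => excess N x - excess N (S x)) = 0.
    rewrite meanB//; last exact: bmeas_comp.
    by have := mean_comp P S (excess N) mS SP (bmeas_excess N); rewrite /comp => ->; rewrite subrr.
  have : mean P (fun x => excess N x - excess N (S x)) <= mean P (fun x => \1_B x - eta * \1_(A N) x).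
    apply: mean_le.
    - by apply: bmeasB => //; exact: bmeas_comp.
    - by apply: bmeasB; [exact: bI|apply: bmeasZ; exact: bI].
    move=> x; rewrite !indicE; case: (boolP (x \in A N)) => hx; last first.
      have e0 : excess N x = 0.
        apply/eqP; rewrite eq_le excess_ge0 andbT leNgt; apply/negP => h.
        by move: hx; rewrite notin_setE; apply.
      by rewrite e0 mulr0 sub0r subr0 (@le_trans _ _ 0)// oppr_le0.
    move: hx; rewrite inE /A /= => hx.
    case: N hx => [|N] /=; first by rewrite ltxx.
    rewrite lt_max ltxx /= => hx; rewrite (max_idPr (ltW hx)) mulr1 indicE.
    have := excess_nd N (S x) => /=; rewrite indicE; lra.
  rewrite (meanB _ _ _ (bI B mB) (bmeasZ eta _ (bI _ (mA N)))).
  by move=> h1 h2; move: h1; rewrite h2 subr_ge0.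
have -> : ~` rarely_in = \bigcup_N A N.
  apply/seteqP; split => x.
    by move/existsNP => [N /negP]; rewrite -ltNge => h; exists N.
  by move=> [N _ h] /(_ N); rewrite leNgt h.
have nd : nondecreasing_seq A.
  apply/nondecreasing_seqP => N; apply/subsetPset => x; rewrite /A /= => h.
  exact: lt_le_trans h (excess_nd N x).
have mU : measurable (\bigcup_N A N) by exact: bigcup_measurable.
have C := nondecreasing_cvg_mu mA mU nd (mu := P).
have C' : fine (P (A N)) @[N --> \oo] --> fine (P (\bigcup_N A N)).
  by apply: fine_cvg; rewrite fineK ?fin_num_measure//; exact: C.
by apply: (cvgr_to_le C'); exact: nearW.
Qed.

End maximal_inequality.

(** * Chernoff bound over separated blocks *)

Section block_products.
Context {d : measure_display} {T : measurableType d} {R : realType}.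
Variables (P mu : probability T R) (S : T -> T) (alpha : set (set T)) (phi : T -> nat).
Hypothesis hsys : probability_preserving_fibred_system P S alpha.
Hypothesis hmu : equivalent_measures mu P.
Hypothesis hphi : partition_measurable alpha phi.

Local Notation es := (ergodic_sum S phi).
Local Notation lap := (lap P S phi).
Local Notation expes := (expes S phi).

(** [mean mu g] is kept in the error and not replaced by a constant: once compared with [mean P g],
    it lets the error be absorbed into a factor per block. *)
Lemma theta_mixing_bounded n k (f g : T -> R) (C : R) : (1 <= k)%N ->
  theta_coef P mu S alpha n \is a fin_num ->
  (forall c, coord_sigma S alpha k [set x | c <= f x]) -> (forall x, 0 <= f x <= 1) ->
  measurable_fun setT f -> measurable_fun setT g -> 0 < C -> (forall x, 0 <= g x <= C) ->
  mean P (fun x => f x * g (iter (n + k) S x)) <=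
    mean P f * mean P g + fine (theta_coef P mu S alpha n) * mean mu g.
Proof.
move=> k1 tf cf f01 mf mg C0 gC.
pose h x := C^-1 * g x.
have mh : measurable_fun setT h by apply: measurable_funM.
have h01 x : 0 <= h x <= 1.
  by have /andP[g0 g1] := gC x; rewrite mulr_ge0 ?invr_ge0 ?(ltW C0)//= ler_pdivrMl// mulr1.
have gh : g = (fun x => C * h x).
  by apply/funext => x; rewrite /h mulVKf// gt_eqF.
have bh := bmeas01 h mh h01.
have bf := bmeas01 f mf f01.
have bhi i : bmeas (fun x => h (iter i S x)).
  by apply: (bmeas_comp h (iter i S)) => //; exact: (fibred_miter P S alpha hsys).
have := theta_mixing_means P mu S alpha hsys hmu n k f h k1 tf cf f01 mh h01.
have [-> ->] : mean P g = C * mean P h /\ mean mu g = C * mean mu h.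
  by split; rewrite [X in mean _ X = _]gh meanZ.
have -> : (fun x => f x * g (iter (n + k) S x)) = (fun x => f x * (C * h (iter (n + k) S x))).
  by apply/funext => x; rewrite [in LHS]gh.
have -> : (fun x => f x * (C * h (iter (n + k) S x))) = (fun x => C * (f x * h (iter (n + k) S x))).
  by apply/funext => x; rewrite mulrCA.
rewrite meanZ; last exact: bmeasM.
rewrite ler_norml => /andP[_]; rewrite lerBlDl => /(ler_wpM2l (ltW C0)) /le_trans; apply.
by rewrite mulrDr !(mulrCA C).
Qed.

Variables (E : set T) (h : T -> R) (M : R).
Hypothesis mE : measurable E.
Hypothesis mh : measurable_fun setT h.
Hypothesis hM : forall x, 0 <= h x <= M.
Hypothesis M0 : 0 < M.
Hypothesis Eh : forall g : T -> R, measurable_fun setT g -> (forall x, 0 <= g x <= 1) ->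
  mean mu (fun x => \1_E x * g x) = mean P (fun x => h x * g x).

Let mean_E (g : T -> R) C : measurable_fun setT g -> 0 < C -> (forall x, 0 <= g x <= C) ->
  mean mu (fun x => \1_E x * g x) <= M * mean P g.
Proof.
move=> mg C0 gC; pose k x := C^-1 * g x.
have mk : measurable_fun setT k by apply: measurable_funM.
have k01 x : 0 <= k x <= 1.
  by have /andP[g0 g1] := gC x; rewrite mulr_ge0 ?invr_ge0 ?(ltW C0)//= ler_pdivrMl// mulr1.
have bk := bmeas01 k mk k01.
have gk : g = (fun x => C * k x) by apply/funext => x; rewrite /k mulVKf// gt_eqF.
have -> : (fun x => \1_E x * g x) = (fun x => C * (\1_E x * k x)).
  by apply/funext => x; rewrite gk mulrCA.
rewrite meanZ; last by apply: bmeasM => //; exact: bmeas_indic.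
rewrite Eh// gk meanZ// mulrCA; apply: ler_wpM2l; first exact: ltW.
rewrite -meanZ//; apply: mean_le; last first.
- by move=> x; have /andP[k0 _] := k01 x; have /andP[_ h1] := hM x; exact: ler_wpM2r.
- exact: bmeasZ.
apply: bmeasM => //; split => //; exists M => x; have /andP[h0 h1] := hM x; by rewrite ger0_norm.
Qed.

Variables (y kappa : R) (m g : nat).
Hypothesis y0 : 0 < y.
Hypothesis kappa0 : 0 < kappa.

(** The period of the blocks: a sum of [m] terms reads [m.+1] coordinates, and then comes a gap
    [g]. *)
Let D := (g + m.+1)%N.

(* The factor [kappa] pays for the blocks that start outside [E]. *)
Fixpoint block_product (r : nat) (x : T) : R :=
  if r is r'.+1 then (kappa + \1_E x * expes y m x) * block_product r' (iter D S x) else 1.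

Let mSi i : measurable_fun setT (iter i S).
Proof. exact: (fibred_miter P S alpha hsys). Qed.

Let bex k : bmeas (expes y k).
Proof. by apply: (bmeas_expes P S alpha hsys phi hphi); exact: ltW. Qed.

Let e01 k x : 0 <= expes y k x <= 1. Proof. by apply: expes01; exact: ltW. Qed.

Let K := 1 + kappa.
Let K1 : 1 <= K. Proof. by rewrite lerDl ltW. Qed.

Let block_factor x : 0 <= kappa + \1_E x * expes y m x <= K.
Proof.
have /andP[a0 a1] := e01 m x; have k0 := ltW kappa0.
by rewrite indicE /K; case: (_ \in _); rewrite ?mul1r ?mul0r; apply/andP; split; lra.
Qed.

Lemma block_product_bounds r x : 0 <= block_product r x <= K ^+ r.
Proof.
elim: r x => [|r IH] x /=; first by rewrite expr0 ler01 lexx.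
have /andP[a0 a1] := block_factor x; have /andP[b0 b1] := IH (iter D S x).
by rewrite mulr_ge0//= exprS ler_pM.
Qed.

Lemma bmeas_block_product r : bmeas (block_product r).
Proof.
elim: r => [|r IH]; first exact: bmeas_cst.
apply: bmeasM; last exact: (bmeas_comp (block_product r) (iter D S)).
apply: bmeasD; first exact: bmeas_cst.
by apply: bmeasM => //; exact: bmeas_indic.
Qed.

Variable eps0 : R.
Hypothesis htheta : forall n, (g <= n)%N ->
  theta_coef P mu S alpha n \is a fin_num /\ fine (theta_coef P mu S alpha n) <= eps0.

Let rho := lap y m + eps0 * M.

Let bQi r i : bmeas (fun x => block_product r (iter i S x)).
Proof. by apply: (bmeas_comp (block_product r) (iter i S)) => //; exact: bmeas_block_product. Qed.

Let rho0 : 0 <= rho.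
Proof.
rewrite addr_ge0 ?mulr_ge0 ?(ltW M0)//.
  by apply: mean_ge0 => x; have /andP[] := e01 m x.
have [_] := htheta g (leqnn g); apply: le_trans.
by rewrite fine_ge0// theta_coef_ge0.
Qed.

(** [i] is general because the [kappa] term of the first factor leaves the next block one period
    further away. In the other term mixing separates the two blocks, and [\1_E] converts [mu] into
    [M] times [P], so each block costs [rho]. *)
Let block_correlation r i : (0 < i)%N ->
  mean P (fun x => expes y m x * block_product r (iter (i * D) S x)) <= rho * (kappa + rho) ^+ r.
Proof.
elim: r i => [|r IH] i i0.
  rewrite expr0 mulr1 /= (_ : mean _ _ = lap y m).
    by rewrite lerDl mulr_ge0 ?(ltW M0)//; have [_] := htheta g (leqnn g); apply: le_trans;
      rewrite fine_ge0// theta_coef_ge0.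
  by congr mean; apply/funext => x; rewrite mulr1.
pose G x := expes y m x * block_product r (iter D S x).
have bG : bmeas G by apply: bmeasM.
have mG : measurable_fun setT G by case: bG.
have GK x : 0 <= G x <= K ^+ r.
  have /andP[a0 a1] := e01 m x; have /andP[b0 b1] := block_product_bounds r (iter D S x).
  by rewrite mulr_ge0//= (le_trans _ b1)// ler_piMl.
have K0 : 0 < K ^+ r by rewrite exprn_gt0// (lt_le_trans ltr01).
have bEG : bmeas (fun x => \1_E x * G x) by apply: bmeasM => //; exact: bmeas_indic.
have -> : (fun x => expes y m x * block_product r.+1 (iter (i * D) S x)) =
  (fun x => kappa * (expes y m x * block_product r (iter (i.+1 * D) S x)) +
            expes y m x * (\1_E (iter (i * D) S x) * G (iter (i * D) S x))).
  by apply/funext => x; rewrite /= /G -iterD -mulSn; ring.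
rewrite meanD; last 2 first.
- by apply: bmeasZ; apply: bmeasM.
- apply: bmeasM => //; exact: (bmeas_comp (fun x => \1_E x * G x) (iter (i * D) S)).
rewrite meanZ; last exact: bmeasM.
pose n := (i * D - m.+1)%N.
have iDn : (i * D = n + m.+1)%N.
  by rewrite subnK// (leq_trans (leq_addl g m.+1))// leq_pmull.
have gn : (g <= n)%N.
  by rewrite leq_subRL ?(leq_trans (leq_addl g m.+1)) ?leq_pmull// addnC leq_pmull.
have [tf te] := htheta n gn.
have EGK x : 0 <= \1_E x * G x <= K ^+ r.
  have /andP[a0 a1] := GK x; rewrite indicE; case: (_ \in _); rewrite ?mul1r ?mul0r ?a0//.
  by rewrite lexx ltW.
have := theta_mixing_bounded n m.+1 (expes y m) (fun x => \1_E x * G x) (K ^+ r) (ltn0Sn m) tf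
  (coord_expes S alpha phi hphi y m) (e01 m) (bex m).1 bEG.1 K0 EGK.
rewrite -iDn -/(lap y m) => h1.
have h2 := mean_E G (K ^+ r) mG K0 GK.
have h3 : mean P (fun x => \1_E x * G x) <= mean P G.
  apply: mean_le => // x; have /andP[a0 _] := GK x; rewrite indicE.
  by case: (_ \in _); rewrite ?mul1r ?mul0r.
have h4 : mean P G <= rho * (kappa + rho) ^+ r by have := IH 1%N isT; rewrite mul1n.
have h5 := IH i.+1 isT.
have l0 : 0 <= lap y m by apply: mean_ge0 => x; have /andP[] := e01 m x.
have t0 : 0 <= fine (theta_coef P mu S alpha n) by rewrite fine_ge0// theta_coef_ge0.
have h6 : 0 <= mean P G by apply: mean_ge0 => x; have /andP[] := GK x.
have h7 : lap y m * mean P (fun x => \1_E x * G x) <= lap y m * mean P G by exact: ler_wpM2l.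
have h8 : fine (theta_coef P mu S alpha n) * mean mu (fun x => \1_E x * G x) <= eps0 * (M * mean P G).
  apply: (le_trans (ler_wpM2l t0 h2)); apply: ler_wpM2r => //; exact: mulr_ge0 (ltW M0) h6.
rewrite exprS mulrCA mulrDl; apply: lerD; first by apply: ler_wpM2l h5; exact: ltW.
apply: (le_trans h1); apply: (le_trans (lerD h7 h8)).
rewrite mulrA -mulrDl -/rho; exact: ler_wpM2l.
Qed.

Lemma mean_block_product r : mean P (block_product r) <= (kappa + rho) ^+ r.
Proof.
elim: r => [|r IH]; first by rewrite expr0 /= mean_cst.
have bI : bmeas (fun x => expes y m x * block_product r (iter D S x)) by exact: bmeasM.
have -> : block_product r.+1 = (fun x => kappa * block_product r (iter D S x) +
   \1_E x * (expes y m x * block_product r (iter D S x))).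
  by apply/funext => x /=; ring.
rewrite meanD; [|exact: bmeasZ|by apply: bmeasM => //; exact: bmeas_indic].
rewrite meanZ// (mean_iter P S alpha hsys D _ (bmeas_block_product r)).
rewrite exprS mulrDl; apply: lerD; first by apply: ler_wpM2l => //; exact: ltW.
have := block_correlation r 1 isT; rewrite mul1n; apply: le_trans.
apply: mean_le => //; first by apply: bmeasM => //; exact: bmeas_indic.
move=> x; have /andP[a0 _] := e01 m x; have /andP[b0 _] := block_product_bounds r (iter D S x).
by rewrite indicE; case: (_ \in _); rewrite ?mul1r ?mul0r// mulr_ge0.
Qed.

Let bad (x : T) : R := \1_(~` E) x.

(** A block started in [E] has a factor at least [expes y m], hence at least [expes y D]. One
    started outside has the factor e^(-L), which is charged to the count of bad starts. *)
Lemma block_product_ge L r x : kappa = expR (- L) -> 0 <= L ->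
  expes y (r * D) x * expR (- (L * \sum_(j < r) bad (iter (j * D) S x))) <= block_product r x.
Proof.
move=> kL L0; elim: r x => [|r IH] x.
  by rewrite mul0n big_ord0 mulr0 oppr0 expR0 mulr1; have /andP[] := e01 0 x.
rewrite big_ord_recl mul0n /= mulSn expesD mulrDr opprD expRD mulrACA.
have -> : \sum_(i < r) bad (iter (bump 0 i * D) S x) = \sum_(j < r) bad (iter (j * D) S (iter D S x)).
  by apply: eq_bigr => j _; rewrite -iterD addnC -mulSn.
have /andP[a0 a1] := e01 D x; have /andP[c0 c1] := e01 (r * D) (iter D S x).
apply: ler_pM; rewrite ?mulr_ge0 ?expR_ge0//.
rewrite /bad !indicE in_setC; have /andP[b0 b1] := e01 m x; case: (_ \in _) => /=.
  rewrite mulr0 oppr0 expR0 mulr1 mul1r (@le_trans _ _ (expes y m x))//; last by rewrite lerDr ltW.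
  rewrite /expes ler_expR lerN2 ler_pM2r ?invr_gt0// ler_nat.
  by apply: es_le; rewrite /D addnS ltnW// ltnS leq_addl.
by rewrite mulr1 -kL mul0r addr0 ler_piMl// ltW.
Qed.

(** For a single phase all block starts may be bad. Over the [D] phases the starts run exactly once
    through the first [r * D] times, of which at most [eta * r * D] are bad. A period beyond [r]
    leaves room for the phase. *)
Lemma block_product_average L eta r n x : kappa = expR (- L) -> 0 <= L ->
  ((r.+1 * D) <= n)%N -> rarely_in S (~` E) eta x ->
  D%:R * (expes y n x * expR (- (L * (eta * r%:R)))) <= \sum_(i < D) block_product r (iter i S x).
Proof.
move=> kL L0 rD rare; have En0 : 0 <= expes y n x by have /andP[] := e01 n x.
pose Bi (i : nat) := \sum_(j < r) bad (iter (j * D) S (iter i S x)).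
have total : \sum_(i < D) Bi i = \sum_(k < r * D) bad (iter k S x).
  rewrite /Bi {Bi} exchange_big /=; elim: r {rD} => [|r IH]; first by rewrite mul0n !big_ord0.
  rewrite big_ord_recr /= IH mulSn addnC [in RHS]big_split_ord /=; congr (_ + _).
  by apply: eq_bigr => i _; rewrite -iterD.
have tot : \sum_(i < D) Bi i <= D%:R * (eta * r%:R).
  rewrite total; apply: (le_trans (visits_rarely S (~` E) eta (r * D) x rare)).
  by rewrite natrM; lra.
have step i : (i < D)%N ->
    expes y n x * (expR (- (L * (eta * r%:R))) * (1 - L * (Bi i - eta * r%:R))) <= block_product r (iter i S x).
  move=> iD; apply: (le_trans _ (block_product_ge L r (iter i S x) kL L0)).
  apply: (@le_trans _ _ (expes y n x * expR (- (L * Bi i)))).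
    apply: ler_wpM2l => //.
    (* Jensen's inequality through the tangent at the mean count [eta * r]: the lower bound is
       affine in [Bi i], so only the total over the phases matters. *)
    have -> : - (L * Bi i) = - (L * (eta * r%:R)) + - (L * (Bi i - eta * r%:R)) by ring.
    by rewrite expRD; apply: ler_wpM2l; [exact: expR_ge0|have := expR_ge1Dx (- (L * (Bi i - eta * r%:R)))].
  apply: ler_wpM2r; first exact: expR_ge0.
  rewrite /expes ler_expR lerN2 ler_pM2r ?invr_gt0// ler_nat.
  rewrite (@leq_trans (es (i + r * D) x))//; first by rewrite esD leq_addl.
  by apply: es_le; apply: leq_trans rD; rewrite mulSn leq_add2r ltnW.
apply: (@le_trans _ _ (\sum_(i < D) expes y n x * (expR (- (L * (eta * r%:R))) * (1 - L * (Bi i - eta * r%:R)))));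
  last by apply: ler_sum => i _; exact: step.
rewrite -!mulr_sumr [leLHS]mulrCA; apply: ler_wpM2l => //.
rewrite [leLHS]mulrC; apply: ler_wpM2l; first exact: expR_ge0.
rewrite sumrB -mulr_sumr sumrB !sumr_const card_ord -[X in _ <= X - _]mulr_natl mulr1.
rewrite -mulr_natl lerBrDr -lerBrDl subrr mulr_ge0_le0// subr_le0.
by rewrite (le_trans tot)// mulr_natl.
Qed.

(* Chernoff's bound, averaged over the [D] phases of the block decomposition. *)
Lemma rare_deviation L eta r n (c : R) : kappa = expR (- L) -> 0 <= L -> 0 < eta ->
  ((r.+1 * D) <= n)%N ->
  fine (P (rarely_in S (~` E) eta `&` [set x | (es n x)%:R <= c])) <=
    expR (c / y + L * (eta * r%:R)) * (kappa + rho) ^+ r.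
Proof.
move=> kL L0 eta0 rD.
have mSS : measurable_fun setT S by exact: (mSi 1).
have mEc : measurable (~` E) by exact: measurableC.
have mR : measurable (rarely_in S (~` E) eta) by exact: measurable_rarely.
have mC : measurable [set x | (es n x)%:R <= c].
  exact: (measurable_es_set P S alpha hsys phi hphi n [set k | k%:R <= c]).
rewrite -mean_indic; last exact: measurableI.
have D0 : 0 < D%:R :> R by rewrite ltr0n /D addnS.
rewrite -(ler_pM2l D0).
have bI : bmeas (\1_(rarely_in S (~` E) eta `&` [set x | (es n x)%:R <= c]) : T -> R).
  by apply: bmeas_indic; exact: measurableI.
have bS : bmeas (fun x => \sum_(i < D) block_product r (iter i S x)) by exact: bmeas_sum.
apply: (@le_trans _ _ (expR (c / y + L * (eta * r%:R)) * mean P (fun x => \sum_(i < D) block_product r (iter i S x)))).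
  rewrite -!meanZ//; apply: mean_le; [exact: bmeasZ|exact: bmeasZ|move=> x].
  have s0 : 0 <= \sum_(i < D) block_product r (iter i S x).
    by apply: sumr_ge0 => i _; have /andP[] := block_product_bounds r (iter i S x).
  rewrite indicE; case: (boolP (x \in _)) => [|_]; last by rewrite mulr0 mulr_ge0// expR_ge0.
  rewrite inE => -[/= rare hc].
  have := block_product_average L eta r n x kL L0 rD rare.
  move=> /(ler_wpM2l (expR_ge0 (c / y + L * (eta * r%:R)))); apply: le_trans.
  rewrite mulrCA ler_wpM2l ?(ltW D0)// mulrCA -expRD addrK.
  by rewrite /expes -expRD -[leLHS]expR0 ler_expR addrC subr_ge0 ler_pM2r ?invr_gt0.
rewrite [leRHS]mulrCA; apply: ler_wpM2l; first exact: expR_ge0.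
rewrite mean_sum//; apply: (@le_trans _ _ (\sum_(i < D) (kappa + rho) ^+ r)); last first.
  by rewrite sumr_const card_ord mulr_natl.
apply: ler_sum => i _; rewrite (mean_iter P S alpha hsys i _ (bmeas_block_product r)).
exact: mean_block_product.
Qed.

End block_products.

(** * The law of the iterated logarithm *)

Section liminf_one.
Context {R : realType}.

Lemma limn_einf_eq1 (u : nat -> R) :
  (forall e, 0 < e -> forall N, exists2 n, (N <= n)%N & u n <= 1 + e) ->
  (forall e, 0 < e -> exists N, forall n, (N <= n)%N -> 1 - e <= u n) ->
  limn_einf (fun n => (u n)%:E) = 1%E.
Proof.
move=> hle hge; rewrite limn_einf_lim.
have cv : cvgn (einfs (fun n => (u n)%:E)) by exact: is_cvg_einfs.
apply/eqP; rewrite eq_le; apply/andP; split.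
  apply/lee_addgt0Pr => e e0; apply: lime_le => //; apply: nearW => N.
  have [n Nn un] := hle e e0 N.
  apply: (@le_trans _ _ (u n)%:E); last by rewrite -EFinD lee_fin.
  by apply: ereal_inf_lbound; exists n.
apply/lee_subgt0Pr => e e0; apply: lime_ge => //.
have [N hN] := hge e e0; exists N => // k /= Nk.
apply: le_ereal_inf_tmp => _ [n /= kn <-].
by rewrite -EFinB lee_fin; apply: hN; exact: leq_trans kn.
Qed.

End liminf_one.

Section iterated_logarithm_growth.
Context {R : realType}.
Local Notation ll n := (ln (ln (n%:R : R))).

Lemma lnln_ge (M : R) : \forall n \near \oo, M <= ll n.
Proof.
apply: filterS (cvgy_ge _ (@cvgr_idn R) (expR (expR M))) => n h.
have n0 : 0 < n%:R :> R by apply: lt_le_trans h; exact: expR_gt0.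
have h1 : expR M <= ln n%:R.
  by rewrite -[leLHS]expRK ler_ln ?posrE ?expR_gt0.
by rewrite -[leLHS]expRK ler_ln ?posrE ?expR_gt0// (lt_le_trans (expR_gt0 _) h1).
Qed.

Lemma lnln_le (delta : R) : 0 < delta -> \forall n \near \oo, ll n <= delta * n%:R.
Proof.
move=> d0; apply: filterS (cvgy_ge _ (@cvgr_idn R) (expR (2 / delta))) => n h.
have n0 : 0 < n%:R :> R by apply: lt_le_trans h; exact: expR_gt0.
set y := ln n%:R.
have hy : 2 / delta <= y by rewrite -[leLHS]expRK /y ler_ln ?posrE ?expR_gt0.
have y0 : 0 < y by apply: lt_le_trans hy; rewrite divr_gt0.
have ny : n%:R = expR y by rewrite /y lnK.
have h1 : y ^+ 2 / 2 <= n%:R.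
  by have := expR_ge1Dxn 1 (ltW y0); rewrite -ny (_ : (2`! = 2)%N)// => h1; lra.
have h2 : ln y <= y by have := le_ln1Dx (x := y - 1); rewrite addrCA subrr addr0 => h2; lra.
apply: (le_trans h2); apply: (@le_trans _ _ (delta * (y ^+ 2 / 2))); last by rewrite ler_pM2l.
have : 2 <= y * delta by rewrite -ler_pdivrMr.
by rewrite expr2; nra.
Qed.

End iterated_logarithm_growth.

(** Here [l] is log log n. From n < (r + 2) D and D l <= (1 + delta/2) n one gets l < (r + 2)(1 +
    delta/2); multiplying by 1 - delta/2 gives (1 - delta/2) l <= r + 2, and the 2 is at most delta
    l / 2. *)
Lemma block_count_arith (R : realFieldType) (r D n g : nat) (m l delta : R) :
  0 < delta <= 1 -> 0 < l -> D%:R = g.+1%:R + m -> 0 < m * l -> m * l <= n%:R ->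
  g.+1%:R * l <= delta / 2 * n%:R -> 2 <= delta / 2 * l -> (n < r.+2 * D)%N ->
  (1 - delta) * l <= r%:R.
Proof.
move=> /andP[d0 d1] l0 eD ml0 ml gl l2 nD.
have n0 : 0 < n%:R :> R by exact: lt_le_trans ml.
have : n%:R * l < r.+2%:R * (D%:R * l).
  by rewrite mulrA ltr_pM2r// -natrM ltr_nat.
have Dl : D%:R * l <= (1 + delta / 2) * n%:R by rewrite eD mulrDl mulrDl mul1r addrC lerD.
have r0 : 0 <= r.+2%:R :> R by [].
move=> /lt_le_trans/(_ (ler_wpM2l r0 Dl)).
rewrite mulrA [X in _ < X]mulrC ltr_pM2l// => h.
have e : r.+2%:R = r%:R + 2 :> R by rewrite -addn2 natrD.
move: h; rewrite e => h.
have rr : 0 <= r%:R :> R by [].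
have h1 : (1 - delta / 2) * l <= r%:R + 2.
  have : (1 - delta / 2) * l <= (1 - delta / 2) * ((r%:R + 2) * (1 + delta / 2)).
    by apply: ler_wpM2l; [lra|exact: ltW].
  move=> /le_trans; apply.
  have -> : (1 - delta / 2) * ((r%:R + 2) * (1 + delta / 2)) = (r%:R + 2) * (1 - (delta / 2) ^+ 2).
    by ring.
  by apply: ler_piMr; [rewrite addr_ge0|rewrite gerBl sqr_ge0].
by lra.
Qed.

(** To leading order q = r = l and the exponent is -5 l. The relative error 1/lam in [q] costs less
    than l, and so does that in [r]. *)
Lemma chernoff_exponent (R : realFieldType) (lam q r l : R) : 8 < lam -> 0 < l ->
  q <= (1 + lam^-1) * l -> (1 - lam^-1) * l <= r ->
  (lam - 8) * q + r + (2 - lam) * r <= - (2 * l).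
Proof.
move=> l8 l0 hq hr; have lam0 : 0 < lam by lra.
have h1 : (lam - 8) * q <= (lam - 8) * ((1 + lam^-1) * l) by apply: ler_wpM2l => //; lra.
have h2 : (lam - 3) * ((1 - lam^-1) * l) <= (lam - 3) * r by apply: ler_wpM2l => //; lra.
have e1 : (lam - 8) * ((1 + lam^-1) * l) = (lam - 7 - 8 * lam^-1) * l.
  by field; rewrite gt_eqF.
have e2 : (lam - 3) * ((1 - lam^-1) * l) = (lam - 4 + 3 * lam^-1) * l.
  by field; rewrite gt_eqF.
have i0 : 0 < lam^-1 by rewrite invr_gt0.
have h3 : (lam - 7 - 8 * lam^-1) * l - (lam - 4 + 3 * lam^-1) * l <= - (2 * l).
  have -> : (lam - 7 - 8 * lam^-1) * l - (lam - 4 + 3 * lam^-1) * l = - (2 * l) - (1 + 11 * lam^-1) * l by ring.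
  by rewrite gerBl mulr_ge0//; lra.
have -> : (lam - 8) * q + r + (2 - lam) * r = (lam - 8) * q - (lam - 3) * r by ring.
lra.
Qed.

Section iterated_logarithm.
Context {d : measure_display} {T : measurableType d} {R : realType}.
Variables (P mu : probability T R) (S : T -> T) (alpha : set (set T)).
Variables (phi : T -> nat) (b : nat -> R).
Hypothesis hsys : probability_preserving_fibred_system P S alpha.
Hypothesis hmu : equivalent_measures mu P.
Hypothesis hmix : theta_mixing P mu S alpha.
Hypothesis phi_gt0 : forall x, (0 < phi x)%N.
Hypothesis hphi : partition_measurable alpha phi.
Hypothesis ha : regularly_varying (occupation P S phi) 1.
Hypothesis hadapted : adapted (occupation P S phi) (theta_coef P mu S alpha).
Hypothesis hb : asymp_inverse (occupation P S phi) b.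

Local Notation es := (ergodic_sum S phi).
Local Notation a := (occupation P S phi).
Local Notation lap := (lap P S phi).
Local Notation expes := (expes S phi).
Local Notation ll n := (ln (ln (n%:R : R))).

Let boo := inverse_cvgy P S alpha phi b hsys phi_gt0 hphi hb.

Lemma laplace_limit1 lam : 0 < lam -> lap (b n / lam) n @[n --> \oo] --> expR (- lam).
Proof.
move=> l0; have h1 : 0 < (1 : R) <= 1. by rewrite ltr01 lexx.
have := laplace_limit P mu S alpha phi 1 b hsys hmu hmix phi_gt0 hphi h1 ha hadapted hb lam l0.
by rewrite (Gamma_nat 1) (_ : (1`!)%:R = 1 :> R)// divr1 powRr1// ltW.
Qed.

(** Chebyshev for e^(-phi_n / b n): its second moment [V n] about e^(-1) vanishes by the Laplace
    limits at 2 and 1, and the event forces a distance [delta] from e^(-1). *)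
Lemma prob_above_cvg0 (e : R) : 0 < e ->
  fine (P [set x | (1 + e) * b n < (es n x)%:R]) @[n --> \oo] --> (0 : R).
Proof.
move=> e0; pose v := expR (- 1) : R; pose delta := v - expR (- (1 + e)).
have d0 : 0 < delta by rewrite subr_gt0 ltr_expR ltrN2 ltrDl.
pose V n := lap (b n / 2) n - 2 * v * lap (b n / 1) n + v ^+ 2.
have V0 : (delta ^+ 2)^-1 * V n @[n --> \oo] --> (0 : R).
  rewrite -[X in _ --> X](mulr0 (delta ^+ 2)^-1); apply: cvgMr.
  have -> : 0 = expR (- 2) - 2 * v * expR (- 1) + v ^+ 2.
    have -> : expR (- 2) = v ^+ 2 :> R by rewrite /v -expRM_natl mulrN mulr1.
    by rewrite -/v; ring.
  apply: cvgD; last exact: cvg_cst.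
  by apply: cvgB; [exact: laplace_limit1|apply: cvgMr; exact: laplace_limit1].
apply: (@squeeze_cvgr _ _ _ _ (cst 0) (fun n => (delta ^+ 2)^-1 * V n)) => //; last exact: cvg_cst.
apply: filterS (cvgy_ge _ boo 1) => n bn; have b0 : 0 < b n by exact: lt_le_trans bn.
apply/andP; split; first exact: fine_ge0.
have mA : measurable [set x | (1 + e) * b n < (es n x)%:R].
  exact: (measurable_es_set P S alpha hsys phi hphi n [set k | (1 + e) * b n < k%:R]).
have bX (y : R) : 0 < y -> bmeas (expes y n).
  by move=> y0; exact: (bmeas_expes P S alpha hsys phi hphi y n (ltW y0)).
have b20 : 0 < b n / 2 by rewrite divr_gt0.
have b10 : 0 < b n / 1 by rewrite divr_gt0.
have bD : bmeas (fun x => expes (b n / 2) n x - 2 * v * expes (b n / 1) n x).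
  by apply: bmeasB; [exact: bX|apply: bmeasZ; exact: bX].
have VE : V n = mean P (fun x => expes (b n / 2) n x - 2 * v * expes (b n / 1) n x + v ^+ 2).
  rewrite (meanD _ _ _ bD (bmeas_cst _)) (meanB _ _ _ (bX _ b20) (bmeasZ _ _ (bX _ b10))).
  by rewrite (meanZ _ _ _ (bX _ b10)) mean_cst.
have bV : bmeas (fun x => expes (b n / 2) n x - 2 * v * expes (b n / 1) n x + v ^+ 2).
  by apply: bmeasD => //; exact: bmeas_cst.
rewrite VE -mean_indic// -meanZ//; apply: mean_le; [exact: bmeas_indic|exact: bmeasZ|move=> x].
have -> : expes (b n / 2) n x - 2 * v * expes (b n / 1) n x + v ^+ 2 = (expes (b n / 1) n x - v) ^+ 2.
  have -> : expes (b n / 2) n x = expes (b n / 1) n x ^+ 2.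
    by rewrite /expes -expRM_natl; congr expR; field; rewrite gt_eqF.
  by ring.
rewrite indicE; case: (boolP (x \in _)) => [|_]; last by rewrite mulr_ge0 ?sqr_ge0// invr_ge0 sqr_ge0.
rewrite inE /= => h; rewrite -ler_pdivrMl ?invr_gt0 ?exprn_gt0// invrK mulr1 -[leRHS]sqrrN opprB.
apply: lerXn2r; rewrite ?nnegrE ?(ltW d0)//.
  have : expes (b n / 1) n x <= v; last by rewrite subr_ge0.
  rewrite ler_expR lerN2 divr1 ler_pdivlMr// mul1r ltW// (le_lt_trans _ h)// ler_peMl ?(ltW b0)// lerDl ltW//.
by rewrite lerB// ler_expR lerN2 divr1 ler_pdivlMr// ltW.
Qed.

Lemma negligible_above (e : R) : 0 < e ->
  P.-negligible [set x | exists N, forall n, (N <= n)%N -> (1 + e) * b n < (es n x)%:R].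
Proof.
move=> e0; pose A n := [set x | (1 + e) * b n < (es n x)%:R].
have mA n : measurable (A n).
  exact: (measurable_es_set P S alpha hsys phi hphi n [set k | (1 + e) * b n < k%:R]).
pose C N := \bigcap_(n in [set n | (N <= n)%N]) A n.
have mC N : measurable (C N) by apply: bigcap_measurable => //; exists N => /=.
have -> : [set x | exists N, forall n, (N <= n)%N -> (1 + e) * b n < (es n x)%:R] = \bigcup_N C N.
  apply/seteqP; split => x.
    by move=> [N h]; exists N => // n /= Nn; exact: h.
  by move=> [N _ h]; exists N => n Nn; exact: h.
apply: negligible_bigcup => N.
exists (C N); split => //.
suff fz : fine (P (C N)) = 0.
  by have := fineK (fin_num_measure P _ (mC N)); rewrite fz => /esym.
apply/eqP; rewrite eq_le fine_ge0// andbT.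
apply: (cvgr_to_ge (prob_above_cvg0 e e0)).
exists N => // n /= Nn; apply: (prob_fine_le P _ _ (mC N) (mA n)) => x h; exact: h.
Qed.

Hypothesis hlog : asymp_equiv (fun n => at_real b (n%:R / ll n : R) * ll n) b.

Lemma rare_lower_deviation (e eta0 : R) : 0 < e < 1 -> 0 < eta0 ->
  exists2 G : set T, measurable G /\ fine (P (~` G)) <= eta0 &
    \forall n \near \oo,
      fine (P (G `&` [set x | (es n x)%:R <= (1 - e) * b n])) <= expR (- (2 * ll n)).
Proof.
move=> /andP[e0 e1] eta00.
(* Chosen so that (1 - e) lam = lam - 8: a saving of 8 per block, from which all errors in the
   exponent are paid. *)
pose lam := 8 / e.
have lam8 : 8 < lam by rewrite /lam ltr_pdivlMr// gtr_pMr.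
have lam0 : 0 < lam by apply: lt_trans lam8.
have le8 : (1 - e) * lam = lam - 8 by rewrite /lam; field; rewrite gt_eqF.
have i0 : 0 < lam^-1 by rewrite invr_gt0.
have i1 : lam^-1 <= 1 by rewrite invf_le1// ltW// (lt_trans _ lam8)// ltr1n.
have [muP _] := hmu.
(* The factor 1/lam compensates the division by the visit rate 1/lam in the maximal inequality. *)
have [E [h [M [mE PE _ [M0 mh hM Eh]]]]] := bounded_density P mu (eta0 * lam^-1) muP (mulr_gt0 eta00 i0).
have mEc : measurable (~` E) by exact: measurableC.
have mS : measurable_fun setT S by exact: (fibred_miter P S alpha hsys 1).
have [_ SP] := hsys.
exists (rarely_in S (~` E) lam^-1).
  split; first exact: measurable_rarely.
  apply: (le_trans (maximal_inequality P S (~` E) lam^-1 mS SP mEc i0)).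
  by rewrite ler_pdivrMr.
pose v := expR (- lam) : R; have v0 : 0 < v by exact: expR_gt0.
(* [kappa = v], a Laplace transform at most 3v/2, and [eps0 * M = v / 2] add up to 3v <= e^(2 -
   lam). As [eps0] does not depend on [n], neither does the gap [g]. *)
pose eps0 := v / (2 * M).
have eps00 : 0 < eps0 by rewrite divr_gt0// mulr_gt0.
have /fine_cvgP[thf tht] : theta_coef P mu S alpha n @[n --> \oo] --> 0%E := hmix.
have [g htheta] : exists g, forall n, (g <= n)%N ->
    theta_coef P mu S alpha n \is a fin_num /\ fine (theta_coef P mu S alpha n) <= eps0.
  have : \forall n \near \oo, theta_coef P mu S alpha n \is a fin_num /\
      fine (theta_coef P mu S alpha n) <= eps0.
    near=> n; split; first by near: n.
    near: n; have /cvgrPdist_le/(_ _ eps00) := tht; apply: filterS => n /=.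
    by rewrite sub0r normrN; apply: le_trans; exact: ler_norm.
  by move=> [g _ hg]; exists g => n gn; exact: hg.
pose m n := Num.truncn (n%:R / ll n).
have moo : m n @[n --> \oo] --> \oo.
  apply: cvg_truncn; apply/cvgryPge => A.
  have A1 : 0 < (`|A| + 1)^-1 by rewrite invr_gt0 ltr_wpDl.
  apply: filterS2 (lnln_ge 1) (lnln_le _ A1) => n l1 lA.
  have l0 : 0 < ll n by exact: lt_le_trans l1.
  rewrite ler_pdivlMr//; apply: (@le_trans _ _ ((`|A| + 1) * ll n)).
    by rewrite ler_pM2r// (le_trans (ler_norm _))// lerDl.
  by rewrite -ler_pdivlMl// ltr_wpDl.
have lapm : \forall n \near \oo, lap (b (m n) / lam) (m n) <= 3 / 2 * v /\ 1 <= b (m n).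
  have : \forall k \near \oo, lap (b k / lam) k <= 3 / 2 * v /\ 1 <= b k.
    have v20 : 0 < v / 2 by rewrite divr_gt0.
    near=> k; split; last by near: k; exact: cvgy_ge.
    have : `|v - lap (b k / lam) k| <= v / 2.
      by near: k; have /cvgrPdist_le/(_ _ v20) := laplace_limit1 lam lam0.
    by rewrite ler_norml => /andP[+ _]; lra.
  by move=> hk; have := moo _ hk.
have bq : \forall n \near \oo, b n <= (1 + lam^-1) * (b (m n) * ll n).
  (* Half of w = 1/lam is enough, because (1 + w)(1 - w/2) >= 1 for 0 <= w <= 1. *)
  have d1 : 0 < lam^-1 / 2 by rewrite divr_gt0.
  have /cvgrPdist_le/(_ _ d1) := hlog; apply: filterS2 (cvgy_ge _ boo 1) => n bn.
  have b0 : 0 < b n by exact: lt_le_trans bn.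
  rewrite /at_real -/(m n); set z := b (m n) * ll n; rewrite ler_norml => /andP[_ h1].
  have h2 : (1 - lam^-1 / 2) * b n <= z by rewrite -ler_pdivlMr//; lra.
  have h3 : (1 + lam^-1) * ((1 - lam^-1 / 2) * b n) <= (1 + lam^-1) * z.
    by rewrite ler_pM2l//; lra.
  apply: le_trans h3; rewrite mulrA ler_peMl ?(ltW b0)//.
  move: i0 i1; move: lam^-1 => w i0 i1; nra.
have gl0 : 0 < lam^-1 / 2 / g.+1%:R by rewrite !divr_gt0.
near=> n.
have [lm bm] : lap (b (m n) / lam) (m n) <= 3 / 2 * v /\ 1 <= b (m n) by near: n.
have l2 : 2 <= lam^-1 / 2 * ll n.
  rewrite -ler_pdivrMl ?divr_gt0//; near: n; exact: lnln_ge.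
have l0 : 0 < ll n.
  by have := lt_le_trans (ltr0n _ 2) l2; rewrite pmulr_rgt0// divr_gt0.
have gl : g.+1%:R * ll n <= lam^-1 / 2 * n%:R.
  have h' : ll n <= lam^-1 / 2 / g.+1%:R * n%:R by near: n; exact: lnln_le.
  by rewrite -ler_pdivlMl// mulrA [g.+1%:R^-1 * _]mulrC.
have hq : b n <= (1 + lam^-1) * (b (m n) * ll n) by near: n.
have m1 : (0 < m n)%N by near: n; exact: (moo _ (nbhs_infty_gt 0%N)).
have mR : 0 < (m n)%:R :> R by rewrite ltr0n.
have ml0 : 0 < (m n)%:R * ll n by rewrite mulr_gt0.
have ml : (m n)%:R * ll n <= n%:R.
  by rewrite -ler_pdivlMr// truncn_le divr_ge0// ltW.
(* One of the [n %/ D] periods is given up to make room for the phase. *)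
pose D := (g + (m n).+1)%N; pose r := (n %/ D).-1.
have Dn : D%:R = g.+1%:R + (m n)%:R :> R by rewrite /D addnS -addSn natrD.
have n0 : 0 < n%:R :> R by exact: lt_le_trans ml.
have Dlen : (D <= n)%N.
  have l20 : 2 <= ll n by rewrite (le_trans l2)// ler_piMl ?(ltW l0)//; lra.
  have : D%:R * 2 <= n%:R * 2 :> R.
    apply: (@le_trans _ _ (D%:R * ll n)); first by rewrite ler_wpM2l.
    rewrite Dn mulrDl.
    have : lam^-1 / 2 * n%:R <= n%:R by rewrite ler_piMl ?(ltW n0)//; lra.
    lra.
  by rewrite ler_pM2r// ler_nat.
have D0 : (0 < D)%N by rewrite /D addnS.
have r1 : r.+1 = (n %/ D)%N by rewrite /r prednK// divn_gt0.
have rD : (r.+1 * D <= n)%N by rewrite r1 leq_divM.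
have nr : (n < r.+2 * D)%N by rewrite r1 ltn_ceil.
have hr : (1 - lam^-1) * ll n <= r%:R.
  by apply: (block_count_arith R r D n g (m n)%:R (ll n) lam^-1) => //; rewrite i0 i1.
have b0 : 0 < b (m n) by exact: lt_le_trans bm.
have y0 : 0 < b (m n) / lam by rewrite divr_gt0.
(* With [L = lam] and visit rate 1/lam, the bad starts add only [r] to the exponent. *)
have := rare_deviation P mu S alpha phi hsys hmu hphi E h M mE mh hM M0 Eh (b (m n) / lam) v (m n) g
  y0 v0 eps0 htheta lam lam^-1 r n ((1 - e) * b n) erefl (ltW lam0) i0 rD.
move=> /le_trans; apply.
have kr : v + (lap (b (m n) / lam) (m n) + eps0 * M) <= expR (2 - lam).
  have -> : eps0 * M = v / 2 by rewrite /eps0; field; rewrite gt_eqF.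
  apply: (@le_trans _ _ (3 * v)); first by lra.
  rewrite expRD -/v ler_pM2r//; have := expR_ge1Dx (2 : R); lra.
have kr0 : 0 <= v + (lap (b (m n) / lam) (m n) + eps0 * M).
  rewrite !addr_ge0 ?(ltW v0)//; last by rewrite mulr_ge0// ltW.
  by have /andP[] := lap01 P S alpha hsys phi hphi (b (m n) / lam) (m n) (ltW y0).
apply: (@le_trans _ _ (expR ((1 - e) * b n / (b (m n) / lam) + lam * (lam^-1 * r%:R)) * expR (2 - lam) ^+ r)).
  by apply: ler_wpM2l; [exact: expR_ge0|apply: lerXn2r; rewrite ?nnegrE ?expR_ge0].
rewrite -expRM_natl -expRD ler_expR.
have -> : (1 - e) * b n / (b (m n) / lam) + lam * (lam^-1 * r%:R) + r%:R * (2 - lam) =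
   (lam - 8) * (b n / b (m n)) + r%:R + (2 - lam) * r%:R.
  by rewrite -le8; field; rewrite !gt_eqF.
apply: chernoff_exponent => //.
by rewrite ler_pdivrMr// mulrAC -mulrA.
Unshelve. all: by end_near. Qed.

End iterated_logarithm.


(** Borel-Cantelli with a majorant of order j^(-2) that telescopes, so its partial sums are explicit
    and at most 1. The bound holds only eventually; a shift by [J] does not change the limsup. *)
Lemma lim_sup_negligible {d : measure_display} {T : measurableType d} {R : realType}
    (P : probability T R) (F : nat -> set T) (C : R) : (forall j, measurable (F j)) ->
  (\forall j \near \oo, fine (P (F j)) <= C * (j.+1%:R^-1 - j.+2%:R^-1)) ->
  P (lim_sup_set F) = 0%E.
Proof.
move=> mF [J _ hJ].
pose F' j := F (j + J)%N.
have C0 : 0 <= C.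
  have := hJ J (leqnn J); move=> h.
  have := le_trans (fine_ge0 (measure_ge0 P (F J))) h.
  rewrite pmulr_lge0// subr_gt0 ltf_pV2 ?posrE ?ltr0n// ltr_nat.
  exact: ltnSn.
have bnd j : fine (P (F' j)) <= C * (j.+1%:R^-1 - j.+2%:R^-1).
  apply: (le_trans (hJ (j + J)%N (leq_addl j J))); apply: ler_wpM2l => //.
  have e (k : nat) : k.+1%:R^-1 - k.+2%:R^-1 = (k.+1%:R * k.+2%:R)^-1 :> R.
    rewrite -[k.+2%:R]natr1; have k0 : 0 < k.+1%:R :> R by rewrite ltr0n.
    by field; apply/andP; split; rewrite gt_eqF// addr_gt0.
  rewrite !e lef_pV2 ?posrE ?mulr_gt0 ?ltr0n//.
  by apply: ler_pM; rewrite ?ler_nat ?ltnS ?leq_addr.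
have z : P (lim_sup_set F') = 0%E.
  apply: lim_sup_set_cvg0; first by move=> k; exact: mF.
  apply: (@le_lt_trans _ _ C%:E); last exact: ltry.
  apply: lime_le; first exact: is_cvg_nneseries.
  apply: nearW => K.
  rewrite (eq_bigr (fun j => (fine (P (F' j)))%:E)); last first.
    by move=> j _; rewrite fineK// fin_num_measure//; exact: mF.
  rewrite sumEFin lee_fin.
  apply: (@le_trans _ _ (\sum_(0 <= j < K) C * (j.+1%:R^-1 - j.+2%:R^-1))).
    by apply: ler_sum => j _; exact: bnd.
  rewrite -mulr_sumr -[leRHS]mulr1; apply: ler_wpM2l => //.
  have -> : \sum_(0 <= j < K) (j.+1%:R^-1 - j.+2%:R^-1) = 1 - K.+1%:R^-1 :> R.
    elim: K => [|K IH]; first by rewrite big_nil invr1 subrr.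
    by rewrite big_nat_recr//= IH addrA subrK.
  by rewrite gerBl invr_ge0.
rewrite -z; congr (P _); apply/seteqP; split => x h j _.
  by have [k /= jk Fk] := h (j + J)%N I; exists (k - J)%N; rewrite /= /F' ?subnK ?leq_subRL//;
    rewrite ?(leq_trans _ jk) ?leq_addl// addnC.
by have [k /= jk Fk] := h j I; exists (k + J)%N => //=; rewrite (leq_trans jk)// leq_addr.
Qed.

(** * Integer parts of a geometric sequence *)

Section geometric_subsequence.
Context {R : realType}.
Variable t : R.
Hypothesis t0 : 0 < t.

Definition geometric (j : nat) : nat := Num.truncn (expR (j%:R * t)).

(** The left side is (ln n)^(-2) at n = [geometric j], and ln n >= j t / 2 despite the rounding. The
    constant is 24 = 4 * 6, with (j + 1)(j + 2) <= 6 j^2. *)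
Lemma geometric_lnln : \forall j \near \oo,
  expR (- (2 * ln (ln (geometric j)%:R))) <= 24 / t ^+ 2 * (j.+1%:R^-1 - j.+2%:R^-1).
Proof.
near=> j.
have j0 : 0 < j%:R :> R by near: j; exact: near_nat_gt0.
have jt : 2 <= j%:R * t.
  by rewrite -ler_pdivrMr//; near: j; exact: (cvgy_ge _ (@cvgr_idn R)).
set s := j%:R * t in jt *.
have s2 : 0 < s / 2 by lra.
have n1 : expR (s / 2) <= (geometric j)%:R.
  have h1 : expR s = expR (s / 2) * expR (s / 2) by rewrite -expRD; congr expR; field.
  have h2 : 2 <= expR (s / 2) by have := expR_ge1Dx (s / 2); lra.
  have : expR s < (geometric j).+1%:R by rewrite truncnS_gt.
  rewrite -natr1 h1; have : 2 * expR (s / 2) <= expR (s / 2) * expR (s / 2) by rewrite ler_pM2r ?expR_gt0.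
  lra.
have y1 : s / 2 <= ln (geometric j)%:R.
  by rewrite -[leLHS]expRK ler_ln ?posrE ?expR_gt0// (lt_le_trans (expR_gt0 _) n1).
set y := ln _ in y1 *; have y0 : 0 < y by exact: lt_le_trans y1.
have -> : expR (- (2 * ln y)) = (y ^+ 2)^-1 by rewrite expRN expRM_natl lnK.
have jj : 1 <= j%:R :> R by move: j0; rewrite ltr0n ler1n.
have -> : j.+1%:R^-1 - j.+2%:R^-1 = ((j%:R + 1) * (j%:R + 2))^-1 :> R.
  rewrite -[j.+2%:R]natr1 -[j.+1%:R]natr1; field.
  by apply/andP; split; rewrite gt_eqF//; lra.
have j12 : 0 < (j%:R + 1) * (j%:R + 2) :> R by apply: mulr_gt0; lra.
apply: (@le_trans _ _ ((s / 2) ^+ 2)^-1).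
  by rewrite lef_pV2 ?posrE ?exprn_gt0//; apply: lerXn2r; rewrite ?nnegrE ?(ltW s2) ?(ltW y0).
have -> : ((s / 2) ^+ 2)^-1 = 24 / t ^+ 2 * (6 * j%:R ^+ 2)^-1.
  by rewrite /s; field; rewrite !gt_eqF.
apply: ler_wpM2l; first by rewrite divr_ge0 ?sqr_ge0.
rewrite lef_pV2 ?posrE ?mulr_gt0 ?exprn_gt0//.
by rewrite expr2; move: jj; move: (j%:R : R) => q q1; nra.
Unshelve. all: by end_near. Qed.

(** The exact powers have ratio e^t; a second factor e^t absorbs the rounding to integers. *)
Lemma geometric_dense (J : nat) : \forall n \near \oo,
  exists2 j, (J <= j)%N & (geometric j <= n)%N /\ n%:R <= expR t ^+ 2 * (geometric j)%:R.
Proof.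
have e1 : 0 < expR t - 1 by rewrite subr_gt0 -expR0 ltr_expR.
near=> n.
have n0 : 0 < n%:R :> R by near: n; exact: near_nat_gt0.
have nJ : expR (J%:R * t) <= n%:R by near: n; exact: (cvgy_ge _ (@cvgr_idn R)).
have nB : expR t * (2 + (expR t - 1)^-1) <= n%:R by near: n; exact: (cvgy_ge _ (@cvgr_idn R)).
have nL : 0 <= ln n%:R / t.
  rewrite divr_ge0 ?(ltW t0)// ln_ge0// ler1n; move: n0; by rewrite ltr0n.
pose j := Num.truncn (ln n%:R / t).
have /andP[j1 j2] := truncn_itv nL; rewrite -/j in j1 j2.
have Jj : (J <= j)%N.
  by rewrite truncn_ge_nat// ler_pdivlMr// -ler_expR lnK.
have a1 : expR (j%:R * t) <= n%:R by rewrite -[leRHS]lnK// ler_expR -ler_pdivlMr.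
have a2 : n%:R < expR (j%:R * t) * expR t.
  rewrite -expRD -[ltLHS]lnK// ltr_expR -[X in _ < _ + X]mul1r -mulrDl natr1 -ltr_pdivrMr//.
exists j => //.
have g1 : (geometric j)%:R <= expR (j%:R * t) by rewrite truncn_le expR_ge0.
have g2 : expR (j%:R * t) < (geometric j)%:R + 1 by rewrite natr1 truncnS_gt.
split; first by rewrite -(ler_nat R) (le_trans g1).
have et : 0 < expR t by exact: expR_gt0.
have a3 : n%:R < ((geometric j)%:R + 1) * expR t by apply: (lt_le_trans a2); rewrite ler_pM2r// ltW.
have g3 : (expR t - 1)^-1 <= (geometric j)%:R.
  have : expR t * (2 + (expR t - 1)^-1) < expR t * ((geometric j)%:R + 1).
    by apply: (le_lt_trans nB); rewrite mulrC.
  by rewrite ltr_pM2l//; lra.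
have g4 : 1 <= (geometric j)%:R * (expR t - 1) by rewrite -ler_pdivrMr// mul1r.
apply: (le_trans (ltW a3)).
rewrite expr2 -mulrA mulrC ler_pM2l//; lra.
Unshelve. all: by end_near. Qed.

End geometric_subsequence.

Section iterated_logarithm_limit.
Context {d : measure_display} {T : measurableType d} {R : realType}.
Variables (P mu : probability T R) (S : T -> T) (alpha : set (set T)).
Variables (phi : T -> nat) (b : nat -> R).
Hypothesis hsys : probability_preserving_fibred_system P S alpha.
Hypothesis hmu : equivalent_measures mu P.
Hypothesis hmix : theta_mixing P mu S alpha.
Hypothesis phi_gt0 : forall x, (0 < phi x)%N.
Hypothesis hphi : partition_measurable alpha phi.
Hypothesis ha : regularly_varying (occupation P S phi) 1.
Hypothesis hadapted : adapted (occupation P S phi) (theta_coef P mu S alpha).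
Hypothesis hb : asymp_inverse (occupation P S phi) b.

Local Notation es := (ergodic_sum S phi).
Local Notation a := (occupation P S phi).
Local Notation ll n := (ln (ln (n%:R : R))).

Let boo := inverse_cvgy P S alpha phi b hsys phi_gt0 hphi hb.

(* [b] need not be monotone, but [a] is. *)
Lemma inverse_quasi_monotone (q : R) : 1 < q -> \forall k \near \oo, forall n, (k <= n)%N ->
  n%:R <= q ^+ 2 * k%:R -> b n <= q ^+ 3 * b k.
Proof.
move=> q1; have q0 : 0 < q by exact: lt_trans q1.
have a_nd := occupation_nd P S alpha phi hsys phi_gt0 hphi.
have a_ge0 := occupation_ge0 P S phi.
have h1 : 0 < (1 : R) <= 1 by rewrite ltr01 lexx.
(* If b(n) exceeded q^3 b(k), then a(b(n)) >= a(q^3 b(k)) >= s k, with s < q^3 the index being 1.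
   But a(b(n)) <= s' n <= s' q^2 k < s k. *)
pose s := (q ^+ 2 + q ^+ 3) / 2; pose s' := (1 + s / q ^+ 2) / 2.
have q23 : q ^+ 2 < q ^+ 3 by rewrite [ltRHS]exprSr ltr_pMr// exprn_gt0.
have q20 : 0 < q ^+ 2 by exact: exprn_gt0.
have sq : 1 < s / q ^+ 2 by rewrite ltr_pdivlMr// mul1r /s; lra.
have s1 : 1 < s' by rewrite /s'; lra.
have s2 : s' * q ^+ 2 < s by rewrite -ltr_pdivlMr// /s'; lra.
have R1 := regvar_inverse a 1 b a_ge0 a_nd h1 ha hb.2 (q ^+ 3) (exprn_gt0 3 q0).
rewrite powRr1 in R1; last by rewrite exprn_ge0// ltW.
have d1 : 0 < q ^+ 3 - s by rewrite /s; lra.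
have d2 : 0 < s' - 1 by lra.
have N1 : \forall k \near \oo, s <= at_real a (q ^+ 3 * b k) / k%:R.
  have /cvgrPdist_le/(_ _ d1) := R1; apply: filterS => k.
  by rewrite ler_norml => /andP[_]; lra.
have [N2 _ hN2] : \forall k \near \oo, at_real a (b k) / k%:R <= s'.
  have /cvgrPdist_le/(_ _ d2) := hb.2; apply: filterS => k.
  by rewrite ler_norml => /andP[+ _]; lra.
near=> k => n kn nk; rewrite leNgt; apply/negP => hlt.
have k0 : 0 < k%:R :> R by near: k; exact: near_nat_gt0.
have n0 : 0 < n%:R :> R by apply: lt_le_trans k0 _; rewrite ler_nat.
have A1 : s * k%:R <= at_real a (q ^+ 3 * b k) by rewrite -ler_pdivlMr//; near: k.
have A2 : at_real a (q ^+ 3 * b k) <= at_real a (b n).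
  by apply: a_nd; apply: le_truncn; exact: ltW.
have A3 : at_real a (b n) <= s' * n%:R.
  rewrite -ler_pdivrMr//; apply: hN2 => /=; apply: leq_trans kn.
  by near: k; exact: nbhs_infty_ge.
have A4 : s' * n%:R <= s' * (q ^+ 2 * k%:R) by rewrite ler_pM2l// (lt_trans _ s1).
have A5 : s' * q ^+ 2 * k%:R < s * k%:R by rewrite ltr_pM2r.
by move: A4; rewrite mulrA; lra.
Unshelve. all: by end_near. Qed.

Hypothesis hlog : asymp_equiv (fun n => at_real b (n%:R / ll n : R) * ll n) b.

Lemma negligible_below (e : R) : 0 < e < 1 ->
  P.-negligible [set x | forall N, exists2 n, (N <= n)%N & (es n x)%:R <= (1 - e) * b n].
Proof.
move=> /andP[e0 e1].
pose e2 := e / 2; have e20 : 0 < e2 < 1 by rewrite /e2; lra.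
have /andP[e2a e2b] := e20.
(* Passing from [n] to the geometric index below it multiplies [b] by at most e^(3t). Taking e^(3t)
   = [w] turns 1 - e into exactly 1 - e/2. *)
pose w := (1 - e2) / (1 - e).
have w1 : 1 < w by rewrite /w ltr_pdivlMr ?mul1r /e2; lra.
pose t := ln w / 3; have t0 : 0 < t by rewrite divr_gt0// ln_gt0.
have q3 : expR t ^+ 3 = w by rewrite -expRM_natl /t mulrC divfK ?lnK ?posrE// (lt_trans _ w1).
have q1 : 1 < expR t by rewrite -expR0 ltr_expR.
pose F j := [set x | (es (geometric t j) x)%:R <= (1 - e2) * b (geometric t j)].
have mF j : measurable (F j).
  exact: (measurable_es_set P S alpha hsys phi hphi _ [set k | k%:R <= (1 - e2) * b (geometric t j)]).
have gy : geometric t j @[j --> \oo] --> \oo.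
  apply: cvg_truncn; apply/cvgryPge => A; apply: filterS (cvgy_ge _ (@cvgr_idn R) (A / t)) => j.
  rewrite ler_pdivrMr// => h; apply: (le_trans h).
  by have := expR_ge1Dx (j%:R * t); lra.
have mL : measurable (lim_sup_set F).
  by apply: bigcap_measurable => // j _; apply: bigcup_measurable => k _.
have PV : P (lim_sup_set F) = 0%E.
  suff fz : fine (P (lim_sup_set F)) = 0.
    by have := fineK (fin_num_measure P _ mL); rewrite fz => /esym.
  (* The deviation bound holds only inside a set [G] that depends on [eta]; Borel-Cantelli is
     applied in [G], and then [eta] is arbitrary. *)
  apply/eqP; rewrite eq_le fine_ge0// andbT; apply/ler_addgt0Pr => eta eta0; rewrite add0r.
  have [G [mG PG] dev] := rare_lower_deviation P mu S alpha phi b hsys hmu hmix phi_gt0 hphi ha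
    hadapted hb hlog e2 eta e20 eta0.
  pose F' j := G `&` F j.
  have mF' j : measurable (F' j) by exact: measurableI.
  have z : P (lim_sup_set F') = 0%E.
    apply: (lim_sup_negligible P F' (24 / t ^+ 2)) => //.
    apply: filterS2 (geometric_lnln t t0) (gy _ dev) => j h1 h2.
    exact: le_trans h2 h1.
  have mL' : measurable (lim_sup_set F').
    by apply: bigcap_measurable => // j _; apply: bigcup_measurable => k _.
  have sub : lim_sup_set F `<=` ~` G `|` lim_sup_set F'.
    move=> x hx; have [Gx|Gx] := pselect (G x); [right|by left].
    by move=> j _; have [k jk Fk] := hx j I; exists k.
  have mU : measurable (~` G `|` lim_sup_set F') by apply: measurableU => //; exact: measurableC.
  apply: (le_trans (prob_fine_le P _ _ mL mU sub)).
  have hh : (P (~` G `|` lim_sup_set F') <= P (~` G) + P (lim_sup_set F'))%E.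
    exact: measureU2 (measurableC mG) mL'.
  rewrite z adde0 in hh.
  apply: le_trans PG; apply: fine_le => //; apply: fin_num_measure => //; exact: measurableC.
exists (lim_sup_set F); split => // x hx J _.
have hQ := inverse_quasi_monotone (expR t) q1.
have [K _ hK] := hQ.
have [J' _ hJ'] : \forall j \near \oo, (K <= geometric t j)%N by exact: (gy _ (nbhs_infty_ge K)).
have [N _ hN] := geometric_dense t t0 (maxn J J').
have [n Nn hn] := hx N.
have [j Jj [gn ng]] := hN n Nn.
move: Jj; rewrite geq_max => /andP[Jj J'j].
exists j => //=; rewrite /F /=.
have bn := hK (geometric t j) (hJ' j J'j) n gn ng.
apply: (@le_trans _ _ (es n x)%:R); first by rewrite ler_nat; exact: es_le.
apply: (le_trans hn); apply: (@le_trans _ _ ((1 - e) * (expR t ^+ 3 * b (geometric t j)))).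
  by apply: ler_wpM2l => //; rewrite subr_ge0 ltW.
rewrite q3 mulrA /w [(1 - e) * _]mulrC divfK// gt_eqF// subr_gt0//.
Qed.

Lemma liminf_law : \forall x \ae P, limn_einf (fun n => ((es n x)%:R / b n)%:E) = 1%E.
Proof.
pose A k := [set x | exists N, forall n, (N <= n)%N -> (1 + k.+1%:R^-1) * b n < (es n x)%:R].
(* [k.+2], because [negligible_below] needs its parameter below 1. *)
pose B k := [set x | forall N, exists2 n, (N <= n)%N & (es n x)%:R <= (1 - k.+2%:R^-1) * b n].
have nA : P.-negligible (\bigcup_k A k).
  by apply: negligible_bigcup => k; apply: negligible_above hsys hmu hmix phi_gt0 hphi ha hadapted hb _ _; rewrite invr_gt0.
have nB : P.-negligible (\bigcup_k B k).
  apply: negligible_bigcup => k; apply: negligible_below.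
  by rewrite invr_gt0 ltr0n /= invf_lt1 ?ltr0n// ltr1n.
apply: negligibleS (negligibleU nA nB) => x /= hx.
apply: contrapT => /not_orP[hA hB]; apply: hx.
have [N0 _ b0] := cvgy_ge _ boo 1.
have bp n : (N0 <= n)%N -> 0 < b n by move=> h; exact: lt_le_trans (b0 n h).
have small (e : R) : 0 < e -> exists k : nat, k.+1%:R^-1 <= e.
  move=> e0; exists (Num.truncn e^-1); rewrite invf_ple ?posrE// ltW//; exact: truncnS_gt.
apply: limn_einf_eq1 => e e0.
  move=> N; have [k ke] := small e e0.
  apply: contrapT => h; apply: hA; exists k => //; exists (maxn N N0) => n.
  rewrite geq_max => /andP[Nn N0n]; rewrite ltNge; apply/negP => hn; apply: h; exists n => //.
  rewrite ler_pdivrMr ?bp//; apply: (le_trans hn); by rewrite ler_pM2r ?bp// lerD2l.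
have [k ke] := small e e0.
have /existsNP[N hN] : ~ B k x by move=> h; apply: hB; exists k.
exists (maxn N N0) => n; rewrite geq_max => /andP[Nn N0n].
rewrite ler_pdivlMr ?bp//; have : (1 - k.+2%:R^-1) * b n <= (es n x)%:R.
  by rewrite leNgt; apply/negP => h; apply: hN; exists n => //; exact: ltW.
apply: le_trans; rewrite ler_pM2r ?bp//.
rewrite lerD2l lerN2; apply: le_trans ke.
by rewrite lef_pV2 ?posrE ?ltr0n// ler_nat.
Qed.

End iterated_logarithm_limit.


Theorem theorem2p1 (R : realType) (d : measure_display) (T : measurableType d)
    (P mu : probability T R) (S : T -> T) (alpha : set (set T))
    (phi : T -> nat) (gamma : R) (b : nat -> R)
    (hsys : probability_preserving_fibred_system P S alpha)
    (hmu : equivalent_measures mu P)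
    (hmix : theta_mixing P mu S alpha)
    (phi_gt0 : forall x, (0 < phi x)%N)
    (hphi : partition_measurable alpha phi)
    (hgamma : 0 < gamma <= 1)
    (ha : regularly_varying (occupation P S phi) gamma)
    (hadapted : adapted (occupation P S phi) (theta_coef P mu S alpha))
    (hb : asymp_inverse (occupation P S phi) b) :
  (forall (d' : measure_display) (W : measurableType d')
      (P' : probability W R) (Y : {RV P' >-> R}),
    mittag_leffler Y gamma ->
    strongly_converges P
      (fun n x => ((ergodic_sum S phi n x)%:R / b n)%:E)
      P' (stable_of Y gamma)) /\
  (gamma = 1 ->
    asymp_equiv
      (fun n => at_real b (n%:R / ln (ln n%:R) : R) * ln (ln n%:R)) b ->
    \forall x \ae P,
      limn_einf (fun n => ((ergodic_sum S phi n x)%:R / b n)%:E) = 1%E).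

Proof.
split.
  move=> d' W P' Y; exact: (stable_limit P mu S alpha phi gamma b hsys hmu hmix phi_gt0 hphi
    hgamma ha hadapted hb).
move=> g1; rewrite g1 in ha => hlog.
exact: (liminf_law P mu S alpha phi b hsys hmu hmix phi_gt0 hphi ha hadapted hb hlog).
Qed.
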